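(* Let $\rho$ be a bounded probability density on $\mathbb{R}$ such that $\mathbb{P}[|X|>M_\rho]\le\theta$ for $X\sim\rho$, where $M_\rho>0$ and $\theta\in(0,1)$. Let $(A,B)$ be an $n\times n$ definite pencil with $\|A\|_2,\|B\|_2\le1$, and let $(\widetilde A,\widetilde B)=(A+\mu D_1^\rho,\,B+\mu D_2^\rho)$ for independent diagonal random matrices $D_1^\rho,D_2^\rho$ and $0<\mu<\frac{\gamma(A,B)}{2\sqrt2M_\rho}$. Set $\omega=\frac{\mu^3\gamma(A,B)^2}{n^5}$, choose $z_0$ uniformly at random in $\left(-\frac{3n^2}{2\mu}-\omega,-\frac{3n^2}{2\mu}\right)$ (independently of $D_1^\rho,D_2^\rho$), let $g=\{z_0+j\omega:0\le j\le\lceil\frac{3n^2}{\mu\omega}\rceil+1\}$, and let $\epsilon=\frac{\mu^6\gamma(A,B)^2}{6n^{11}}$. Then $\Lambda^{\mathrm{sym}}_\epsilon(\widetilde A,\widetilde B)$ is shattered with respect to $g$ with probability at least $$\left(1-\frac{C\|\rho\|_\infty^2}{n}\right)\cdot\left(1-2n\theta-\frac{2\|\rho\|_\infty}{n}\right),$$ where $C<\infty$ is an absolute constant.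
   Context: A pencil $(A,B)$ of $n\times n$ complex matrices is definite if $A,B$ are Hermitian and its Crawford number $\gamma(A,B)=\min_{\|x\|_2=1}|x^H(A+iB)x|$ is positive. Eigenvalues of a pencil are the roots $z$ of $\det(A-zB)=0$, counted with multiplicity. A probability density $\rho$ on $\mathbb{R}$ is bounded if $\|\rho\|_\infty:=\sup_x\rho(x)<\infty$; the associated diagonal random matrix $D^\rho$ is the $n\times n$ diagonal matrix whose diagonal entries are i.i.d. with density $\rho$. For a Hermitian pencil and $\epsilon>0$, $\Lambda^{\mathrm{sym}}_\epsilon(A,B)=\{z\in\mathbb{C}:(A+E)u=z(B+F)u$ for some $u\neq0$ and Hermitian $E,F$ with $\sqrt{\|E\|_2^2+\|F\|_2^2}\le\epsilon\}$. For a finite set of reals $g=\{g_1<g_2<\dots\}$, $\Lambda^{\mathrm{sym}}_\epsilon(A,B)$ is shattered with respect to $g$ if every eigenvalue of $(A,B)$ lies in an open interval $(g_i,g_{i+1})$ between consecutive points of $g$, no two eigenvalues (with multiplicity) in the same interval, and $\Lambda^{\mathrm{sym}}_\epsilon(A,B)\cap g=\emptyset$. *)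

(* Defs.v *)
From HB Require Import structures.
From mathcomp Require Import all_boot all_order all_algebra.
From mathcomp Require Import all_classical all_reals all_analysis.
From mathcomp Require Export complex.
Import Order.TTheory GRing.Theory Num.Theory.

Set Implicit Arguments.
Unset Strict Implicit.
Unset Printing Implicit Defensive.

Local Open Scope ring_scope.
Local Open Scope classical_set_scope.

Section PencilDefs.
Variable R : realType.
Local Notation C := (R[i]).
Local Notation normc := (@ComplexField.Normc.normc R).

Definition cR (r : R) : C := (r%:C)%C.

Definition cvnorm n (x : 'cV[C]_n) : R :=
  Num.sqrt (\sum_(i < n) normc (x i 0) ^+ 2).

Definition specnorm n (A : 'M[C]_n) : R :=
  sup [set cvnorm (A *m x) | x in [set x : 'cV[C]_n | cvnorm x = 1]].

Definition mxadj m n (A : 'M[C]_(m, n)) : 'M[C]_(n, m) :=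
  (map_mx (@conjc R) A)^T.

Definition hermitian n (A : 'M[C]_n) : Prop := mxadj A = A.

Definition crawford n (A B : 'M[C]_n) : R :=
  inf [set normc ((mxadj x *m (A + 'i%C *: B) *m x) 0 0)
      | x in [set x : 'cV[C]_n | cvnorm x = 1]].

Definition definite_pencil n (A B : 'M[C]_n) : Prop :=
  hermitian A /\ hermitian B /\ 0 < crawford A B.

(* det(A - zB) as a polynomial in z; eigenvalues = its roots,
   multiplicity = root multiplicity *)
Definition pencil_poly n (A B : 'M[C]_n) : {poly C} :=
  \det (map_mx polyC A - 'X *: map_mx polyC B).

Definition sym_pseudospec n (eps : R) (A B : 'M[C]_n) : set C :=
  [set z | exists (u : 'cV[C]_n) (E F : 'M[C]_n),
      [/\ u != 0, hermitian E, hermitian F,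
          Num.sqrt (specnorm E ^+ 2 + specnorm F ^+ 2) <= eps &
          (A + E) *m u = z *: ((B + F) *m u)]].

Definition in_gap (g : seq R) (i : nat) (z : C) : Prop :=
  exists r : R, z = cR r /\ g`_i < r < g`_i.+1.

Definition shattered n (eps : R) (A B : 'M[C]_n) (g : seq R) : Prop :=
  let p := pencil_poly A B in
  [/\ (forall z, root p z -> exists2 i, (i.+1 < size g)%N & in_gap g i z),
      (forall i z, (i.+1 < size g)%N -> root p z -> in_gap g i z ->
         mup z p = 1%N /\
         (forall z', root p z' -> in_gap g i z' -> z' = z)) &
      (forall j, (j < size g)%N -> ~ sym_pseudospec eps A B (cR g`_j))].

Definition rdiag n (d : nat -> R) : 'M[C]_n := diag_mx (\row_(i < n) cR (d i)).

Definition is_density (rho : R -> R) : Prop :=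
  [/\ measurable_fun setT rho, (forall x, 0 <= rho x) &
      (\int[lebesgue_measure]_x (rho x)%:E = 1)%E].

Definition ubounded_density (rho : R -> R) : Prop := exists M : R, forall x, rho x <= M.

Definition supnorm (rho : R -> R) : R := sup (range rho).

Fixpoint iint (k : nat) (f : seq R -> \bar R) : \bar R :=
  match k with
  | 0 => f [::]
  | k'.+1 => (\int[lebesgue_measure]_x iint k' (fun s => f (x :: s)))%E
  end.

Definition grid (z0 w : R) (K : nat) : seq R :=
  [seq z0 + j%:R * w | j <- iota 0 K.+2].

(* Probability of the shattering event in Theorem 3.9.
   Sample space R^(2n+1): s_0..s_(n-1) = diagonal of D_1, s_n..s_(2n-1) =
   diagonal of D_2 (all i.i.d. with density rho), s_(2n) = z0, uniform on
   (a - w, a) and independent of the others. *)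
Definition shatter_prob n (rho : R -> R) (mu : R) (A B : 'M[C]_n) : \bar R :=
  let g := crawford A B in
  let w := mu ^+ 3 * g ^+ 2 / (n%:R ^+ 5) in
  let a := - (3 * n%:R ^+ 2 / (2 * mu)) in
  let K := `|Num.ceil (3 * n%:R ^+ 2 / (mu * w))|%N in
  let eps := mu ^+ 6 * g ^+ 2 / (6 * n%:R ^+ 11) in
  let event (s : seq R) : Prop :=
    shattered eps (A + cR mu *: rdiag n (fun i => s`_i))
                  (B + cR mu *: rdiag n (fun i => s`_(n + i)))
                  (grid s`_(n + n) w K) in
  iint (n + n).+1 (fun s =>
    ((if `[< event s >] then 1 else 0)
     * (\prod_(i < n + n) rho s`_i)
     * (if `[< a - w < s`_(n + n) < a >] then w^-1 else 0))%:E).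

End PencilDefs.

(* Main.v *)
Require Import Defs.
From HB Require Import structures.
From mathcomp Require Import all_boot all_order all_algebra.
From mathcomp Require Import all_classical all_reals all_analysis.
From mathcomp Require Import measurable_realfun complex ring lra.
Import Order.TTheory GRing.Theory Num.Theory.
Local Open Scope ring_scope.
Local Open Scope classical_set_scope.

Set Implicit Arguments.
Unset Strict Implicit.
Unset Printing Implicit Defensive.

(* The bound holds with C = 0: one shows that shattering fails with probability at most
   2 n theta + 2 sup(rho) / n. Write H(x) = A~ - x B~ and let nu be the negative index of inertia.
   A definite pencil is diagonalized by a congruence, so each way of failing is a jump of nu:
   a grid point in the pseudospectrum makes nu jump between H(x) + eta and H(x) - eta, two
   eigenvalues in one cell make nu(H) change by 2 between its end points, and an eigenvalue beyond
   the grid makes the inertia of B~ unstable under a small multiple of A~. Performing a diagonal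
   shift site by site splits a jump into n unit steps. As a function of its own diagonal entry,
   with the others frozen, a step occurs only in a window as wide as the shift, so it has
   probability at most sup(rho) times that width (Wegner). For two eigenvalues in a cell the first
   step is integrated out in this way while the second survives resampling (Minami), and over all
   cells the index changes at most n times. Conditioning on all |d_i| <= M costs 2 n theta.
   The numerical constant 2 leaves no room in the bound for eigenvalues beyond the grid, whence the
   case distinction in outside_choice. *)

(** * Hermitian forms *)

(** The index replaces the eigenvalues because it is monotone in the form, moves by at most one when
    one diagonal entry moves, and is lower semicontinuous, hence measurable without a selection of
    eigenvalues. Every failure is bounded by the expectation of a count of unit steps. These counts
    are measurable; the shattering event only enters on the larger side of a comparison of
    integrals, which holds for arbitrary nonnegative functions. At a grid point the shift grows like
    [max(1,|x|)]. So does the influence of the randomness, if the entry of [D_1] is used for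
    [|x| <= 1] and that of [D_2] otherwise. Let [t = mu M], [r = sup(rho)], and let [p] be the mass
    kept on [[-M, M]]. In units of [r/(n p)] the budget is 2; an eigenvalue beyond the grid costs
    [4/3 (1 + t) - 2/3 p mu/r] or [2/3 (1 + t)], the grid points about [sqrt(2) mu/n^2], the cells
    [(1 + t)/2 (gamma mu/n)^2]. Since only [t < 1/2] is known, [4/3 (1 + t)] alone can come
    arbitrarily close to 2. The saving [2/3 p mu/r] comes from averaging over [D_1]. *)

Section HermitianForms.
Variable R : realType.
Local Notation C := (R[i]).
Local Notation hermitian := Defs.hermitian.
Local Notation normc := (@ComplexField.Normc.normc R).

Definition sform n (H : 'M[C]_n) (u v : 'cV[C]_n) : C :=
  (mxadj u *m H *m v) 0 0.
Definition qform n (H : 'M[C]_n) (u : 'cV[C]_n) : R := complex.Re (sform H u u).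
Definition sqn n (u : 'cV[C]_n) : R := \sum_(i < n) normc (u i 0) ^+ 2.

Lemma normc_sqr (z : C) : normc z ^+ 2 = complex.Re z ^+ 2 + complex.Im z ^+ 2.
Proof. by case: z => x y /=; rewrite sqr_sqrtr // addr_ge0 // sqr_ge0. Qed.

Lemma normc_ge0 (z : C) : 0 <= normc z.
Proof. by case: z => x y /=; exact: sqrtr_ge0. Qed.

Lemma conjcM_normc (z : C) : conjc z * z = cR (normc z ^+ 2).
Proof.
rewrite normc_sqr; case: z => x y /=; rewrite /cR.
apply/eqP; rewrite eq_complex /=; apply/andP; split; apply/eqP; ring.
Qed.

Lemma mxadjM m n p (A : 'M[C]_(m, n)) (B : 'M[C]_(n, p)) :
  mxadj (A *m B) = mxadj B *m mxadj A.
Proof. by rewrite /mxadj map_mxM trmx_mul. Qed.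

Lemma mxadjD m n (A B : 'M[C]_(m, n)) : mxadj (A + B) = mxadj A + mxadj B.
Proof. by rewrite /mxadj map_mxD linearD. Qed.

Lemma mxadjB m n (A B : 'M[C]_(m, n)) : mxadj (A - B) = mxadj A - mxadj B.
Proof. by rewrite /mxadj map_mxB linearB. Qed.

Lemma mxadjZ m n (a : C) (A : 'M[C]_(m, n)) : mxadj (a *: A) = conjc a *: mxadj A.
Proof. by rewrite /mxadj map_mxZ linearZ. Qed.

Lemma mxadjK m n (A : 'M[C]_(m, n)) : mxadj (mxadj A) = A.
Proof. by apply/matrixP => i j; rewrite !mxE conjcK. Qed.

Lemma mxadj_col n m1 m2 (A : 'M[C]_(n, m1)) (B : 'M[C]_(n, m2)) :
  mxadj (row_mx A B) = col_mx (mxadj A) (mxadj B).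
Proof. by rewrite /mxadj map_row_mx tr_row_mx. Qed.

Lemma cRD : {morph @cR R : x y / x + y}.
Proof. by move=> x y; rewrite /cR rmorphD. Qed.
Lemma cRM : {morph @cR R : x y / x * y}.
Proof. by move=> x y; rewrite /cR rmorphM. Qed.
Lemma cRN : {morph @cR R : x / - x}.
Proof. by move=> x; rewrite /cR rmorphN. Qed.

Lemma hermitian1 n : hermitian (1%:M : 'M[C]_n).
Proof. by rewrite /hermitian /mxadj map_mx1 trmx1. Qed.
Lemma hermitianD n (A B : 'M[C]_n) : hermitian A -> hermitian B -> hermitian (A + B).
Proof. by rewrite /hermitian mxadjD => -> ->. Qed.
Lemma hermitianZ n (a : R) (A : 'M[C]_n) : hermitian A -> hermitian (cR a *: A).
Proof. by rewrite /hermitian mxadjZ conjc_real => ->. Qed.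
Lemma hermitianB n (A B : 'M[C]_n) : hermitian A -> hermitian B -> hermitian (A - B).
Proof. by rewrite /hermitian mxadjB => -> ->. Qed.
Lemma hermitian_rdiag n (d : nat -> R) : hermitian (rdiag n d).
Proof.
rewrite /hermitian; apply/matrixP => i j; rewrite !mxE eq_sym.
by case: eqP => [->|_]; rewrite ?mulr1n ?mulr0n ?conjc_real ?conjc0.
Qed.

Lemma sform_conj n (H : 'M[C]_n) u v : hermitian H ->
  sform H v u = conjc (sform H u v).
Proof.
move=> hH; rewrite /sform.
have -> : mxadj v *m H *m u = mxadj (mxadj u *m H *m v).
  by rewrite !mxadjM mxadjK hH mulmxA.
by rewrite !mxE.
Qed.

Lemma sformDr n (H : 'M[C]_n) u v w : sform H u (v + w) = sform H u v + sform H u w.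
Proof. by rewrite /sform mulmxDr mxE. Qed.
Lemma sformDl n (H : 'M[C]_n) u v w : sform H (u + v) w = sform H u w + sform H v w.
Proof. by rewrite /sform mxadjD !mulmxDl mxE. Qed.
Lemma sformZr n (H : 'M[C]_n) a u v : sform H u (a *: v) = a * sform H u v.
Proof. by rewrite /sform -scalemxAr mxE. Qed.
Lemma sformZl n (H : 'M[C]_n) a u v : sform H (a *: u) v = conjc a * sform H u v.
Proof. by rewrite /sform mxadjZ -!scalemxAl mxE. Qed.
Lemma sform_addm n (H K : 'M[C]_n) u v : sform (H + K) u v = sform H u v + sform K u v.
Proof. by rewrite /sform mulmxDr mulmxDl mxE. Qed.
Lemma sform_scalem n a (H : 'M[C]_n) u v : sform (a *: H) u v = a * sform H u v.
Proof. by rewrite /sform -scalemxAr -scalemxAl mxE. Qed.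

Lemma sform_real n (H : 'M[C]_n) u : hermitian H -> sform H u u = cR (qform H u).
Proof.
move=> /(@sform_conj n H u u); rewrite /qform; case: (sform H u u) => x y /= [].
move=> h; rewrite /cR; apply/eqP; rewrite eq_complex /= eqxx /=; apply/eqP; lra.
Qed.

Lemma qformDm n (H K : 'M[C]_n) u : qform (H + K) u = qform H u + qform K u.
Proof. by rewrite /qform sform_addm raddfD. Qed.
Lemma qformZm n (a : R) (H : 'M[C]_n) u : qform (cR a *: H) u = a * qform H u.
Proof.
by rewrite /qform sform_scalem; case: (sform H u u) => x y /=; rewrite mul0r subr0.
Qed.
Lemma qformNm n (H : 'M[C]_n) u : qform (- H) u = - qform H u.
Proof.
have -> : - H = cR (-1) *: H by rewrite cRN scaleNr scale1r.
by rewrite qformZm mulN1r.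
Qed.
Lemma qformBm n (H K : 'M[C]_n) u : qform (H - K) u = qform H u - qform K u.
Proof. by rewrite qformDm qformNm. Qed.

Lemma qform0 n (H : 'M[C]_n) : qform H 0 = 0.
Proof. by rewrite /qform /sform mulmx0 mxE. Qed.

Lemma qformZ n (H : 'M[C]_n) (a : C) u : qform H (a *: u) = normc a ^+ 2 * qform H u.
Proof.
rewrite /qform sformZl sformZr mulrA conjcM_normc.
by case: (sform H u u) => x y /=; rewrite mul0r subr0.
Qed.

Lemma qformD n (H : 'M[C]_n) u v : hermitian H ->
  qform H (u + v) = qform H u + qform H v + 2 * complex.Re (sform H u v).
Proof.
move=> hH; rewrite /qform sformDl !sformDr (sform_conj u v hH).
case: (sform H u u) => a b; case: (sform H v v) => c d; case: (sform H u v) => x y /=.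
ring.
Qed.

Lemma sform1 n u v : sform (1%:M : 'M[C]_n) u v = \sum_i conjc (u i 0) * v i 0.
Proof. by rewrite /sform mulmx1 mxE; apply: eq_bigr => i _; rewrite !mxE. Qed.

Lemma sqn_qform n (u : 'cV[C]_n) : sqn u = qform 1%:M u.
Proof.
rewrite /qform sform1 (raddf_sum (@complex.Re R)); apply: eq_bigr => i _.
by rewrite conjcM_normc.
Qed.

Lemma sqn_ge0 n (u : 'cV[C]_n) : 0 <= sqn u.
Proof. by apply: sumr_ge0 => i _; exact: sqr_ge0. Qed.

Lemma sqn_eq0 n (u : 'cV[C]_n) : (sqn u == 0) = (u == 0).
Proof.
rewrite /sqn psumr_eq0 => [|i _]; last exact: sqr_ge0.
apply/allP/eqP => [h|-> i _]; last by rewrite mxE ComplexField.Normc.normc0 expr0n /= eqxx.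
apply/matrixP => i j; rewrite ord1 mxE; apply: ComplexField.Normc.eq0_normc.
by apply/eqP; have := h i (mem_index_enum _); rewrite sqrf_eq0.
Qed.

Lemma sqn_gt0 n (u : 'cV[C]_n) : (0 < sqn u) = (u != 0).
Proof. by rewrite lt_def sqn_ge0 andbT sqn_eq0. Qed.

Lemma qform_rdiag n (d : nat -> R) (u : 'cV[C]_n) :
  qform (rdiag n d) u = \sum_(i < n) d i * normc (u i 0) ^+ 2.
Proof.
rewrite /qform /sform -mulmxA mul_diag_mx mxE (raddf_sum (@complex.Re R)).
apply: eq_bigr => i _; rewrite !mxE mulrCA conjcM_normc -[cR _ * _]cRM.
by [].
Qed.

Lemma qform_congr n m (H : 'M[C]_n) (S : 'M[C]_(n, m)) x :
  qform (mxadj S *m H *m S) x = qform H (S *m x).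
Proof. by rewrite /qform /sform mxadjM !mulmxA. Qed.

End HermitianForms.

(** * Simultaneous diagonalization of definite pencils *)

(** Rank-nullity with subspaces represented as ranges of injective matrices: intersecting the range
    of [V] with linear conditions becomes a product [V *m K]. The dimension counts for the index use
    it in this form. *)
Lemma kernel_columns (F : fieldType) m p k (M : 'M[F]_(p, m)) : (k + p <= m)%N ->
  exists2 K : 'M[F]_(m, k), (M *m K = 0) & (forall x : 'cV_k, K *m x = 0 -> x = 0).
Proof.
move=> kpm; set N := kermx M^T.
have rN : (k <= \rank N)%N.
  rewrite mxrank_ker leq_subRL; last by rewrite rank_leq_row.
  by rewrite addnC (leq_trans _ kpm) // leq_add2l rank_leq_col.
have free : row_free (pid_mx k *m row_base N : 'M[F]_(k, m)).
  rewrite /row_free mxrankMfree ?row_base_free //.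
  by rewrite rank_pid_mx.
exists (pid_mx k *m row_base N : 'M[F]_(k, m))^T.
  apply: trmx_inj; rewrite trmx_mul trmxK trmx0 -mulmxA.
  have /sub_kermxP -> : (row_base N <= kermx M^T)%MS by rewrite eq_row_base.
  by rewrite mulmx0.
move=> x /(congr1 trmx); rewrite trmx_mul trmxK trmx0 => h.
apply: trmx_inj; rewrite trmx0; apply: (row_free_inj free).
by rewrite h mul0mx.
Qed.

Section SimultaneousDiagonalization.
Variable R : realType.
Local Notation C := (R[i]).
Local Notation hermitian := Defs.hermitian.

(** The eigenvalue is kept homogeneous, as the pair [a], [b], because [B] may be singular; a kernel
    vector of [B] then serves as an eigenvector at infinity. Otherwise algebraic closedness gives a
    row eigenvector of [B^-1 A], and taking adjoints turns it into a column. *)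
Lemma pencil_eigenvector n (A B : 'M[C]_n.+1) : hermitian A -> hermitian B ->
  exists (u w : 'cV[C]_n.+1) (a b : C), [/\ u != 0, A *m u = a *: w & B *m u = b *: w].
Proof.
move=> hA hB.
have adj0 (v : 'rV[C]_n.+1) : v != 0 -> mxadj v != 0.
  by move=> v0; apply: contra_neq v0 => h; rewrite -(mxadjK v) h /mxadj map_mx0 trmx0.
have [/det0P[v v0 vB]|dB] := boolP (\det B == 0).
  exists (mxadj v), (A *m mxadj v), 1, 0; split; rewrite ?adj0 ?scale1r ?scale0r //.
  by rewrite -hB -mxadjM vB /mxadj map_mx0 trmx0.
have uB : B \in unitmx by rewrite unitmxE unitfE.
have /closed_rootP[z] : size (char_poly (invmx B *m A)) != 1%N.
  by rewrite size_char_poly.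
rewrite -eigenvalue_root_char => /eigenvalueP[v vM v0].
exists (mxadj (v *m invmx B)), (B *m mxadj (v *m invmx B)), (conjc z), 1; split.
- apply: adj0; apply: contra_neq v0 => h.
  by rewrite -[v](mulmxKV uB) h mul0mx.
- rewrite -{1}hA -mxadjM -mulmxA vM mxadjZ.
  congr (_ *: _).
  have -> : B *m mxadj (v *m invmx B) = mxadj (v *m invmx B *m B).
    by rewrite [RHS]mxadjM hB.
  by rewrite mulmxKV.
- by rewrite scale1r.
Qed.

Lemma rdiag_block n (a0 : R) (a : nat -> R) :
  block_mx (cR a0)%:M 0 0 (rdiag n a) =
  rdiag (1 + n) (fun k => if k is k'.+1 then a k' else a0).
Proof.
apply/matrixP => i j; rewrite mxE.
case: splitP => i' ei; rewrite mxE; case: splitP => j' ej; rewrite !mxE.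
- rewrite ei; have -> : i = j by apply: val_inj; rewrite /= ei ej !ord1.
  by rewrite !eqxx (ord1 i') (ord1 j') eqxx.
- by have -> : (i == j) = false by apply/eqP => /(congr1 val) /=; rewrite ei ej !ord1; case.
- by have -> : (i == j) = false by apply/eqP => /(congr1 val) /=; rewrite ei ej !ord1; case.
- have -> : (i == j) = (i' == j').
    by rewrite -!val_eqE /= ei ej eqn_add2l.
  by rewrite ei.
Qed.

(* Deflation: if A u and B u are both multiples of w, then u^* w <> 0 by definiteness, and the
   pencil splits along span(u) and the orthogonal complement of w. *)
Lemma definite_pencil_diag n (A B : 'M[C]_n) : hermitian A -> hermitian B ->
  (forall u, qform A u = 0 -> qform B u = 0 -> u = 0) ->
  exists (S : 'M[C]_n) (a b : nat -> R), [/\ S \in unitmx,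
    mxadj S *m A *m S = rdiag n a & mxadj S *m B *m S = rdiag n b].
Proof.
elim: n A B => [|n IH] A B hA hB def.
  exists 1%:M, (fun=> 0), (fun=> 0); split; first exact: unitmx1.
    by apply/matrixP => -[].
  by apply/matrixP => -[].
have [u [w [a [b [u0 Au Bu]]]]] := pencil_eigenvector hA hB.
have uw : (mxadj u *m w) 0 0 != 0.
  apply: contra_neq u0 => h; apply: def.
    by rewrite /qform /sform -mulmxA Au -scalemxAr mxE h mulr0.
  by rewrite /qform /sform -mulmxA Bu -scalemxAr mxE h mulr0.
have wu : (mxadj w *m u) 0 0 != 0.
  apply: contra_neq uw => h.
  have -> : mxadj u *m w = mxadj (mxadj w *m u) by rewrite mxadjM mxadjK.
  by move: h; move: (mxadj w *m u) => m h; rewrite !mxE h conjc0.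
have [T wT injT] : exists2 K : 'M[C]_(n.+1, n), mxadj w *m K = 0 &
    forall x : 'cV_n, K *m x = 0 -> x = 0 by apply: kernel_columns; rewrite addn1.
have hermT (H : 'M[C]_n.+1) : hermitian H -> hermitian (mxadj T *m H *m T).
  by move=> hH; rewrite /Defs.hermitian !mxadjM mxadjK hH mulmxA.
have [|S [a' [b' [uS dA dB]]]] := IH _ _ (hermT A hA) (hermT B hB).
  by move=> x; rewrite !qform_congr => h1 h2; apply: injT; apply: def.
pose S1 : 'M[C]_(1 + n) := row_mx u T.
have key (H : 'M[C]_n.+1) (c : C) d : hermitian H -> H *m u = c *: w ->
    mxadj S *m (mxadj T *m H *m T) *m S = rdiag n d ->
  exists d' : nat -> R, mxadj (S1 *m block_mx 1%:M 0 0 S) *m H *m (S1 *m block_mx 1%:M 0 0 S)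
     = rdiag n.+1 d'.
  move=> hH Hu dH.
  exists (fun k => if k is k'.+1 then d k' else qform H u).
  have uHT : mxadj u *m H *m T = 0.
    have -> : mxadj u *m H = mxadj (H *m u) by rewrite mxadjM hH.
    by rewrite Hu mxadjZ -scalemxAl wT scaler0.
  have THu : mxadj T *m H *m u = 0.
    by rewrite -mulmxA Hu -scalemxAr -[T in mxadj T]mxadjK mxadjK
       -[mxadj T *m w]mxadjK mxadjM mxadjK wT /mxadj map_mx0 trmx0 scaler0.
  rewrite mul_row_block mulmx1 !mulmx0 addr0 add0r.
  rewrite mxadj_col mul_col_mx mul_col_row.
  rewrite -rdiag_block mxadjM.
  congr block_mx.
  - by apply/matrixP => i j; rewrite (ord1 i) (ord1 j) [RHS]mxE eqxx mulr1n -sform_real.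
  - by rewrite mulmxA uHT mul0mx.
  - by rewrite -!mulmxA (mulmxA (mxadj T)) THu mulmx0.
  - by rewrite -dH !mulmxA.
have [a2 da2] := key A a a' hA Au dA.
have [b2 db2] := key B b b' hB Bu dB.
exists (S1 *m block_mx 1%:M 0 0 S), a2, b2; split=> //.
rewrite unitmx_mul; apply/andP; split; last first.
  by rewrite unitmxE (@det_ublock _ 1 n) det1 mul1r -unitmxE.
rewrite -unitmx_tr -row_free_unit; apply/row_freeP.
apply/row_freeP/inj_row_free => v /(congr1 trmx); rewrite trmx_mul !trmxK trmx0 => h.
apply: trmx_inj; rewrite trmx0.
move: h; rewrite -[v^T](@vsubmxK _ 1 n) /S1 (@mul_row_col _ _ 1 n) => h.
(* Invertibility of [S1]: applying [w^*] to a relation [u z + T y = 0] kills [T] and leaves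
   [(w^* u) z = 0]. *)
have := congr1 (mulmx (mxadj w)) h; rewrite mulmxDr !mulmxA wT mul0mx addr0 mulmx0 => h1.
have z0 : usubmx (v^T : 'M[C]_(1 + n, 1)) = 0.
  apply/matrixP => i j; rewrite ord1 [j]ord1 [RHS]mxE.
  move/matrixP: h1 => /(_ 0 0); rewrite mxE big_ord1 [RHS]mxE => /eqP.
  by rewrite mulf_eq0 (negPf wu) /= => /eqP.
move: h; rewrite z0 mulmx0 add0r => /injT ->.
by rewrite col_mx0.
Qed.

End SimultaneousDiagonalization.

(** * The negative index of inertia *)

Section NegativeIndex.
Variable R : realType.
Local Notation C := (R[i]).
Local Notation hermitian := Defs.hermitian.
Local Notation normc := (@ComplexField.Normc.normc R).

(** Variational form of the index, so that a comparison of forms transfers at once. Injectivity of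
    [V] is implied: a nonzero [x] with [V *m x = 0] would give the value 0. *)
Definition neg_ge k n (H : 'M[C]_n) : Prop :=
  exists V : 'M[C]_(n, k), forall x : 'cV_k, x != 0 -> qform H (V *m x) < 0.

Definition nneg n (H : 'M[C]_n) : nat := \max_(k < n.+1 | `[< neg_ge k H >]) k.

Lemma vanishing_columns n (Q : {set 'I_n}) k p (V : 'M[C]_(n, k)) :
  (p + #|Q| <= k)%N -> exists2 K : 'M[C]_(k, p),
    (forall x : 'cV_p, K *m x = 0 -> x = 0) &
    (forall (x : 'cV_p) i, i \in Q -> (V *m K *m x) i 0 = 0).
Proof.
move=> le; pose M : 'M[C]_(#|Q|, k) := rowsub (fun i => enum_val i) V.
have [K MK Kinj] := kernel_columns M le.
exists K => // x i iQ; have /matrixP/(_ (enum_rank_in iQ i) 0) := congr1 (mulmx^~ x) MK.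
rewrite mul0mx [RHS]mxE => <-.
by rewrite /M mul_rowsub_mx mul_rowsub_mx [RHS]mxE enum_rankK_in.
Qed.

Lemma neg_ge_bound k n (H : 'M[C]_n) : neg_ge k H -> (k <= n)%N.
Proof.
case=> V VP; rewrite leqNgt; apply/negP => nk.
have [K VK Kinj] : exists2 K : 'M[C]_(k, 1), (V *m K = 0) &
    (forall x : 'cV_1, K *m x = 0 -> x = 0) by apply: kernel_columns; rewrite add1n.
have := VP K; rewrite VK qform0 ltxx => VPK.
suff /VPK : K != 0 by [].
apply/eqP => K0; have := Kinj 1%:M; rewrite K0 mul0mx => /(_ erefl)/matrixP/(_ 0 0)/eqP.
by rewrite !mxE oner_eq0.
Qed.

Lemma neg_ge_inj k k' n (H : 'M[C]_n) (V : 'M[C]_(n, k)) (K : 'M[C]_(k, k')) :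
  (forall x : 'cV_k, x != 0 -> qform H (V *m x) < 0) ->
  (forall x : 'cV_k', K *m x = 0 -> x = 0) ->
  (forall x : 'cV_k', x != 0 -> qform H (V *m K *m x) < 0).
Proof.
move=> VP Kinj x x0; rewrite -mulmxA; apply: VP.
by apply: contra_neq x0 => /Kinj.
Qed.

Lemma neg_ge_le k k' n (H : 'M[C]_n) : (k' <= k)%N -> neg_ge k H -> neg_ge k' H.
Proof.
move=> le [V VP].
have [K _ Kinj] : exists2 K : 'M[C]_(k, k'), ((0 : 'M[C]_(0, k)) *m K = 0) &
    (forall x : 'cV_k', K *m x = 0 -> x = 0) by apply: kernel_columns; rewrite addn0.
by exists (V *m K) => x; exact: neg_ge_inj.
Qed.

Lemma neg_ge0 n (H : 'M[C]_n) : neg_ge 0 H.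
Proof.
exists 0 => x; have -> : x = 0 by apply/matrixP => -[].
by rewrite eqxx.
Qed.

Lemma nnegP k n (H : 'M[C]_n) : (k <= nneg H)%N <-> neg_ge k H.
Proof.
split=> [le|h]; last first.
  have kn : (k < n.+1)%N by rewrite ltnS (neg_ge_bound h).
  by rewrite /nneg (@leq_bigmax_cond _ _ (fun k : 'I_n.+1 => k : nat) (Ordinal kn)) //; apply/asboolP.
apply: neg_ge_le le _; rewrite /nneg.
elim/big_ind : _ => [|x y hx hy|i /asboolP //]; first exact: neg_ge0.
by rewrite /maxn; case: ifP.
Qed.

Lemma nneg_le n (H : 'M[C]_n) : (nneg H <= n)%N.
Proof. by have /neg_ge_bound := (nnegP (nneg H) H).1 (leqnn _). Qed.

Lemma nneg_mono n (H H' : 'M[C]_n) :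
  (forall u, qform H u <= qform H' u) -> (nneg H' <= nneg H)%N.
Proof.
move=> le; apply/nnegP; have [V VP] := (nnegP (nneg H') H').1 (leqnn _).
by exists V => x /VP; exact: le_lt_trans.
Qed.

(** Cauchy interlacing: a negative subspace loses at most one dimension when cut with the hyperplane
    [u i = 0], on which the two forms agree. *)
Lemma nneg_hyperplane n (H H' : 'M[C]_n) (i : 'I_n) :
  (forall u : 'cV_n, u i 0 = 0 -> qform H' u = qform H u) -> (nneg H <= (nneg H').+1)%N.
Proof.
move=> eqH; case E : (nneg H) => [//|k]; rewrite ltnS; apply/nnegP.
have [V VP] := (nnegP k.+1 H).1 (eq_leq (esym E)).
have [|K Kinj Kv] := @vanishing_columns n [set i] k.+1 k V; first by rewrite cards1 addn1.
exists (V *m K) => x x0; rewrite eqH; first exact: neg_ge_inj x0.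
by apply: Kv; rewrite inE.
Qed.

(** The kernel vector is appended to a maximal negative subspace of [H']. Since [H' u = 0] removes
    the cross terms, the form of [H'] is at most 0 on the sum, and the strict comparison makes that
    of [H] negative there. *)
Lemma nneg_kernel n (H H' : 'M[C]_n) (u : 'cV_n) : hermitian H' -> u != 0 -> H' *m u = 0 ->
  (forall x, x != 0 -> qform H x < qform H' x) -> (nneg H' < nneg H)%N.
Proof.
move=> hH u0 Hu lt; apply/nnegP; set k := nneg H'.
have [V VP] := (nnegP k H').1 (leqnn _).
have split_form (y : 'cV_k) (z : 'M[C]_1) : qform H' (V *m y + u *m z) = qform H' (V *m y).
  rewrite qformD // /qform /sform -!(mulmxA _ H') !(mulmxA H') Hu !(mul0mx, mulmx0) !mxE /=.
  by rewrite mulr0 !addr0.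
have cancelz (z : 'M[C]_1) : u *m z = 0 -> z = 0.
  rewrite [z]mx11_scalar mul_mx_scalar => /eqP; rewrite scaler_eq0 (negPf u0) orbF => /eqP ->.
  by rewrite raddf0.
rewrite -addn1; exists (row_mx V u) => x x0.
rewrite -[x]vsubmxK mul_row_col; set y := usubmx x; set z := dsubmx x.
have ne : V *m y + u *m z != 0.
  apply: contra_neq x0 => e; have := split_form y z; rewrite e qform0 => e2.
  have y0 : y = 0.
    by apply/eqP; apply: contraT => /VP; rewrite -e2 ltxx.
  move: e; rewrite y0 mulmx0 add0r => /cancelz z0.
  by rewrite -[x]vsubmxK -/y -/z y0 z0 col_mx0.
apply: lt_le_trans (lt _ ne) _; rewrite split_form.
by have [->|/VP/ltW //] := eqVneq y 0; rewrite mulmx0 qform0.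
Qed.

Lemma qform_diag n (S H : 'M[C]_n) (h : nat -> R) x : mxadj S *m H *m S = rdiag n h ->
  qform H (S *m x) = \sum_(i < n) h i * normc (x i 0) ^+ 2.
Proof. by move=> e; rewrite -qform_rdiag -e qform_congr. Qed.

Definition negset n (h : nat -> R) : {set 'I_n} := [set k : 'I_n | h k < 0]%SET.

Lemma diag_vanish_neg n (h : nat -> R) (y : 'cV[C]_n) : y != 0 ->
  (forall i, i \in ~: negset n h -> y i 0 = 0) ->
  \sum_(i < n) h i * normc (y i 0) ^+ 2 < 0.
Proof.
move=> y0 yv; rewrite -oppr_gt0 -sumrN lt_def; apply/andP; split; last first.
  apply: sumr_ge0 => i _; rewrite -mulNr.
  have [hi|hi] := ltP (h i) 0; first by rewrite mulr_ge0 ?sqr_ge0 // oppr_ge0 ltW.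
  by rewrite yv ?inE -?leNgt // ComplexField.Normc.normc0 expr0n mulr0.
rewrite psumr_neq0; last first.
  move=> i _; rewrite -mulNr.
  have [hi|hi] := ltP (h i) 0; first by rewrite mulr_ge0 ?sqr_ge0 // oppr_ge0 ltW.
  by rewrite yv ?inE -?leNgt // ComplexField.Normc.normc0 expr0n mulr0.
have [i yi] : exists i, y i 0 != 0.
  apply/existsP; apply: contraT; rewrite negb_exists => /forallP all0.
  case/negP: y0; apply/eqP/matrixP => i j; rewrite ord1 mxE; apply/eqP.
  by have := all0 i; rewrite negbK.
apply/hasP; exists i; first by rewrite mem_index_enum.
have hi : h i < 0 by rewrite ltNge; apply: contra yi => hi; rewrite yv // inE inE -leNgt.
rewrite /= -mulNr mulr_gt0 ?oppr_gt0 // exprn_gt0 // lt_def normc_ge0 andbT.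
by apply: contra yi => /eqP/ComplexField.Normc.eq0_normc ->.
Qed.

(** Sylvester's law of inertia. A negative subspace of dimension above [#|P|] would contain a
    nonzero vector whose coordinates in [P] vanish, and there the form is nonnegative; conversely
    the coordinate subspace of [P] is negative. *)
Lemma nneg_diag n (S H : 'M[C]_n) (h : nat -> R) : S \in unitmx ->
  mxadj S *m H *m S = rdiag n h -> nneg H = #|negset n h|.
Proof.
move=> uS e; set P := negset n h; apply/eqP; rewrite eqn_leq; apply/andP; split.
  rewrite leqNgt; apply/negP => lt.
  have [V VP] := (nnegP (nneg H) H).1 (leqnn _).
  have [|K Kinj Kv] := @vanishing_columns n P (nneg H) 1 (invmx S *m V).
    by rewrite add1n.
  have K1 : K *m (1%:M : 'M[C]_1) != 0.
    by apply/eqP => /Kinj/matrixP/(_ 0 0)/eqP; rewrite !mxE oner_eq0.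
  have := VP _ K1; rewrite -[V](mulKVmx uS) -!mulmxA (qform_diag _ e) ltNge => /negP; apply.
  apply: sumr_ge0 => i _; have [iP|] := boolP (i \in P).
    by have := Kv 1%:M i iP; rewrite -!mulmxA => ->; rewrite ComplexField.Normc.normc0 expr0n mulr0.
  by rewrite inE -leNgt => hi; rewrite mulr_ge0 // sqr_ge0.
apply/nnegP; have [|K Kinj Kv] := @vanishing_columns n (~: P) n #|P| 1%:M.
  by rewrite cardsC card_ord.
exists (S *m K) => x x0; rewrite -mulmxA (qform_diag _ e); apply: diag_vanish_neg.
  by apply: contra_neq x0 => /Kinj.
by move=> i iP; have := Kv x i iP; rewrite mul1mx.
Qed.

Lemma pos_lower_bound (I : finType) (P : pred I) (f : I -> R) :
  (forall i, P i -> 0 < f i) -> exists2 e, 0 < e & (forall i, P i -> e <= f i).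
Proof.
move=> fP; exists (\big[Num.min/1]_(i | P i) f i); first exact: lt_bigmin.
by move=> i Pi; exact: bigmin_le_cond.
Qed.

(** Diagonalizing [H] together with the identity turns the margin into a minimum over the finitely
    many ratios [- a i / b i], so that no compactness of the unit sphere is invoked. *)
Lemma nneg_margin n (H : 'M[C]_n) : hermitian H ->
  exists (V : 'M[C]_(n, nneg H)) (e : R), [/\ 0 < e,
    (forall x : 'cV_(nneg H), V *m x = 0 -> x = 0) &
    (forall x : 'cV_(nneg H), qform H (V *m x) <= - e * sqn (V *m x))].
Proof.
move=> hH.
have [|S [a [b [uS dH d1]]]] := definite_pencil_diag hH (hermitian1 R n).
  by move=> u _; rewrite -sqn_qform => /eqP; rewrite sqn_eq0 => /eqP.
pose P := negset n a.
have bpos (k : 'I_n) : 0 < b k.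
  have : 0 < sqn (S *m delta_mx k 0).
    rewrite sqn_gt0; apply/eqP => /(congr1 (mulmx (invmx S))).
    rewrite mulKmx // mulmx0 => /matrixP/(_ k 0)/eqP; rewrite !mxE !eqxx oner_eq0 //.
  rewrite sqn_qform (qform_diag _ d1) (bigD1 k) //= big1 ?addr0 => [|i ik].
    by rewrite !mxE !eqxx ComplexField.Normc.normc1 expr1n mulr1.
  by rewrite !mxE (negPf ik) ComplexField.Normc.normc0 expr0n mulr0.
have [e e0 eP] : exists2 e, 0 < e & (forall i : 'I_n, i \in P -> e <= - a i / b i).
  by apply: pos_lower_bound => i; rewrite inE => ai; rewrite divr_gt0 // oppr_gt0.
have [|K Kinj Kv] := @vanishing_columns n (~: P) n (nneg H) 1%:M.
  by rewrite (nneg_diag uS dH) cardsC card_ord.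
exists (S *m K), e; split=> // [x|x].
  move=> /(congr1 (mulmx (invmx S))); rewrite mulmx0 -!mulmxA mulKmx //; exact: Kinj.
rewrite -mulmxA sqn_qform (qform_diag _ dH) (qform_diag _ d1) mulr_sumr.
apply: ler_sum => i _; rewrite [leRHS]mulrA; have [iP|iP] := boolP (i \in P).
  apply: ler_wpM2r; first exact: sqr_ge0.
  by rewrite mulNr lerNr -ler_pdivlMr // eP.
have -> : (K *m x) i 0 = 0 by have := Kv x i; rewrite mul1mx inE iP; exact.
by rewrite ComplexField.Normc.normc0 expr0n !mulr0.
Qed.

Lemma normc_Re (z : C) : complex.Re z <= normc z.
Proof.
case: z => x y /=; apply: le_trans (ler_norm _) _; rewrite -sqrtr_sqr.
by apply: ler_wsqrtr; rewrite lerDl sqr_ge0.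
Qed.

Lemma normc_conjc (z : C) : normc (conjc z) = normc z.
Proof. by case: z => x y /=; rewrite sqrrN. Qed.

Lemma normc_le_ReIm (z : C) : normc z <= `|complex.Re z| + `|complex.Im z|.
Proof.
case: z => x y /=; rewrite -[leRHS]ger0_norm ?addr_ge0 // -sqrtr_sqr.
apply: ler_wsqrtr; rewrite sqrrD !real_normK ?num_real // lerD2r lerDl.
by rewrite mulrn_wge0 // mulr_ge0.
Qed.

Lemma qform_entry_bound n (E : 'M[C]_n) (e : R) u : (forall i j, normc (E i j) <= e) ->
  qform E u <= e * n%:R * sqn u.
Proof.
move=> Ee; have -> : qform E u =
    \sum_i \sum_j complex.Re (conjc (u i 0) * E i j * u j 0).
  rewrite /qform /sform -mulmxA mxE (raddf_sum (@complex.Re R)); apply: eq_bigr => i _.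
  rewrite !mxE mulr_sumr (raddf_sum (@complex.Re R)); apply: eq_bigr => j _.
  by rewrite mulrA.
have bound i j : complex.Re (conjc (u i 0) * E i j * u j 0) <=
    e * ((normc (u i 0) ^+ 2 + normc (u j 0) ^+ 2) / 2).
  apply: le_trans (normc_Re _) _; rewrite !ComplexField.Normc.normcM normc_conjc.
  rewrite mulrAC mulrC; apply: ler_pM => //; rewrite ?normc_ge0 //.
    by rewrite mulr_ge0 ?normc_ge0.
  by have := sqr_ge0 (normc (u i 0) - normc (u j 0)); nra.
apply: (@le_trans _ _ (\sum_(i < n) \sum_(j < n) e * ((normc (u i 0) ^+ 2 + normc (u j 0) ^+ 2) / 2))).
  by apply: ler_sum => i _; apply: ler_sum.
under eq_bigr do rewrite -mulr_sumr -mulr_suml big_split /= sumr_const card_ord.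
rewrite -mulr_sumr -mulr_suml big_split /= sumr_const card_ord sumrMnl -/(sqn u).
rewrite -(mulr_natr (sqn u)); move: (sqn u) (n%:R : R) => s m.
by rewrite le_eqVlt; apply/orP; left; apply/eqP; field.
Qed.

(** Lower semicontinuity from the margin [e]: real and imaginary parts within [e / (4 (n+1))] change
    the form by at most [e / 2] times the squared norm. [H'] ranges over all matrices, which later
    allows boxes in the full matrix space. *)
Lemma nneg_stable n (H : 'M[C]_n) : hermitian H -> exists2 d : R, 0 < d &
  forall H' : 'M[C]_n, (forall i j, `|complex.Re (H' i j - H i j)| < d /\
     `|complex.Im (H' i j - H i j)| < d) -> (nneg H <= nneg H')%N.
Proof.
move=> hH; have [V [e [e0 Vinj VP]]] := nneg_margin hH.
exists (e / 4 / n.+1%:R) => [|H' close]; first by rewrite !divr_gt0.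
apply/nnegP; exists V => x x0.
have Vx : 0 < sqn (V *m x) by rewrite sqn_gt0; apply: contra_neq x0 => /Vinj.
have -> : H' = H + (H' - H) by rewrite addrC subrK.
rewrite qformDm; have := VP x.
have : qform (H' - H) (V *m x) <= (e / 2 / n.+1%:R) * n%:R * sqn (V *m x).
  apply: qform_entry_bound => i j; apply: le_trans (normc_le_ReIm _) _.
  have [] := close i j; rewrite !mxE => h1 h2.
  have -> : e / 2 / n.+1%:R = e / 4 / n.+1%:R + e / 4 / n.+1%:R :> R.
    by rewrite -mulrDl; congr (_ / _); lra.
  by rewrite lerD // ltW.
have le1 : e / 2 / n.+1%:R * n%:R * sqn (V *m x) <= e / 2 * sqn (V *m x).
  apply: ler_wpM2r; first exact: ltW.
  rewrite -[leLHS]mulrA; apply: ler_piMr; first by rewrite divr_ge0 // ltW.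
  by rewrite mulrC ler_pdivrMr ?ltr0n // mul1r ler_nat.
move=> /le_trans/(_ le1) {le1}; have : 0 < e * sqn (V *m x) by rewrite mulr_gt0.
move: (sqn _) (qform _ _) (qform _ _) => s q1 q2; nra.
Qed.

End NegativeIndex.

(** * Iterated integrals and measurability *)

Section IteratedIntegral.
Variable R : realType.
Local Notation leb := (@lebesgue_measure R).
Local Open Scope ereal_scope.

(** The integral of a nonnegative function is a supremum over the simple functions below it, so
    monotonicity holds without measurability. This admits the indicator of the shattering event as
    an integrand. *)
Lemma ge0_le_integral_gen (f g : R -> \bar R) : (forall x, 0 <= f x) -> (forall x, f x <= g x) ->
  \int[leb]_x f x <= \int[leb]_x g x.
Proof.
move=> f0 fg; have g0 x : 0 <= g x by apply: le_trans (fg x).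
rewrite !ge0_integralTE //; apply: le_ereal_sup => _ /= [h hf <-].
by exists h => // x; exact: le_trans (hf x) (fg x).
Qed.

(* Quantifying over all measurable parametrizations of the first k coordinates stands in for
   Borel measurability on R^k. *)
Definition borel_on (k : nat) (f : seq R -> \bar R) : Prop :=
  forall d (T : measurableType d) (c : T -> seq R), (forall t, size (c t) = k) ->
  (forall i, measurable_fun setT (fun t => nth 0%R (c t) i)) ->
  measurable_fun setT (fun t => f (c t)).

Lemma iintS k (f : seq R -> \bar R) :
  iint k.+1 f = \int[leb]_x iint k (fun s => f (x :: s)).
Proof. by []. Qed.

Lemma borel_on_cons k f x : borel_on k.+1 f -> borel_on k (fun s => f (x :: s)).
Proof.
move=> bf d T c sc mc; apply: (bf d T (fun t => x :: c t)) => [t|[|i]] /=.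
- by rewrite sc.
- exact: measurable_cst.
- exact: mc.
Qed.

Lemma iint_ge0 k (f : seq R -> \bar R) : (forall s, 0 <= f s) -> 0 <= iint k f.
Proof.
elim: k f => [|k IH] f f0 //=; apply: integral_ge0 => x _; exact: IH.
Qed.

Lemma le_iint k (f g : seq R -> \bar R) : (forall s, 0 <= f s) ->
  (forall s, size s = k -> f s <= g s) -> iint k f <= iint k g.
Proof.
elim: k f g => [|k IH] f g f0 fg /=; first exact: fg.
apply: ge0_le_integral_gen => x; first exact: iint_ge0.
by apply: IH => // s sk; apply: fg; rewrite /= sk.
Qed.

Lemma eq_iint k (f g : seq R -> \bar R) :
  (forall s, size s = k -> f s = g s) -> iint k f = iint k g.
Proof.
elim: k f g => [|k IH] f g fg /=; first exact: fg.
by apply: eq_integral => x _; apply: IH => s sk; apply: fg; rewrite /= sk.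
Qed.

Lemma measurable_iint k m d (T : measurableType d) (c : T -> seq R) f :
  borel_on (m + k) f -> (forall s, 0 <= f s) -> (forall t, size (c t) = m) ->
  (forall i, measurable_fun setT (fun t => nth 0%R (c t) i)) ->
  measurable_fun setT (fun t => iint k (fun s => f (c t ++ s))).
Proof.
elim: k m d T c => [|k IH] m d T c bf f0 sc mc /=.
  apply: (bf d T (fun t => c t ++ [::])) => [t|i].
    by rewrite cats0 sc addn0.
  by under eq_fun do rewrite cats0; exact: mc.
pose c' (tx : T * R) := rcons (c tx.1) tx.2.
have mF : measurable_fun setT (fun tx : T * R => iint k (fun s => f (c' tx ++ s))).
  apply: (IH m.+1) => // [|t|i]; first by rewrite addSnnS.
    by rewrite size_rcons sc.
  have [im|im] := eqVneq i m.
    have -> : (fun t => nth 0%R (c' t) i) = snd; last exact: measurable_snd.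
    by apply/funext => t; rewrite nth_rcons sc im ltnn eqxx.
  have -> : (fun t => nth 0%R (c' t) i) = (fun t => nth 0%R (c t.1) i).
    apply/funext => t; rewrite nth_rcons sc (negPf im); case: ltnP => // mi.
    by rewrite nth_default // sc.
  exact: (measurableT_comp (mc i) measurable_fst).
have F0 (tx : T * R) : 0 <= iint k (fun s => f (c' tx ++ s)) by exact: iint_ge0.
have := @measurable_fun_fubini_tonelli_F _ _ T (measurableTypeR R) R leb _ mF F0.
apply: eq_measurable_fun => t _; rewrite /fubini_F.
by apply: eq_integral => x _; apply: eq_iint => s _; rewrite /c' cat_rcons.
Qed.

Lemma measurable_iint_cons k f : borel_on k.+1 f -> (forall s, 0 <= f s) ->
  measurable_fun setT (fun x : R => iint k (fun s => f (x :: s))).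
Proof.
move=> bf f0; apply: (@measurable_iint k 1%N _ _ (fun x => [:: x])) => // -[|i] /=.
  exact: measurable_id.
by rewrite (_ : (fun=> _) = cst 0%R) //; apply/funext => x; rewrite nth_nil.
Qed.

Lemma iintD k f g : borel_on k f -> borel_on k g -> (forall s, 0 <= f s) -> (forall s, 0 <= g s) ->
  iint k (fun s => f s + g s) = iint k f + iint k g.
Proof.
elim: k f g => [|k IH] f g bf bg f0 g0 //=.
rewrite -ge0_integralD //; first last.
- exact: measurable_iint_cons.
- by move=> x _; exact: iint_ge0.
- exact: measurable_iint_cons.
- by move=> x _; exact: iint_ge0.
by apply: eq_integral => x _; apply: IH => //; exact: borel_on_cons.
Qed.

Lemma iintZl k f (a : R) : borel_on k f -> (forall s, 0 <= f s) -> (0 <= a)%R ->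
  iint k (fun s => a%:E * f s) = a%:E * iint k f.
Proof.
elim: k f => [|k IH] f bf f0 a0 //=.
rewrite -ge0_integralZl_EFin //; first last.
- exact: measurable_iint_cons.
- by move=> x _; exact: iint_ge0.
by apply: eq_integral => x _; apply: IH => //; exact: borel_on_cons.
Qed.

(** Brings the first coordinate into the innermost position: Tonelli exchanges it with the second
    one, which is then frozen while the induction hypothesis moves the first further in. *)
Lemma iint_swap k f : borel_on k.+1 f -> (forall s, 0 <= f s) ->
  iint k.+1 f = iint k (fun s => \int[leb]_x f (x :: s)).
Proof.
elim: k f => [|k IH] f bf f0 //.
rewrite [LHS]/= [RHS]/=.
have mF : measurable_fun setT (fun xy : R * R => iint k (fun s => f (xy.1 :: xy.2 :: s))).
  apply: (@measurable_iint k 2%N _ _ (fun xy : R * R => [:: xy.1; xy.2])) => // -[|[|i]] /=.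
  - exact: measurable_fst.
  - exact: measurable_snd.
  - by rewrite (_ : (fun=> _) = cst 0%R) //; apply/funext => x; rewrite nth_nil.
rewrite (@fubini_tonelli _ _ (measurableTypeR R) (measurableTypeR R) R leb leb
  (fun xy : R * R => iint k (fun s => f (xy.1 :: xy.2 :: s)))) //; last first.
  by move=> x; exact: iint_ge0.
apply: eq_integral => y _.
pose f' s := f (head 0%R s :: y :: behead s).
have := IH f'; rewrite [iint _ _]/= /f' /=; apply => // d T c sc mc.
apply: (bf d T (fun t => head 0%R (c t) :: y :: behead (c t))) => [t|[|[|i]]] /=.
- by rewrite size_behead sc.
- by under eq_fun do rewrite -nth0; exact: mc.
- exact: measurable_cst.
- by under eq_fun do rewrite nth_behead; exact: mc.
Qed.

(** Reduces a comparison of iterated integrals to one-dimensional ones along coordinate [i], all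
    others frozen. The entry of [s] at [i] is a dummy, overwritten by [set_nth]. *)
Lemma le_iint_slice k i f g : (i < k)%N -> borel_on k f -> borel_on k g ->
  (forall s, 0 <= f s) -> (forall s, 0 <= g s) ->
  (forall s, size s = k ->
    \int[leb]_v f (set_nth 0%R s i v) <= \int[leb]_v g (set_nth 0%R s i v)) ->
  iint k f <= iint k g.
Proof.
elim: i k f g => [|i IH] [|k] f g //= ik bf bg f0 g0 le.
  rewrite -[leLHS]/(iint k.+1 f) -[leRHS]/(iint k.+1 g) !iint_swap //.
  apply: le_iint => [s|s sk]; first exact: integral_ge0.
  by have /= := le (0%R :: s); rewrite sk => /(_ erefl).
apply: ge0_le_integral_gen => x; first exact: iint_ge0.
apply: IH => //; do ?exact: borel_on_cons.
by move=> s sk; have /= := le (x :: s); rewrite sk => /(_ erefl).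
Qed.

End IteratedIntegral.

(** * Measurability of the negative index *)

Section MeasurableNegativeIndex.
Variable R : realType.
Local Notation C := (R[i]).
Local Notation hermitian := Defs.hermitian.

(** By [nneg_stable] the index is at least [k] near every Hermitian matrix where it is. Hence the
    superlevel set is the preimage of a union of boxes with rational centre and radius [1/(m+1)] on
    which the bound holds throughout, and there are countably many such boxes. *)
Lemma measurable_nneg_ge d (T : measurableType d) n (M : T -> 'M[C]_n) (k : nat) :
  (forall t, hermitian (M t)) ->
  (forall i j, measurable_fun setT (fun t => complex.Re (M t i j))) ->
  (forall i j, measurable_fun setT (fun t => complex.Im (M t i j))) ->
  measurable [set t | (k <= nneg (M t))%N].
Proof.
move=> hM mRe mIm.
pose near_box (q : 'M[rat]_n * 'M[rat]_n * nat) (H : 'M[C]_n) := forall i j,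
  `|complex.Re (H i j) - ratr (q.1.1 i j)| < q.2.+1%:R^-1 /\
  `|complex.Im (H i j) - ratr (q.1.2 i j)| < q.2.+1%:R^-1.
pose F q := if `[< forall H, near_box q H -> (k <= nneg H)%N >]
  then [set t | near_box q (M t)] else set0.
rewrite (_ : mkset _ = \bigcup_q F q).
  apply: countable_bigcupT_measurable => // q; rewrite /F; case: ifP => // _.
  rewrite (_ : mkset _ = \bigcap_(ij in [set: 'I_n * 'I_n])
     ([set t | `|complex.Re (M t ij.1 ij.2) - ratr (q.1.1 ij.1 ij.2)| < q.2.+1%:R^-1] `&`
      [set t | `|complex.Im (M t ij.1 ij.2) - ratr (q.1.2 ij.1 ij.2)| < q.2.+1%:R^-1])).
    have mlt (f : T -> R) (a b : R) : measurable_fun setT f ->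
        measurable [set t | `|f t - a| < b].
      move=> mf; have := @measurable_fun_ltr _ T R setT (fun t => `|f t - a|) (cst b).
      have mfa : measurable_fun setT (fun t => `|f t - a|).
        by apply: measurableT_comp => //; exact: measurable_funB.
      move=> /(_ mfa (measurable_cst _)) /(_ measurableT [set true]).
      by rewrite setTI; apply.
    apply: fin_bigcap_measurable; first exact: finite_finset.
    by move=> ij _; apply: measurableI; exact: mlt.
  apply/seteqP; split => [t nt ij _|t nt i j]; first exact: nt.
  exact: (nt (i, j)).
apply/seteqP; split => [t /= kM|t [q _]]; last first.
  by rewrite /F; case: ifPn => // /asboolP h /h.
have [e e0 eP] := nneg_stable (hM t).
(* The radius is below [e / 2], so that two matrices in the same box have entries within [e] of each
   other. *)
have [m me] : exists m : nat, m.+1%:R^-1 < e / 2.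
  exists (Num.truncn (e / 2)^-1).
  rewrite -[ltRHS]invrK ltf_pV2 ?posrE ?invr_gt0 ?divr_gt0 //.
  by rewrite truncnS_gt.
have approx (x : R) : exists q : rat, `|x - ratr q| < m.+1%:R^-1.
  have [|q] := @rat_in_itvoo R (x - m.+1%:R^-1) (x + m.+1%:R^-1).
    by rewrite ltrBlDr -addrA ltrDl addr_gt0 ?invr_gt0.
  rewrite in_itv /= => /andP[h1 h2]; exists q; rewrite ltr_norml.
  by move: h1 h2; move: (_^-1) (ratr q) => a b *; apply/andP; split; lra.
pose ap x := xchoose (approx x).
pose P := \matrix_(i, j) ap (complex.Re (M t i j)).
pose Q := \matrix_(i, j) ap (complex.Im (M t i j)).
have near : near_box (P, Q, m) (M t).
  by move=> i j; rewrite /= !mxE; split; exact: (xchooseP (approx _)).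
exists (P, Q, m) => //; rewrite /F; case: ifPn => [//|/asboolP[]].
move=> H nearH; apply: leq_trans kM _; apply: eP => i j.
have [h1 h2] := near i j; have [h3 h4] := nearH i j.
move: h1 h2 h3 h4 me; move: (_^-1) (ratr _) (ratr _) => a b c h1 h2 h3 h4 me; split.
  rewrite raddfB /=; move: h1 h3; rewrite !ltr_norml => /andP[? ?] /andP[? ?].
  by apply/andP; split; lra.
rewrite raddfB /=; move: h2 h4; rewrite !ltr_norml => /andP[? ?] /andP[? ?].
by apply/andP; split; lra.
Qed.

Lemma sum_ltn_nat (m n : nat) : (m <= n)%N -> \sum_(k < n) ((k < m)%N%:R : R) = m%:R.
Proof.
move=> mn; rewrite -natr_sum -(big_mkord xpredT (fun k => nat_of_bool (k < m)%N)).
rewrite (big_cat_nat (leq0n m) mn) /=; congr (_%:R).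
rewrite (eq_big_nat _ _ (F2 := fun=> 1%N)) => [|i /andP[_ ->] //].
rewrite sum_nat_const_nat subn0 muln1 big_nat big1 ?addn0 // => i /andP[mi _].
by rewrite ltnNge mi.
Qed.

Lemma measurable_nneg d (T : measurableType d) n (M : T -> 'M[C]_n) :
  (forall t, hermitian (M t)) ->
  (forall i j, measurable_fun setT (fun t => complex.Re (M t i j))) ->
  (forall i j, measurable_fun setT (fun t => complex.Im (M t i j))) ->
  measurable_fun setT (fun t => (nneg (M t))%:R : R).
Proof.
move=> hM mRe mIm.
under eq_fun do rewrite -(sum_ltn_nat (nneg_le _)).
apply: measurable_sum => k.
rewrite (_ : (fun t => _) = \1_[set t | (k < nneg (M t))%N]).
  by apply: measurable_indic; exact: measurable_nneg_ge.
by apply/funext => t; rewrite indicE mem_setE.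
Qed.

End MeasurableNegativeIndex.

Section RealBorel.
Variable R : realType.

Definition rborel (k : nat) (f : seq R -> R) : Prop :=
  forall d (T : measurableType d) (c : T -> seq R), (forall t, size (c t) = k) ->
  (forall i, measurable_fun setT (fun t => (c t)`_i)) ->
  measurable_fun setT (fun t => f (c t)).

Lemma rborel_EFin k f : rborel k f -> borel_on k (fun s => (f s)%:E).
Proof. by move=> bf d T c sc mc; apply/measurable_EFinP; exact: bf. Qed.

Lemma rborel_nth k i : rborel k (fun s => s`_i).
Proof. by move=> d T c sc mc. Qed.

Lemma rborel_cst k a : rborel k (fun=> a).
Proof. by move=> d T c sc mc. Qed.

Lemma rborelD k f g : rborel k f -> rborel k g -> rborel k (fun s => f s + g s).
Proof. by move=> bf bg d T c sc mc; apply: measurable_funD; [exact: bf|exact: bg]. Qed.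

Lemma rborelB k f g : rborel k f -> rborel k g -> rborel k (fun s => f s - g s).
Proof. by move=> bf bg d T c sc mc; apply: measurable_funB; [exact: bf|exact: bg]. Qed.

Lemma rborelM k f g : rborel k f -> rborel k g -> rborel k (fun s => f s * g s).
Proof. by move=> bf bg d T c sc mc; apply: measurable_funM; [exact: bf|exact: bg]. Qed.

Lemma rborel_comp k (h : R -> R) f : measurable_fun setT h -> rborel k f ->
  rborel k (fun s => h (f s)).
Proof. by move=> mh bf d T c sc mc; apply: measurableT_comp => //; exact: bf. Qed.

Lemma rborel_sum k (I : Type) (r : seq I) (f : I -> seq R -> R) :
  (forall i, rborel k (f i)) -> rborel k (fun s => \sum_(i <- r) f i s).
Proof. by move=> bf d T c sc mc; apply: measurable_sum => i; exact: bf. Qed.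

Lemma rborel_prod k (I : eqType) (r : seq I) (f : I -> seq R -> R) :
  (forall i, rborel k (f i)) -> rborel k (fun s => \prod_(i <- r) f i s).
Proof. by move=> bf d T c sc mc; apply: measurable_prod => i _; exact: bf. Qed.

Lemma rborel_le k f g : rborel k f -> rborel k g -> rborel k (fun s => (f s <= g s)%R%:R).
Proof.
move=> bf bg d T c sc mc; rewrite (_ : (fun t => _) = (fun t => if f (c t) <= g (c t) then 1 else 0)).
  by apply: measurable_fun_ifT => //; apply: measurable_fun_ler; [exact: bf|exact: bg].
by apply/funext => t; case: ifP.
Qed.

Lemma rborel_lt k f g : rborel k f -> rborel k g -> rborel k (fun s => (f s < g s)%R%:R).
Proof.
move=> bf bg d T c sc mc; rewrite (_ : (fun t => _) = (fun t => if f (c t) < g (c t) then 1 else 0)).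
  by apply: measurable_fun_ifT => //; apply: measurable_fun_ltr; [exact: bf|exact: bg].
by apply/funext => t; case: ifP.
Qed.

End RealBorel.

Section Slices.
Import numFieldNormedType.Exports.
Variable R : realType.
Local Notation leb := (@lebesgue_measure R).

(** The one-variable core of Wegner's estimate. The support is controlled through its diameter
    because only the width of the window is known, not its position. *)
Lemma integral_le_diam (g : R -> R) (r D : R) : 0 <= r -> (forall v, 0 <= g v <= r) ->
  (forall v v', g v != 0 -> g v' != 0 -> v' <= v + D) ->
  (exists v, g v != 0) ->
  (\int[leb]_v (g v)%:E <= (r * D)%:E)%E.
Proof.
move=> r0 gr gD [v0 gv0].
pose S := [set v | g v != 0].
have lbS : has_inf S.
  by split; [exists v0|exists (v0 - D) => v gv; have := gD _ _ gv gv0; lra].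
have D0 : 0 <= D by have := gD _ _ gv0 gv0; lra.
set a := inf S.
have sub v : g v != 0 -> a <= v <= a + D.
  move=> gv; apply/andP; split; first exact: ge_inf lbS.2 _ gv.
  rewrite -lerBlDr; apply: lb_le_inf; first by exists v0.
  by move=> u gu; have := gD _ _ gu gv; lra.
apply: (@le_trans _ _ (\int[leb]_v (r * \1_(`[a, a + D]%classic) v)%:E)%E).
  apply: ge0_le_integral_gen => v; rewrite lee_fin; first by case/andP: (gr v).
  have [->|gv] := eqVneq (g v) 0; first by rewrite mulr_ge0.
  rewrite indicE mem_set ?mulr1; first by case/andP: (gr v).
  by rewrite /= in_itv /= sub.
under eq_integral do rewrite EFinM.
rewrite ge0_integralZl_EFin //; last first.
  by apply/measurable_EFinP; exact: measurable_indic.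
rewrite integral_indic //= setIT lebesgue_measure_itv /= lte_fin ltrDl.
case: ltP => [_|_]; last by rewrite mule0 lee_fin mulr_ge0.
by rewrite -EFinB -EFinM lee_fin addrAC subrr add0r.
Qed.

Lemma integral_affine (a b c0 c1 : R) : a < b ->
  (\int[leb]_(x in `[a, b]) (c0 + c1 * x)%:E =
   (c0 * (b - a) + c1 * (b ^+ 2 - a ^+ 2) / 2)%:E)%E.
Proof.
move=> ab.
pose F (x : R) := c0 * x + c1 / 2 * x ^+ 2.
have dF (x : R) : is_derive x 1 F (c0 + c1 * x).
  rewrite /F; apply: is_derive_eq.
  rewrite /GRing.scale /=; lra.
rewrite (@continuous_FTC2 _ _ F) //.
- by rewrite -EFinB /F; congr EFin; lra.
- apply: continuous_subspaceT => x; apply: differentiable_continuous.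
  by apply/derivable1_diffP.
- split.
  + move=> x _; exact: (@ex_derive _ _ _ _ _ _ _ (dF x)).
  + apply: cvg_at_right_filter; apply: differentiable_continuous.
    by apply/derivable1_diffP; exact: (@ex_derive _ _ _ _ _ _ _ (dF _)).
  + apply: cvg_at_left_filter; apply: differentiable_continuous.
    by apply/derivable1_diffP; exact: (@ex_derive _ _ _ _ _ _ _ (dF _)).
- by move=> x _; rewrite derive1E; exact: (@derive_val _ _ _ _ _ _ _ (dF x)).
Qed.

End Slices.

(** * Truncated densities *)

Section TruncatedDensity.
Variable R : realType.
Local Notation leb := (@lebesgue_measure R).
Variables (q : R -> R) (r p : R).
Hypotheses (mq : measurable_fun setT q) (q0 : forall x, 0 <= q x) (qr : forall x, q x <= r)
  (intq : (\int[leb]_x (q x)%:E = p%:E)%E) (p0 : 0 < p).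

Lemma integral_scale_density (a : R) : 0 <= a -> (\int[leb]_x (a * q x)%:E = (a * p)%:E)%E.
Proof.
move=> a0; under eq_integral do rewrite EFinM.
rewrite ge0_integralZl_EFin ?intq //; first by move=> x _; rewrite lee_fin.
exact/measurable_EFinP.
Qed.

Lemma density_bound_gt0 : 0 < r.
Proof.
rewrite ltNge; apply/negP => r0.
have q00 x : q x = 0 by apply/le_anti; rewrite q0 (le_trans (qr x)).
move: intq; under eq_integral do rewrite q00.
by rewrite integral0 => -[] e; move: p0; rewrite -e ltxx.
Qed.

Section Support.
Variable M : R.
Hypothesis (M0 : 0 < M) (qM : forall x, M < `|x| -> q x = 0).

Lemma mass_le : p <= 2 * M * r.
Proof.
rewrite -lee_fin -intq [2 * M * r]mulrC; apply: integral_le_diam.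
- exact: ltW density_bound_gt0.
- by move=> v; rewrite q0 qr.
- have sup v : q v != 0 -> - M <= v <= M.
    by move=> qv; rewrite -ler_norml leNgt; apply: contra qv => /qM ->.
  by move=> v v' /sup /andP[h1 h2] /sup /andP[h3 h4]; lra.
- apply: contrapT => /forallNP h.
  have q00 x : q x = 0 by apply/eqP; have := h x; move/negP; rewrite negbK.
  move: intq; under eq_integral do rewrite q00.
  by rewrite integral0 => -[] e; move: p0; rewrite -e ltxx.
Qed.

(* A density bounded by r with mass p on [-M, M] is, at best, r on an interval of length p/r
   ending at the extremity (bathtub principle). *)
Lemma mean_bound (m sg : R) : 0 < m -> m * M <= 1 -> (sg = 1 \/ sg = -1) ->
  (\int[leb]_x (q x * `|1 + sg * (m * x)|)%:E <=
     (p * (1 + m * M) - m * p ^+ 2 / (2 * r))%:E)%E.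
Proof.
move=> m0 mM sgE.
have r0 := density_bound_gt0.
pose h := p / r; have h0 : 0 < h by rewrite divr_gt0.
pose a := if sg == 1 then M - h else - M.
pose tri x := (h - M) + sg * x.
have tri_int : (\int[leb]_x ((fun x => (tri x)%:E) \_ `[a, (a + h)%R]) x = (h ^+ 2 / 2)%:E)%E.
  rewrite -integral_mkcond integral_affine ?ltrDl //; congr EFin.
  rewrite /a; case: sgE => ->; rewrite ?eqxx; first by lra.
  have -> : (-1 == 1 :> R) = false by apply/eqP; lra.
  lra.
have inI x : x \in (`[a, a + h]%classic : set R) = (0 <= M - sg * x <= h).
  apply/idP/idP; rewrite inE /= in_itv /= /a; case: sgE => ->; rewrite ?eqxx.
  - by move=> /andP[h1 h2]; apply/andP; split; lra.
  - have -> : (-1 == 1 :> R) = false by apply/eqP; lra.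
    by move=> /andP[h1 h2]; apply/andP; split; lra.
  - by move=> /andP[h1 h2]; apply/andP; split; lra.
  - have -> : (-1 == 1 :> R) = false by apply/eqP; lra.
    by move=> /andP[h1 h2]; apply/andP; split; lra.
have tri0 x : (0 <= ((fun x => (tri x)%:E) \_ `[a, (a + h)%R]) x)%E.
  by rewrite patchE inI; case: ifP => // /andP[h1 h2]; rewrite lee_fin /tri; lra.
have mtri : measurable_fun setT ((fun x => (tri x)%:E) \_ `[a, (a + h)%R]).
  apply/(measurable_restrictT _ _).1 => //; apply/measurable_funTS/measurable_EFinP.
  by apply: measurable_funD => //; exact: measurable_funM.
(* With [y = M - sg x], the distance to the favoured end point, the pointwise content is
   [q (h - y) <= r max(0, h - y)]. The term [m h q] stays on the left so that both integrands remain
   nonnegative. *)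
have key : (\int[leb]_x ((q x * `|1 + sg * (m * x)|)%:E + (m * h * q x)%:E) <=
    \int[leb]_x (((1 + m * M) * q x)%:E + (m * r)%:E * ((fun x => (tri x)%:E) \_ `[a, (a + h)%R]) x))%E.
  apply: ge0_le_integral_gen => x.
    by rewrite -EFinD lee_fin addr_ge0 // mulr_ge0 // mulr_ge0 // ltW.
  rewrite patchE inI; have [q00|qn0] := eqVneq (q x) 0.
    rewrite q00 mul0r !mulr0 adde0; case: ifP => [/andP[h1 h2]|_]; last by rewrite mule0 adde0.
    rewrite -EFinM -EFinD lee_fin add0r mulr_ge0 //; last by rewrite /tri; lra.
    by rewrite mulr_ge0 // ltW.
  have xM : - M <= x <= M by rewrite -ler_norml leNgt; apply: contra qn0 => /qM ->.
  have y0 : 0 <= M - sg * x by case/andP: xM => h1 h2; case: sgE => ->; lra.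
  have -> : `|1 + sg * (m * x)| = 1 + m * M - m * (M - sg * x).
    rewrite ger0_norm; first by lra.
    by case/andP: xM => h1 h2; case: sgE => ->; nra.
  have := q0 x; have := qr x; move: (q x) => z zr z0.
  rewrite y0 /=; case: ifPn => [yh|/negP yh].
    rewrite -EFinM -!EFinD lee_fin /tri.
    have : 0 <= m * (r - z) * (h - (M - sg * x)).
      by rewrite !mulr_ge0 ?subr_ge0 // ltW.
    move: (sg * x) => w; nra.
  rewrite mule0 -!EFinD lee_fin addr0.
  have : 0 <= m * z * ((M - sg * x) - h).
    by rewrite mulr_ge0 ?mulr_ge0 ?subr_ge0 // ltW // ltNge; apply/negP.
  move: (sg * x) => w; nra.
have mE : measurable_fun setT (fun x => (q x * `|1 + sg * (m * x)|)%:E).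
  apply/measurable_EFinP; apply: measurable_funM => //; apply: measurableT_comp => //.
  by apply: measurable_funD => //; apply: measurable_funM => //; exact: measurable_funM.
move: key; rewrite !ge0_integralD //; first last.
- by apply/measurable_EFinP; exact: measurable_funM.
- by move=> x _; rewrite lee_fin mulr_ge0 // mulr_ge0 // ltW.
- by move=> x _; rewrite lee_fin mulr_ge0.
- exact: measurable_funeM.
- by move=> x _; rewrite mule_ge0 // lee_fin mulr_ge0 // ltW.
- by apply/measurable_EFinP; exact: measurable_funM.
- by move=> x _; rewrite lee_fin mulr_ge0 // addr_ge0 // mulr_ge0 // ltW.
rewrite ge0_integralZl_EFin //; last by rewrite mulr_ge0 // ltW.
rewrite tri_int !integral_scale_density; last 2 first.
- by rewrite addr_ge0 // mulr_ge0 // ltW.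
- by rewrite mulr_ge0 // ltW.
rewrite -leeBrDr // -EFinM -!EFinD => /le_trans; apply; rewrite lee_fin.
rewrite /h le_eqVlt; apply/orP; left; apply/eqP; field.
by rewrite gt_eqF.
Qed.

End Support.

Section SliceBounds.
Variables (k i : nat) (w W : seq R -> R).
Hypotheses (ik : (i < k)%N) (bw : rborel k w) (w0 : forall s, 0 <= w s) (W0 : forall s, 0 <= W s)
  (wW : forall s v, size s = k -> w (set_nth 0 s i v) = q v * W s).

(** Wegner's estimate along coordinate [i], with room for decoupling. If [f] is nonzero for one
    value of the coordinate, then [h >= 1] for all its values; hence [h] survives resampling and
    remains in the bound as a factor still to be integrated. *)
Lemma slice_window (f D h : seq R -> R) :
  rborel k f -> rborel k D -> rborel k h ->
  (forall s, 0 <= f s <= 1) -> (forall s, 0 <= D s) -> (forall s, 0 <= h s) ->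
  (forall s v, D (set_nth 0 s i v) = D s) ->
  (forall s v u, size s = k -> f (set_nth 0 s i v) != 0 -> 1 <= h (set_nth 0 s i u)) ->
  (forall s v v', size s = k -> f (set_nth 0 s i v) != 0 -> f (set_nth 0 s i v') != 0 ->
     v' <= v + D s) ->
  (iint k (fun s => (w s * f s)%:E) <= iint k (fun s => (r / p * (w s * (D s * h s)))%:E))%E.
Proof.
move=> bf bD bh f01 D0 h0 Dinv fh fD.
have r0 := density_bound_gt0.
have f0 s : 0 <= f s by case/andP: (f01 s).
apply: (le_iint_slice ik).
- by apply: rborel_EFin; exact: rborelM.
- by apply: rborel_EFin; do !apply: rborelM => //; exact: rborel_cst.
- by move=> s; rewrite lee_fin mulr_ge0.
- by move=> s; rewrite lee_fin !mulr_ge0 // ltW // invr_gt0.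
move=> s sk.
have [|/forallNP nof] := pselect (exists v, w (set_nth 0 s i v) * f (set_nth 0 s i v) != 0); last first.
  rewrite integral0_eq; last first.
    by move=> v _; have /negP := nof v; rewrite negbK => /eqP ->.
  by apply: integral_ge0 => v _; rewrite lee_fin !mulr_ge0 // ltW // invr_gt0.
move=> exv; have [v1 wfv1] := exv.
have fv1 : f (set_nth 0 s i v1) != 0 by apply: contra_neq wfv1 => ->; rewrite mulr0.
(* The slice costs at most [r W D]. Writing this as [(r/p) W D p] and unfolding [p] into the
   integral of [q] restores the full weight; this is the origin of the factor [r/p]. *)
apply: (@le_trans _ _ (r * W s * D s)%:E); last first.
  have -> : r * W s * D s = (r / p * W s * D s) * p by field; rewrite gt_eqF.
  rewrite -integral_scale_density; last by rewrite !mulr_ge0 // ?invr_ge0 ltW.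
  apply: ge0_le_integral_gen => v.
    by rewrite lee_fin !mulr_ge0 // ?invr_ge0 ltW.
  rewrite lee_fin wW // Dinv.
  have h1 := fh s v1 v sk fv1.
  have : 0 <= r / p * W s * D s * q v * (h (set_nth 0 s i v) - 1).
    by rewrite !mulr_ge0 // ?invr_ge0 ?subr_ge0 // ltW.
  move: (r / p) => rp; lra.
apply: integral_le_diam.
- by rewrite mulr_ge0 // ltW.
- move=> v; rewrite mulr_ge0 //= wW //.
  have /andP[h1 h2] := f01 (set_nth 0 s i v).
  rewrite -[leRHS]mulr1; apply: ler_pM => //; first by rewrite mulr_ge0.
  by rewrite ler_wpM2r.
- move=> v v'; rewrite !mulf_eq0 !negb_or => /andP[_ h1] /andP[_ h2]; exact: fD.
- exact: exv.
Qed.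

(** A factor that depends on one coordinate only may be replaced by a bound on its mean under the
    normalized density [q / p]. *)
Lemma slice_mean (K : seq R -> R) (phi : R -> R) (a : R) :
  rborel k K -> (forall s, 0 <= K s) -> 0 <= a ->
  measurable_fun setT phi -> (forall v, 0 <= phi v) ->
  (forall s v, size s = k -> K (set_nth 0 s i v) = phi v) ->
  (\int[leb]_v (q v * phi v)%:E <= (a * p)%:E)%E ->
  (iint k (fun s => (w s * K s)%:E) <= iint k (fun s => (a * w s)%:E))%E.
Proof.
move=> bK K0 a0 mphi phi0 Kphi le.
apply: (@le_iint_slice R k i (fun s => (w s * K s)%:E) (fun s => (a * w s)%:E) ik).
- by apply: rborel_EFin; exact: rborelM.
- by apply: rborel_EFin; apply: rborelM => //; exact: rborel_cst.
- by move=> s; rewrite lee_fin mulr_ge0.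
- by move=> s; rewrite lee_fin mulr_ge0.
move=> s sk.
have -> : (\int[leb]_v (a * w (set_nth 0 s i v))%:E = (W s)%:E * (a * p)%:E)%E.
  rewrite -EFinM mulrA -integral_scale_density ?mulr_ge0 //.
  by apply: eq_integral => v _; rewrite wW //; congr EFin; lra.
have -> : (\int[leb]_v (w (set_nth 0 s i v) * K (set_nth 0 s i v))%:E =
    (W s)%:E * \int[leb]_v (q v * phi v)%:E)%E.
  rewrite -ge0_integralZl_EFin //.
  - by apply: eq_integral => v _; rewrite wW // Kphi // -EFinM; congr EFin; lra.
  - by move=> v _; rewrite lee_fin mulr_ge0.
  - by apply/measurable_EFinP; exact: measurable_funM.
by apply: lee_wpmul2l; rewrite ?lee_fin.
Qed.

End SliceBounds.

Lemma iint_product (m : nat) (u : R -> R) : measurable_fun setT u -> (forall x, 0 <= u x) ->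
  (\int[leb]_x (u x)%:E = 1)%E ->
  iint m.+1 (fun s => ((\prod_(l < m) q s`_l) * u s`_m)%:E) = (p ^+ m)%:E.
Proof.
move=> mu u0 intu; elim: m => [|m IH].
  rewrite /= -intu; apply: eq_integral => x _.
  by rewrite big_ord0 mul1r.
have -> : (p ^+ m.+1)%:E = (\int[leb]_x (p ^+ m * q x)%:E)%E.
  by rewrite integral_scale_density ?exprn_ge0 ?ltW // exprSr.
rewrite iintS; apply: eq_integral => x _.
rewrite mulrC EFinM -IH -iintZl //; last first.
- by move=> s; rewrite lee_fin mulr_ge0 // prodr_ge0.
- apply: rborel_EFin; apply: rborelM.
    by apply: rborel_prod => l; apply: rborel_comp => //; exact: rborel_nth.
  by apply: rborel_comp => //; exact: rborel_nth.
apply: eq_iint => s _; rewrite -EFinM big_ord_recl /=; congr EFin.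
by rewrite mulrA.
Qed.

End TruncatedDensity.

(** * Spectral norm and Crawford number *)

Lemma quadratic_root (F : fieldType) (a b c s : F) : b != 0 -> s ^+ 2 = c ^+ 2 - a * b ->
  a + ((- c - s) / b) ^+ 2 * b + 2 * ((- c - s) / b * c) = 0.
Proof.
move=> b0 sE; apply: (mulIf b0); rewrite mul0r.
transitivity (a * b + s ^+ 2 - c ^+ 2); last by rewrite sE; ring.
by field.
Qed.

Lemma cramer2 (F : fieldType) (p q s t x y : F) : p * t - q * s != 0 ->
  let d := p * t - q * s in
  x - ((x * t - y * s) / d * p + (p * y - q * x) / d * s) = 0 /\
  y - ((x * t - y * s) / d * q + (p * y - q * x) / d * t) = 0.
Proof. by move=> d0 d; split; rewrite /d; field. Qed.

Section FormBounds.
Variable R : realType.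
Local Notation C := (R[i]).
Local Notation hermitian := Defs.hermitian.
Local Notation normc := (@ComplexField.Normc.normc R).

Lemma cvnorm_sqr n (u : 'cV[C]_n) : cvnorm u ^+ 2 = sqn u.
Proof. by rewrite /cvnorm sqr_sqrtr // sqn_ge0. Qed.

Lemma cvnorm_ge0 n (u : 'cV[C]_n) : 0 <= cvnorm u.
Proof. exact: sqrtr_ge0. Qed.

Lemma sqnZ n (a : C) (u : 'cV[C]_n) : sqn (a *: u) = normc a ^+ 2 * sqn u.
Proof. by rewrite !sqn_qform qformZ. Qed.

Lemma normc_cR (a : R) : normc (cR a) ^+ 2 = a ^+ 2.
Proof. by rewrite normc_sqr /= expr0n addr0. Qed.

Lemma cvnorm_unit n (u : 'cV[C]_n) : u != 0 ->
  cvnorm (cR (cvnorm u)^-1 *: u) = 1.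
Proof.
move=> u0; apply/eqP; rewrite -(@eqrXn2 _ 2) ?cvnorm_ge0 // expr1n cvnorm_sqr.
rewrite sqnZ normc_cR exprVn cvnorm_sqr mulVf //.
by rewrite sqn_eq0.
Qed.

Lemma sqn_mulmx n (E : 'M[C]_n) (u : 'cV[C]_n) : sqn (E *m u) = qform (mxadj E *m E) u.
Proof. by rewrite sqn_qform -qform_congr mulmx1. Qed.

Lemma specnorm_bounded n (E : 'M[C]_n) :
  has_ubound [set cvnorm (E *m x) | x in [set x : 'cV[C]_n | cvnorm x = 1]].
Proof.
pose e := \sum_i \sum_j normc ((mxadj E *m E) i j).
have eP i j : normc ((mxadj E *m E) i j) <= e.
  rewrite /e (bigD1 i) //= (bigD1 j) //= -addrA lerDl addr_ge0 ?sumr_ge0 // => k _.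
    exact: normc_ge0.
  by apply: sumr_ge0 => l _; exact: normc_ge0.
exists (Num.sqrt (e * n%:R)) => _ [x /= x1 <-].
apply: ler_wsqrtr; rewrite -/(sqn _) sqn_mulmx.
by apply: le_trans (qform_entry_bound _ eP) _; rewrite -cvnorm_sqr x1 expr1n mulr1.
Qed.

Lemma specnorm_sqn n (E : 'M[C]_n) u : 0 <= specnorm E * sqn u /\
  sqn (E *m u) <= specnorm E ^+ 2 * sqn u.
Proof.
have [->|u0] := eqVneq u 0.
  by rewrite mulmx0 !sqn_qform !qform0 !mulr0.
have le : cvnorm (E *m (cR (cvnorm u)^-1 *: u)) <= specnorm E.
  apply: sup_ubound; first exact: specnorm_bounded.
  by exists (cR (cvnorm u)^-1 *: u) => //=; exact: cvnorm_unit.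
have N0 : 0 <= specnorm E by apply: le_trans le; exact: cvnorm_ge0.
split; first by rewrite mulr_ge0 // sqn_ge0.
have : cvnorm (E *m (cR (cvnorm u)^-1 *: u)) ^+ 2 <= specnorm E ^+ 2.
  by rewrite ler_pXn2r // nnegrE // cvnorm_ge0.
rewrite cvnorm_sqr -scalemxAr sqnZ normc_cR exprVn cvnorm_sqr mulrC.
by rewrite ler_pdivrMr // sqn_gt0.
Qed.

(** A weighted arithmetic-geometric mean inequality in place of Cauchy-Schwarz; with [v = E u] and
    the weight [s = specnorm E] it yields the bound of a form by the spectral norm. *)
Lemma Re_sform_le n (u v : 'cV[C]_n) (s : R) : 0 < s ->
  `|complex.Re (sform 1%:M u v)| <= (s * sqn u + sqn v / s) / 2.
Proof.
move=> s0; rewrite sform1 (raddf_sum (@complex.Re R)).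
apply: le_trans (ler_norm_sum _ _ _) _.
rewrite mulr_sumr !mulr_suml -big_split /= mulr_suml; apply: ler_sum => i _.
rewrite !normc_sqr; case: (u i 0) => a b; case: (v i 0) => c d /=.
rewrite [X in X / 2](_ : _ = ((s * a) ^+ 2 + c ^+ 2 + ((s * b) ^+ 2 + d ^+ 2)) / s); last first.
  by field; rewrite gt_eqF.
rewrite mulrAC ler_pdivlMr // -[s in leLHS]gtr0_norm // -normrM ler_norml.
apply/andP; split.
  by have := sqr_ge0 (s * a + c); have := sqr_ge0 (s * b + d); nra.
by have := sqr_ge0 (s * a - c); have := sqr_ge0 (s * b - d); nra.
Qed.

Lemma qform_specnorm n (E : 'M[C]_n) u : `|qform E u| <= specnorm E * sqn u.
Proof.
have [N0 Nle] := specnorm_sqn E u.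
have -> : qform E u = complex.Re (sform 1%:M u (E *m u)).
  by rewrite /qform /sform mulmx1 mulmxA.
have [->|u0] := eqVneq u 0.
  by rewrite mulmx0 /sform mulmx0 mxE normr0 sqn_qform qform0 mulr0.
have N0' : 0 <= specnorm E by move: N0; rewrite pmulr_lge0 // sqn_gt0.
have [N00|Np] := eqVneq (specnorm E) 0.
  have /eqP : sqn (E *m u) = 0.
    by apply/le_anti; rewrite sqn_ge0 andbT (le_trans Nle) // N00 expr0n mul0r.
  by rewrite sqn_eq0 => /eqP ->; rewrite /sform mulmx0 mxE normr0 N00 mul0r.
have {}Np : 0 < specnorm E by rewrite lt_def Np.
apply: le_trans (Re_sform_le _ _ Np) _.
have : sqn (E *m u) / specnorm E <= specnorm E * sqn u.
  by rewrite ler_pdivrMr // mulrAC -expr2.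
move: (sqn (_ *m _) / _) (specnorm _ * _) => x y; lra.
Qed.

Lemma crawford_qform n (A B : 'M[C]_n) u : hermitian A -> hermitian B ->
  0 <= crawford A B -> crawford A B ^+ 2 * sqn u ^+ 2 <= qform A u ^+ 2 + qform B u ^+ 2.
Proof.
move=> hA hB c0; have [->|u0] := eqVneq u 0.
  by rewrite sqn_qform !qform0 expr0n mulr0 addr0.
set x := cR (cvnorm u)^-1 *: u.
have le : crawford A B <= normc ((mxadj x *m (A + 'i%C *: B) *m x) 0 0).
  apply: ge_inf; first by exists 0 => _ [y _ <-]; exact: normc_ge0.
  by exists x => //=; exact: cvnorm_unit.
have : crawford A B ^+ 2 <= qform A x ^+ 2 + qform B x ^+ 2.
  have -> : qform A x ^+ 2 + qform B x ^+ 2 = normc ((mxadj x *m (A + 'i%C *: B) *m x) 0 0) ^+ 2.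
    rewrite -/(sform _ _ _) sform_addm sform_scalem !sform_real // normc_sqr /=; ring.
  by rewrite ler_pXn2r // nnegrE // normc_ge0.
rewrite /x !qformZ normc_cR exprVn cvnorm_sqr ![(_^-1 * _) ^+ 2]exprMn -mulrDr exprVn mulrC.
by rewrite ler_pdivlMr // exprn_gt0 // sqn_gt0.
Qed.

(* The two-dimensional heart of the Toeplitz-Hausdorff theorem. Subtracting from B the
   combination of A and the identity that makes its form vanish at u and at v, a rotation of v
   makes it vanish on the whole real span of u and v. *)
Lemma qform_interpolate n (A B : 'M[C]_n) (u v : 'cV[C]_n) (eta : R) :
  hermitian A -> hermitian B -> 0 < qform A u -> qform A v < 0 ->
  `|qform B u| <= eta * sqn u -> `|qform B v| <= eta * sqn v ->
  exists w, [/\ w != 0, qform A w = 0 & `|qform B w| <= eta * sqn w].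
Proof.
move=> hA hB Au Av Bu Bv.
have u0 : u != 0 by apply: contraTneq Au => ->; rewrite qform0 ltxx.
have v0 : v != 0 by apply: contraTneq Av => ->; rewrite qform0 ltxx.
have su : 0 < sqn u by rewrite sqn_gt0.
have sv : 0 < sqn v by rewrite sqn_gt0.
set det := qform A u * sqn v - qform A v * sqn u.
have det0 : 0 < det.
  by rewrite /det subr_gt0 (@lt_trans _ _ 0) ?nmulr_rlt0 ?mulr_gt0 // nmulr_rlt0.
pose al := (qform B u * sqn v - qform B v * sqn u) / det.
pose be := (qform A u * qform B v - qform A v * qform B u) / det.
pose B' := B - (cR al *: A + cR be *: 1%:M).
have hB' : hermitian B'.
  apply: hermitianB => //; apply: hermitianD; apply: hermitianZ => //; exact: hermitian1.
have qB' x : qform B' x = qform B x - (al * qform A x + be * sqn x).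
  by rewrite qformBm qformDm !qformZm sqn_qform.
have det_neq : det != 0 by rewrite gt_eqF.
have B'u : qform B' u = 0 by rewrite qB'; have [] := cramer2 (qform B u) (qform B v) det_neq.
have B'v : qform B' v = 0 by rewrite qB'; have [] := cramer2 (qform B u) (qform B v) det_neq.
(* [be] is a mean of the quotients [qform B / sqn] at [u] and [v], with the positive weights
   [qform A u * sqn v] and [- qform A v * sqn u]. At the final [w], where [A] vanishes, the quotient
   of [B] is exactly [be]. *)
have beta : `|be| <= eta.
  rewrite /be normrM normfV (gtr0_norm det0) ler_pdivrMr //.
  apply: le_trans (ler_normB _ _) _; rewrite !normrM (gtr0_norm Au) (ltr0_norm Av).
  have h1 : qform A u * `|qform B v| <= qform A u * (eta * sqn v) by rewrite ler_wpM2l // ltW.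
  have h2 : - qform A v * `|qform B u| <= - qform A v * (eta * sqn u).
    by rewrite ler_wpM2l // oppr_ge0 ltW.
  rewrite /det; move: h1 h2.
  move: (qform A u * _) (qform A v) (sqn u) (sqn v) => *; lra.
(* The rotation [i * conj(s)] turns the cross term [s] into [i |s|^2], which has real part 0. *)
have [z z0 Rez] : exists2 z : C, z != 0 & complex.Re (sform B' u (z *: v)) = 0.
  have [s0|s0] := eqVneq (sform B' u v) 0.
    by exists 1; rewrite ?oner_eq0 // sformZr s0 mulr0.
  exists ('i%C * conjc (sform B' u v)).
    rewrite mulf_neq0 ?conjc_eq0 //.
    by rewrite eq_complex /= oner_eq0 andbF.
  rewrite sformZr -mulrA conjcM_normc.
  by rewrite /=; ring.
pose v' := z *: v.
have nz : 0 < normc z ^+ 2.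
  rewrite exprn_gt0 // lt_def normc_ge0 andbT.
  by apply: contra z0 => /eqP/ComplexField.Normc.eq0_normc ->.
have Av' : qform A v' < 0 by rewrite qformZ pmulr_rlt0.
have B'v' : qform B' v' = 0 by rewrite qformZ B'v mulr0.
set c := complex.Re (sform A u v').
have Aw (y : R) : qform A (u + cR y *: v') = qform A u + y ^+ 2 * qform A v' + 2 * (y * c).
  rewrite qformD // qformZ normc_cR sformZr /c.
  by case: (sform A u v') => e f /=; rewrite mul0r subr0.
have B'w (y : R) : qform B' (u + cR y *: v') = 0.
  rewrite qformD // qformZ normc_cR B'u B'v' sformZr.
  move: Rez; rewrite -/v'; case: (sform B' u v') => e f /= ->.
  by rewrite !mul0r !mulr0 subr0 mulr0 !addr0.
pose disc := c ^+ 2 - qform A u * qform A v'.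
have disc0 : 0 <= disc.
  by rewrite subr_ge0 (@le_trans _ _ 0) ?sqr_ge0 // ltW // pmulr_rlt0.
pose y := (- c - Num.sqrt disc) / qform A v'.
have Aw0 : qform A (u + cR y *: v') = 0.
  have sd : Num.sqrt disc ^+ 2 = c ^+ 2 - qform A u * qform A v' by rewrite sqr_sqrtr.
  have q0 : qform A v' != 0 by rewrite lt_eqF.
  by rewrite Aw /y; exact: quadratic_root q0 sd.
exists (u + cR y *: v'); split=> //.
  apply/eqP => /eqP; rewrite addr_eq0 => /eqP uE.
  move: Au; rewrite uE -scaleNr qformZ -cRN normc_cR ltNge => /negP; apply.
  by rewrite mulr_ge0_le0 ?sqr_ge0 // ltW.
have := B'w y; rewrite qB' Aw0 mulr0 add0r => /eqP; rewrite subr_eq0 => /eqP ->.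
by rewrite normrM (ger0_norm (sqn_ge0 _)) ler_wpM2r // sqn_ge0.
Qed.

End FormBounds.

(** * Diagonalized pencils *)

Lemma sum_changes_le1 (c : nat -> bool) (J : nat) : (forall j, c j -> c j.+1) ->
  (\sum_(j < J) (c j != c j.+1) <= 1)%N.
Proof.
move=> mono; suff E : (c 0 + \sum_(j < J) (c j != c j.+1))%N = c J.
  by apply: leq_trans (leq_addl (c 0) _) _; rewrite E leq_b1.
elim: J => [|J IH]; first by rewrite big_ord0 addn0.
rewrite big_ord_recr /= addnA IH; have := mono J.
by case: (c J) (c J.+1) => [] [] // ->.
Qed.

Lemma le_larger (R : realFieldType) (P M s x : R) :
  P + M = 2 * s -> x <= s -> M <= P -> x <= P.
Proof. lra. Qed.

Lemma le_cross_sum (R : realFieldType) (x y N s1 s2 : R) :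
  y * x <= y * (N * s2) -> x * y <= x * (N * s1) -> 2 * (x * y) <= (x * s1 + y * s2) * N.
Proof. lra. Qed.

Definition form_le (R : realType) n (N : R) (B : 'M[R[i]]_n) : Prop :=
  forall u, `|qform B u| <= N * sqn u.

Definition crawford_ge (R : realType) n (g : R) (A B : 'M[R[i]]_n) : Prop :=
  forall u, g ^+ 2 * sqn u ^+ 2 <= qform A u ^+ 2 + qform B u ^+ 2.

Lemma separation_bound (R : realFieldType) (g w P d N : R) :
  0 < g -> 0 <= w -> 0 < P -> 0 < N -> (g * w) ^+ 2 <= (P * d) ^+ 2 -> 2 * P / N <= w ->
  2 * g / N <= `|d|.
Proof.
move=> g0 w0 P0 N0 sq Pw.
have gw : g * w <= P * `|d|.
  rewrite -(ger0_norm (mulr_ge0 (ltW g0) w0)) -[P]gtr0_norm // -normrM.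
  by rewrite -ler_sqr ?nnegrE // !real_normK ?num_real.
rewrite -(ler_pM2l P0); apply: le_trans gw.
have -> : P * (2 * g / N) = g * (2 * P / N) by field; rewrite gt_eqF.
by rewrite ler_wpM2l // ltW.
Qed.

Section DiagonalizedPencil.
Variable R : realType.
Local Notation C := (R[i]).
Local Notation hermitian := Defs.hermitian.
Local Notation normc := (@ComplexField.Normc.normc R).
Variables (n : nat) (A B S : 'M[C]_n) (a b : nat -> R) (N g : R).
Hypotheses (hA : hermitian A) (hB : hermitian B) (uS : S \in unitmx)
  (dA : mxadj S *m A *m S = rdiag n a) (dB : mxadj S *m B *m S = rdiag n b)
  (N0 : 0 < N) (g0 : 0 < g) (leB : form_le N B) (crawfordP : crawford_ge g A B).

Local Notation H x := (A - cR x *: B).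

Lemma rdiag_sub_scale (x : R) : rdiag n a - cR x *: rdiag n b = rdiag n (fun i => a i - x * b i).
Proof.
apply/matrixP => i j; rewrite !mxE; case: eqP => _; rewrite ?mulr1n ?mulr0n ?mulr0 ?subr0 //.
by rewrite cRD cRN cRM.
Qed.

Lemma nneg_shifted (x : R) : nneg (H x) = #|negset n (fun i => a i - x * b i)|.
Proof.
apply: (nneg_diag uS); rewrite mulmxBr mulmxBl -scalemxAr -scalemxAl dA dB.
exact: rdiag_sub_scale.
Qed.

Let e (k : 'I_n) : 'cV[C]_n := S *m delta_mx k 0.

Lemma column_neq0 k : e k != 0.
Proof.
apply/eqP => /(congr1 (mulmx (invmx S))); rewrite (mulKmx uS) mulmx0 => /matrixP/(_ k 0)/eqP.
by rewrite !mxE !eqxx oner_eq0.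
Qed.

Lemma column_form (M : 'M[C]_n) (m : nat -> R) k :
  mxadj S *m M *m S = rdiag n m -> qform M (e k) = m k.
Proof.
move=> dM; rewrite (qform_diag _ dM) (bigD1 k) //= big1 ?addr0 => [|i ik].
  by rewrite !mxE !eqxx ComplexField.Normc.normc1 expr1n mulr1.
by rewrite !mxE (negPf ik) ComplexField.Normc.normc0 expr0n mulr0.
Qed.

Lemma pair_form (M : 'M[C]_n) (m : nat -> R) (k l : 'I_n) (x y : R) : k != l ->
  mxadj S *m M *m S = rdiag n m ->
  qform M (cR x *: e k + cR y *: e l) = x ^+ 2 * m k + y ^+ 2 * m l.
Proof.
move=> kl dM; rewrite /e !scalemxAr -mulmxDr (qform_diag _ dM).
have E (i : 'I_n) : (cR x *: delta_mx k 0 + cR y *: delta_mx l 0 : 'cV[C]_n) i 0 =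
    if i == k then cR x else if i == l then cR y else 0.
  rewrite !mxE eqxx !andbT; case: (eqVneq i k) => [->|_]; last case: (eqVneq i l) => _.
  - by rewrite (negPf kl) mulr1 mulr0 addr0.
  - by rewrite mulr1 mulr0 add0r.
  - by rewrite !mulr0 addr0.
rewrite (bigD1 k) //= (bigD1 l) /= 1?eq_sym // big1 => [|i /andP[ik il]].
  by rewrite !E !eqxx eq_sym (negPf kl) !normc_cR addr0 mulrC [m l * _]mulrC.
by rewrite E (negPf ik) (negPf il) ComplexField.Normc.normc0 expr0n mulr0.
Qed.

Lemma diag_neq0 (k : 'I_n) : (a k != 0) || (b k != 0).
Proof.
rewrite -negb_and; apply/negP => /andP[/eqP ak /eqP bk].
have := crawfordP (e k); rewrite (column_form _ dA) (column_form _ dB) ak bk expr0n addr0 leNgt.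
by rewrite mulr_gt0 // exprn_gt0 // sqn_gt0 column_neq0.
Qed.

(* On w = |b_l|^(1/2) e_k +- b_k^(1/2) e_l the form of B vanishes and that of A equals
   |b_l| b_k (lambda_k - lambda_l); the sign is chosen so that w is not short. *)
Lemma opposite_signs_far (k l : 'I_n) : 0 < b k -> b l < 0 ->
  2 * g / N <= `|a k / b k - a l / b l|.
Proof.
move=> bk bl; have kl : k != l by apply: contraTneq bk => ->; rewrite -leNgt ltW.
have bl' : 0 < - b l by rewrite oppr_gt0.
pose x := Num.sqrt (- b l); pose y := Num.sqrt (b k).
have x2 : x ^+ 2 = - b l by rewrite sqr_sqrtr // ltW.
have y2 : y ^+ 2 = b k by rewrite sqr_sqrtr // ltW.
pose u := cR x *: e k; pose v := cR y *: e l.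
have par : sqn (u + v) + sqn (u - v) = 2 * (sqn u + sqn v).
  rewrite /sqn -!big_split /= mulr_sumr; apply: eq_bigr => i _.
  rewrite !mxE !normc_sqr; case: (u i 0) => c1 c2; case: (v i 0) => c3 c4 /=; ring.
have Nk : b k <= N * sqn (e k).
  by rewrite -(column_form k dB); apply: le_trans (leB _); exact: ler_norm.
have Nl : - b l <= N * sqn (e l).
  by rewrite -(column_form l dB); apply: le_trans (leB _); rewrite -normrN; exact: ler_norm.
have suv : 2 * (- b l * b k) / N <= sqn u + sqn v.
  rewrite /u /v !sqnZ !normc_cR x2 y2 ler_pdivrMr //.
  exact: le_cross_sum (ler_wpM2l (ltW bk) Nl) (ler_wpM2l (ltW bl') Nk).
have [s [s1 ws]] : exists s : R, s ^+ 2 = 1 /\ 2 * (- b l * b k) / N <= sqn (u + cR s *: v).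
  have [h|h] := leP (sqn (u - v)) (sqn (u + v)).
    exists 1; split; first by rewrite expr1n.
    by rewrite scale1r; exact: le_larger par suv h.
  exists (-1); split; first by rewrite sqrrN expr1n.
  by rewrite cRN scaleN1r; apply: le_larger suv (ltW h); rewrite addrC.
have wE : u + cR s *: v = cR x *: e k + cR (s * y) *: e l by rewrite /v scalerA -cRM.
have := crawfordP (u + cR s *: v).
rewrite {2 3}wE (pair_form _ _ kl dA) (pair_form _ _ kl dB) exprMn s1 mul1r x2 y2.
set w := sqn _ in ws *; have -> : - b l * b k + b k * b l = 0 by ring.
have -> : - b l * a k + b k * a l = (- b l * b k) * (a k / b k - a l / b l).
  by field; rewrite ?(gt_eqF bk) ?(lt_eqF bl).
rewrite expr0n [_ + 0]addr0 -[leLHS]exprMn => h.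
have p0 : 0 < - b l * b k by exact: mulr_gt0.
exact: separation_bound g0 (sqn_ge0 _) p0 N0 h ws.
Qed.

Lemma between_sign (g1 g2 : R) (k : 'I_n) : g1 < g2 -> b k != 0 -> g1 < a k / b k < g2 ->
  if 0 < b k then (0 < a k - g1 * b k) && (a k - g2 * b k < 0)
  else (a k - g1 * b k < 0) && (0 < a k - g2 * b k).
Proof.
move=> g12 bk /andP[h1 h2]; case: ltP => bp; apply/andP.
  by move: h1 h2; rewrite ltr_pdivlMr // ltr_pdivrMr // => h1 h2; split; lra.
have {}bp : b k < 0 by rewrite lt_def eq_sym bk.
by move: h1 h2; rewrite ltr_ndivlMr // ltr_ndivrMr // => h1 h2; split; lra.
Qed.

(** Eigenvalues with [b] of opposite signs are at least [2 g / N] apart, so all those in one closed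
    cell have [b] of the same sign. Across the cell their entries [a - x b] thus change sign in the
    same direction, and no third entry can compensate: the negative sets are nested and differ at
    least by [k] and [l]. *)
Lemma collision_jump (g1 g2 : R) (k l : 'I_n) : g1 < g2 -> g2 - g1 < 2 * g / N -> k != l ->
  b k != 0 -> b l != 0 -> g1 < a k / b k < g2 -> g1 < a l / b l < g2 ->
  (nneg (H g1) + 2 <= nneg (H g2))%N \/ (nneg (H g2) + 2 <= nneg (H g1))%N.
Proof.
move=> g12 gap kl bk bl lk ll.
have transport (p q p' q' : nat) : p = p' -> q = q' ->
  (p' + 2 <= q')%N \/ (q' + 2 <= p')%N -> (p + 2 <= q)%N \/ (q + 2 <= p)%N by move=> -> ->.
apply: (transport _ _ _ _ (nneg_shifted g1) (nneg_shifted g2)).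
have near_sign (m m' : 'I_n) : 0 < b m -> b m' < 0 -> g1 <= a m / b m <= g2 ->
    g1 <= a m' / b m' <= g2 -> False.
  move=> p q /andP[? ?] /andP[? ?]; have := opposite_signs_far p q; rewrite leNgt => /negP; apply.
  by rewrite ltr_norml; apply/andP; split; lra.
have lek (m : 'I_n) : g1 < a m / b m < g2 -> g1 <= a m / b m <= g2.
  by move=> /andP[/ltW -> /ltW ->].
have step (P P' : {set 'I_n}) : P \subset P' -> k \in P' -> l \in P' -> k \notin P -> l \notin P ->
    (#|P| + 2 <= #|P'|)%N.
  move=> PP' k1 l1 k0 l0.
  have -> : 2%N = #|[set k; l]%SET| by rewrite cards2 kl.
  rewrite -cardsUI (_ : P :&: [set k; l]%SET = finset.set0) ?cards0 ?addn0.
    apply: subset_leq_card; rewrite finset.subUset PP' /=; apply/fintype.subsetP => m.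
    by rewrite !inE => /orP[] /eqP ->.
  by apply/setP => m; rewrite !inE; apply/negP => /andP[mP /orP[] /eqP E]; move: mP;
    rewrite E ?(negPf k0) ?(negPf l0).
have := between_sign g12 bk lk; have := between_sign g12 bl ll.
case: (ltP 0 (b l)) => bl0; case: (ltP 0 (b k)) => bk0.
- move=> /andP[l1 l2] /andP[k1 k2]; left; apply: step; rewrite ?inE -?leNgt //; do ?exact: ltW.
  apply/fintype.subsetP => m; rewrite !inE => m1; rewrite ltNge; apply/negP => m2.
  have bm : b m < 0.
    rewrite ltNge; apply/negP => bm; have : (g2 - g1) * b m >= 0 by rewrite mulr_ge0 // subr_ge0 ltW.
    lra.
  apply: (near_sign k m) => //; first exact: lek.
  by rewrite ler_ndivlMr // ler_ndivrMr //; apply/andP; split; lra.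
- exfalso; apply: (near_sign l k) => //; rewrite ?lek //.
  by rewrite lt_def eq_sym bk.
- exfalso; apply: (near_sign k l) => //; rewrite ?lek //.
  by rewrite lt_def eq_sym bl.
- have {}bk0 : b k < 0 by rewrite lt_def eq_sym bk.
  move=> /andP[l1 l2] /andP[k1 k2]; right; apply: step; rewrite ?inE -?leNgt //; do ?exact: ltW.
  apply/fintype.subsetP => m; rewrite !inE => m1; rewrite ltNge; apply/negP => m2.
  have bm : 0 < b m.
    rewrite ltNge; apply/negP => bm.
    have : (g2 - g1) * b m <= 0 by rewrite mulr_ge0_le0 // subr_ge0 ltW.
    lra.
  apply: (near_sign m k) => //; last exact: lek.
  by rewrite ler_pdivlMr // ler_pdivrMr //; apply/andP; split; lra.
Qed.

(** Each entry [a k - x b k] is monotone in [x], so its sign changes at most once along the whole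
    grid. The total is therefore bounded by [n] and not by the number of cells. *)
Lemma sum_jumps_le (z om : R) (J : nat) : 0 < om ->
  (\sum_(j < J) ((nneg (H (z + j%:R * om)) < nneg (H (z + j.+1%:R * om))) +
     (nneg (H (z + j.+1%:R * om)) < nneg (H (z + j%:R * om)))) <= n)%N.
Proof.
move=> om0; pose f j := nneg (H (z + j%:R * om)).
rewrite -[X in (X <= _)%N]/(\sum_(j < J) ((f j < f j.+1) + (f j.+1 < f j)))%N.
pose c (k : 'I_n) (j : nat) := a k - (z + j%:R * om) * b k < 0.
pose P j := negset n (fun i => a i - (z + j%:R * om) * b i).
have step (X Y : {set 'I_n}) : ((#|X| < #|Y|) + (#|Y| < #|X|) <= \sum_(k < n) ((k \in X) != (k \in Y)))%N.
  have [->|] := eqVneq X Y; first by rewrite ltnn.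
  move=> XY; apply: (@leq_trans 1); first by case: ltngtP.
  have [k kXY] : exists k, (k \in X) != (k \in Y).
    apply/existsP; apply: contraNT XY; rewrite negb_exists => /forallP h.
    by apply/eqP/setP => k; have := h k; rewrite negbK => /eqP.
  by rewrite (bigD1 k) //= kXY.
apply: (@leq_trans (\sum_(j < J) \sum_(k < n) (c k j != c k j.+1))).
  have fP j : f j = #|P j| by exact: nneg_shifted.
  apply: leq_sum => j _; rewrite !fP; apply: leq_trans (step _ _) _.
  by apply: leq_sum => k _; rewrite !inE.
rewrite exchange_big /=; apply: (@leq_trans (\sum_(k < n) 1)); last by rewrite sum1_card card_ord.
apply: leq_sum => k _.
have incr (j : nat) : j%:R * om <= j.+1%:R * om by apply: ler_wpM2r; [exact: ltW | rewrite ler_nat].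
have [bk|bk] := leP 0 (b k).
  apply: sum_changes_le1 => j; rewrite /c; apply: le_lt_trans.
  by rewrite lerD2l lerN2; apply: ler_wpM2r => //; rewrite lerD2l.
under eq_bigr do rewrite -(inj_eq negb_inj).
apply: (@sum_changes_le1 (fun j => ~~ c k j)) => j; rewrite /c -!leNgt => /le_trans; apply.
by rewrite lerD2l lerN2; apply: ler_wnM2r; [exact: ltW | rewrite lerD2l].
Qed.

Lemma pencil_poly_factor : exists2 c : C, c != 0 &
  pencil_poly A B = c *: \prod_(k < n) ((cR (a k))%:P - 'X * (cR (b k))%:P).
Proof.
pose Sp := map_mx (polyC : C -> {poly C}) S.
pose Tp := map_mx (polyC : C -> {poly C}) (mxadj S).
have dSp : \det Sp = (\det S)%:P by rewrite det_map_mx.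
have dTp : \det Tp = (\det (mxadj S))%:P by rewrite det_map_mx.
have dS0 : \det S != 0 by rewrite -unitfE -unitmxE.
have dT0 : \det (mxadj S) != 0.
  by rewrite /mxadj det_tr det_map_mx conjc_eq0.
exists ((\det (mxadj S))^-1 * (\det S)^-1); first by rewrite mulf_neq0 // invr_eq0.
have E : \det Tp * pencil_poly A B * \det Sp = \prod_(k < n) ((cR (a k))%:P - 'X * (cR (b k))%:P).
  rewrite -!det_mulmx mulmxBr mulmxBl -scalemxAr -scalemxAl -!map_mxM dA dB.
  have -> : map_mx polyC (rdiag n a) - 'X *: map_mx polyC (rdiag n b) =
      diag_mx (\row_k ((cR (a k))%:P - 'X * (cR (b k))%:P)).
    apply/matrixP => i j; rewrite !mxE; case: eqP => [->|_]; first by rewrite !mulr1n.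
    by rewrite !mulr0n mulr0 subr0.
  by rewrite det_diag; apply: eq_bigr => i _; rewrite !mxE.
rewrite -E dSp dTp -mul_polyC; move: (pencil_poly A B) (\det S) (\det (mxadj S)) dS0 dT0 => P x y x0 y0.
have -> : (y^-1 / x)%:P * (y%:P * P * x%:P) = (y^-1 / x)%:P * y%:P * x%:P * P by ring.
rewrite -!polyCM (_ : y^-1 / x * y * x = 1) ?mul1r //.
by field; rewrite x0 y0.
Qed.

(** Indices with [b k = 0] are eigenvalues at infinity: their factors are constants, and nonzero by
    [diag_neq0]. *)
Lemma root_pencil (z : C) : root (pencil_poly A B) z ->
  exists2 k : 'I_n, b k != 0 & z = cR (a k / b k).
Proof.
have [c c0 ->] := pencil_poly_factor; rewrite rootZ // rootE horner_prod => /prodf_eq0[k _].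
rewrite !hornerE => /eqP h; have bk : b k != 0.
  apply: contraTneq (diag_neq0 k) => bk0; move: h.
  by rewrite bk0 mulr0 subr0 eqxx orbF negbK => -[->].
exists k => //; apply: (mulIf (_ : cR (b k) != 0)).
  by apply: contra bk => /eqP -[->].
by rewrite -cRM divfK //; apply/esym/eqP; rewrite -subr_eq0; apply/eqP.
Qed.

Lemma mup_pencil (k : 'I_n) : b k != 0 ->
  (forall l : 'I_n, l != k -> b l != 0 -> a l / b l != a k / b k) ->
  mup (cR (a k / b k)) (pencil_poly A B) = 1%N.
Proof.
move=> bk uniq; have [c c0 ->] := pencil_poly_factor.
have bk' : cR (b k) != 0 by apply: contra bk => /eqP -[->].
rewrite -mul_polyC mupMr; last by rewrite rootC.
rewrite (bigD1 k) //= mupMl; last first.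
  rewrite rootE horner_prod; apply/prodf_neq0 => l lk; apply/negP.
  rewrite !hornerE => /eqP h; have [bl|bl] := eqVneq (b l) 0.
    have := diag_neq0 l; rewrite bl eqxx orbF; move: h.
    by rewrite bl mulr0 subr0 => -[->]; rewrite eqxx.
  have /negP := uniq l lk bl; apply; move: h; rewrite -cRM -cRN -cRD => -[/eqP].
  by rewrite subr_eq0 => /eqP ->; rewrite mulfK.
have -> : (cR (a k))%:P - 'X * (cR (b k))%:P = (- cR (b k))%:P * ('X - (cR (a k / b k))%:P) ^+ 1.
  have E : cR (a k) = cR (b k) * cR (a k / b k) by rewrite -cRM mulrC divfK.
  by rewrite {1}E expr1 polyCN polyCM; ring.
rewrite mupMr; last by rewrite rootC oppr_eq0.
by rewrite mup_XsubCX eqxx.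
Qed.

End DiagonalizedPencil.

(** * Shifting the negative index site by site *)

Section Sites.
Variable R : realType.
Local Notation C := (R[i]).
Local Notation hermitian := Defs.hermitian.
Local Notation normc := (@ComplexField.Normc.normc R).
Variable n : nat.
Implicit Types (K : 'M[C]_n) (kap : nat -> R).

Lemma nneg_eq K K' : (forall u, qform K u = qform K' u) -> nneg K = nneg K'.
Proof.
move=> e; apply/eqP; rewrite eqn_leq; apply/andP; split; apply: nneg_mono => u.
  by rewrite e.
by rewrite e.
Qed.

Lemma qform_rdiag_cst (c : R) (u : 'cV[C]_n) : qform (rdiag n (fun=> c)) u = c * sqn u.
Proof. by rewrite qform_rdiag /sqn mulr_sumr. Qed.

Lemma qform_rdiag_le (d d' : nat -> R) (u : 'cV[C]_n) : (forall l : 'I_n, d l <= d' l) ->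
  qform (rdiag n d) u <= qform (rdiag n d') u.
Proof.
move=> le; rewrite !qform_rdiag; apply: ler_sum => l _.
by rewrite ler_wpM2r // sqr_ge0.
Qed.

Lemma qform_rdiagD (d d' : nat -> R) (u : 'cV[C]_n) :
  qform (rdiag n d) u + qform (rdiag n d') u = qform (rdiag n (fun l => d l + d' l)) u.
Proof. by rewrite !qform_rdiag -big_split /=; apply: eq_bigr => l _; rewrite mulrDl. Qed.

Lemma qform_rdiagB (d d' : nat -> R) (u : 'cV[C]_n) :
  qform (rdiag n d) u - qform (rdiag n d') u = qform (rdiag n (fun l => d l - d' l)) u.
Proof. by rewrite !qform_rdiag -sumrB /=; apply: eq_bigr => l _; rewrite mulrBl. Qed.

Lemma qform_rdiag_eq (d d' : nat -> R) (u : 'cV[C]_n) : (forall l : 'I_n, d l = d' l) ->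
  qform (rdiag n d) u = qform (rdiag n d') u.
Proof. by move=> e; rewrite !qform_rdiag; apply: eq_bigr => l _; rewrite e. Qed.

Definition part (kap : nat -> R) (i l : nat) : R := if (l < i)%N then kap l else 0.
Definition single (i : nat) (x : R) (l : nat) : R := if l == i then x else 0.

(* Increment of the negative index when the shift by kap is extended from the first i sites
   to the site i. *)
Definition site K kap (i : nat) : R :=
  (nneg (K - rdiag n (part kap i.+1)))%:R - (nneg (K - rdiag n (part kap i)))%:R.

Lemma site_sum K kap : \sum_(i < n) site K kap i = (nneg (K - rdiag n kap))%:R - (nneg K)%:R.
Proof.
have fn : nneg (K - rdiag n (part kap n)) = nneg (K - rdiag n kap).
  apply: nneg_eq => u; rewrite !qformBm; congr (_ - _); apply: qform_rdiag_eq => l.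
  by rewrite /part ltn_ord.
have f0 : nneg (K - rdiag n (part kap 0)) = nneg K.
  apply: nneg_eq => u; rewrite qformBm (@qform_rdiag_eq _ (fun=> 0)); last by [].
  by rewrite qform_rdiag_cst mul0r subr0.
pose f i : R := (nneg (K - rdiag n (part kap i)))%:R.
transitivity (\sum_(0 <= i < n) (f i.+1 - f i)); first by rewrite big_mkord.
rewrite (telescope_sumr f (leq0n n)); exact: (f_equal2 (fun p q : nat => (p%:R - q%:R : R)) fn f0).
Qed.

Lemma nneg_single_le K (i : nat) (x y : R) : x <= y ->
  (nneg (K + rdiag n (single i y)) <= nneg (K + rdiag n (single i x)))%N.
Proof.
move=> xy; apply: nneg_mono => u; rewrite !qformDm lerD2l; apply: qform_rdiag_le => l.
by rewrite /single; case: ifP.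
Qed.

Lemma nneg_single_S K (i : 'I_n) (x y : R) :
  (nneg (K + rdiag n (single i x)) <= (nneg (K + rdiag n (single i y))).+1)%N.
Proof.
apply: (@nneg_hyperplane _ _ _ _ i) => u ui; rewrite !qformDm; congr (_ + _).
rewrite !qform_rdiag; apply: eq_bigr => l _; rewrite /single.
have [e|//] := eqVneq (l : nat) i; have -> : l = i by exact: val_inj.
by rewrite ui ComplexField.Normc.normc0 expr0n !mulr0.
Qed.

Lemma site_shift K kap (i : nat) :
  nneg (K - rdiag n (part kap i.+1)) = nneg (K - rdiag n (part kap i) + rdiag n (single i (- kap i))).
Proof.
apply: nneg_eq => u; rewrite !qformDm !qformNm -addrA; congr (_ + _).
suff -> : qform (rdiag n (part kap i)) u =
    qform (rdiag n (part kap i.+1)) u + qform (rdiag n (single i (- kap i))) u.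
  by rewrite opprD addrNK.
rewrite qform_rdiagD; apply: qform_rdiag_eq => l; rewrite /part /single ltnS (leq_eqVlt l i).
by case: (eqVneq (l : nat) i) => [->|_] /=; rewrite ?ltnn ?subrr ?addr0.
Qed.

Lemma site_01 K kap (i : 'I_n) : 0 <= kap i -> 0 <= site K kap i <= 1.
Proof.
move=> k0; pose K1 := K - rdiag n (part kap i).
have e : nneg (K - rdiag n (part kap i)) = nneg (K1 + rdiag n (single i 0)).
  apply: nneg_eq => u; rewrite [RHS]qformDm (@qform_rdiag_eq (single i 0) (fun=> 0)).
    by rewrite qform_rdiag_cst mul0r addr0.
  by move=> l; rewrite /single; case: ifP.
have -> : site K kap i = (nneg (K1 + rdiag n (single i (- kap i))))%:R
    - (nneg (K1 + rdiag n (single i 0)))%:R :> R.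
  exact: (f_equal2 (fun p q : nat => (p%:R - q%:R : R)) (site_shift _ _ _) e).
have neg : - kap i <= 0 by rewrite oppr_le0.
have := @nneg_single_le K1 i (- kap i) 0 neg.
have := @nneg_single_S K1 i (- kap i) 0.
move: (nneg _) (nneg _) => p q h1 h2; apply/andP; split; first by rewrite subr_ge0 ler_nat.
by rewrite lerBlDr addrC natr1 ler_nat.
Qed.

(** As a function of its own entry [y] the index is nonincreasing and takes values that differ by at
    most one, so it has at most one unit step. The site counts this step when it falls between
    [y - kap i] and [y]; if [x' > x + kap i] there would be two separate steps. *)
Lemma site_window K kap (i : 'I_n) (x x' : R) : 0 <= kap i ->
  site (K + rdiag n (single i x)) kap i != 0 -> site (K + rdiag n (single i x')) kap i != 0 ->
  x' <= x + kap i.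
Proof.
move=> k0; pose K1 := K - rdiag n (part kap i); pose m y := nneg (K1 + rdiag n (single i y)).
have siteE y : site (K + rdiag n (single i y)) kap i = (m (y - kap i))%:R - (m y)%:R.
  apply: (f_equal2 (fun p q : nat => (p%:R - q%:R : R))).
    rewrite site_shift; apply: nneg_eq => u; rewrite !qformDm !qformNm.
    suff -> : qform (rdiag n (single i (y - kap i))) u =
        qform (rdiag n (single i y)) u + qform (rdiag n (single i (- kap i))) u.
      by rewrite addrA (addrAC (qform K u)).
    rewrite qform_rdiagD; apply: qform_rdiag_eq => l.
    by rewrite /single; case: ifP => _; rewrite ?addr0.
  by apply: nneg_eq => u; rewrite !qformDm !qformNm addrAC.
have mono y z : y <= z -> (m z <= m y)%N by exact: nneg_single_le.
have lip y z : (m y <= (m z).+1)%N by exact: nneg_single_S.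
rewrite (siteE x) (siteE x'); move: (m) mono lip => f mono lip; rewrite !subr_eq0 !eqr_nat => d1 d2.
rewrite leNgt; apply/negP => far.
have h1 : (f x' < f (x' - kap i)%R)%N.
  by rewrite ltn_neqAle eq_sym d2 mono // lerBlDr lerDl.
have h2 : (f (x' - kap i)%R <= f x)%N by apply: mono; rewrite lerBrDr ltW.
have h3 : (f x < f (x - kap i)%R)%N.
  by rewrite ltn_neqAle eq_sym d1 mono // lerBlDr lerDl.
have := lip (x - kap i) x'; rewrite leqNgt => /negP; apply.
by apply: leq_ltn_trans h3; apply: leq_trans h2.
Qed.

Lemma site_sum_ge K kap (m : nat) : (nneg K + m <= nneg (K - rdiag n kap))%N ->
  (m%:R : R) <= \sum_(i < n) site K kap i.
Proof. by rewrite site_sum lerBrDr -natrD ler_nat addnC. Qed.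

End Sites.

(** * Perturbed pencils *)

Section PseudospectrumJump.
Variable R : realType.
Local Notation C := (R[i]).
Local Notation hermitian := Defs.hermitian.

(** The singular matrix [H + N] lies strictly between [H - eta] and [H + eta] in the order of forms,
    and passing from a singular form to a strictly smaller one raises the index by [nneg_kernel]. *)
Lemma kernel_jump n (H N : 'M[C]_n) (u : 'cV[C]_n) (eta0 eta : R) : hermitian H -> hermitian N ->
  u != 0 -> (H + N) *m u = 0 -> eta0 < eta -> (forall w, `|qform N w| <= eta0 * sqn w) ->
  (nneg (H + rdiag n (fun=> eta)) < nneg (H - rdiag n (fun=> eta)))%N.
Proof.
move=> hH hN u0 Hu lt leN; apply: (@leq_ltn_trans (nneg (H + N))).
  apply: nneg_mono => w; rewrite !qformDm lerD2l qform_rdiag_cst.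
  apply: le_trans (ler_norm _) _; apply: le_trans (leN w) _.
  by rewrite ler_wpM2r ?sqn_ge0 // ltW.
apply: (nneg_kernel (hermitianD hH hN) u0 Hu) => w w0.
rewrite qformBm qformDm ltrD2l qform_rdiag_cst ltrNl.
apply: (@le_lt_trans _ _ (eta0 * sqn w)); last by rewrite ltr_pM2r // sqn_gt0.
by apply: le_trans (leN w); rewrite -normrN ler_norm.
Qed.

(* 71/50 stands for a rational number slightly above the square root of 2. *)
Lemma pseudospec_norm_bound (x e f eps M : R) : 0 < eps -> 0 <= e -> 0 <= f ->
  Num.sqrt (e ^+ 2 + f ^+ 2) <= eps -> `|x| <= M -> 1 <= M ->
  e + `|x| * f < 71 / 50 * eps * M.
Proof.
move=> eps0 e0 f0 le xM M1.
have le2 : e ^+ 2 + f ^+ 2 <= eps ^+ 2.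
  rewrite -[leLHS]sqr_sqrtr ?addr_ge0 ?sqr_ge0 //.
  by rewrite ler_sqr // nnegrE ?sqrtr_ge0 // ltW.
have h0 : 0 <= e + `|x| * f by rewrite addr_ge0 // mulr_ge0.
have M0 : 0 < M by apply: lt_le_trans M1.
have r0 : 0 < 71 / 50 * eps * M by rewrite !mulr_gt0 // divr_gt0.
rewrite -ltr_sqr ?nnegrE //; last exact: ltW.
have h1 : e + `|x| * f <= M * (e + f).
  rewrite mulrDr lerD //; first by rewrite ler_peMl.
  by rewrite ler_wpM2r.
have h2 : (M * (e + f)) ^+ 2 <= M ^+ 2 * (2 * eps ^+ 2).
  rewrite exprMn ler_wpM2l ?sqr_ge0 //.
  by have := sqr_ge0 (e - f); nra.
apply: (@le_lt_trans _ _ ((M * (e + f)) ^+ 2)).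
  by rewrite ler_sqr ?nnegrE // mulr_ge0 ?addr_ge0 // ltW.
apply: le_lt_trans h2 _.
have : 0 < M ^+ 2 * eps ^+ 2 by rewrite mulr_gt0 // exprn_gt0.
rewrite !exprMn; move: (M ^+ 2) (eps ^+ 2) => m2 e2 p; nra.
Qed.

Lemma specnorm_ge0 n (E : 'M[C]_n) (u : 'cV[C]_n) : u != 0 -> 0 <= specnorm E.
Proof. by move=> u0; have [+ _] := specnorm_sqn E u; rewrite pmulr_lge0 // sqn_gt0. Qed.

Lemma pseudospec_jump n (A B : 'M[C]_n) (x eps M : R) : hermitian A -> hermitian B ->
  0 < eps -> `|x| <= M -> 1 <= M -> sym_pseudospec eps A B (cR x) ->
  (nneg ((A - cR x *: B) + rdiag n (fun=> 71 / 50 * eps * M)%R) <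
   nneg ((A - cR x *: B) - rdiag n (fun=> 71 / 50 * eps * M)%R))%N.
Proof.
move=> hA hB eps0 xM M1 [u [E [F [u0 hE hF le eq]]]].
have E0 := specnorm_ge0 E u0; have F0 := specnorm_ge0 F u0.
have lt := pseudospec_norm_bound eps0 E0 F0 le xM M1.
apply: (@kernel_jump _ _ (E - cR x *: F) u _ _ _ _ u0 _ lt).
- by apply: hermitianB => //; exact: hermitianZ.
- by apply: hermitianB => //; exact: hermitianZ.
- have -> : A - cR x *: B + (E - cR x *: F) = (A + E) - cR x *: (B + F).
    by rewrite scalerDr opprD addrACA.
  by rewrite mulmxBl eq -scalemxAl subrr.
- move=> w; rewrite qformBm qformZm mulrDl; apply: le_trans (ler_normB _ _) _.
  apply: lerD; first exact: qform_specnorm.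
  by rewrite normrM -mulrA; apply: ler_wpM2l => //; exact: qform_specnorm.
Qed.

Lemma eigenvalue_jump n (A B : 'M[C]_n) (x eta : R) (u : 'cV[C]_n) : hermitian A -> hermitian B ->
  0 < eta -> u != 0 -> A *m u = cR x *: (B *m u) ->
  (nneg ((A - cR x *: B) + rdiag n (fun=> eta)) < nneg ((A - cR x *: B) - rdiag n (fun=> eta)))%N.
Proof.
move=> hA hB eta0 u0 eq; apply: (@kernel_jump _ _ 0 u 0 eta _ _ u0 _ eta0).
- by apply: hermitianB => //; exact: hermitianZ.
- by rewrite /Defs.hermitian /mxadj map_mx0 trmx0.
- by rewrite addr0 mulmxBl eq -scalemxAl subrr.
- by move=> w; rewrite /qform /sform mulmx0 mul0mx mxE normr0 mul0r.
Qed.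

End PseudospectrumJump.

(** From [(a + x)^2 >= a^2/2 - x^2]: the sum is at least [(g^2/2 - 2 t^2) s^2], and [8 t^2 <= g^2]
    leaves [g^2/4]. This is where half of the Crawford number is kept. *)
Lemma perturbed_pair_bound (R : realFieldType) (a b x y t g s : R) :
  8 * t ^+ 2 <= g ^+ 2 -> `|x| <= t * s -> `|y| <= t * s -> g ^+ 2 * s ^+ 2 <= a ^+ 2 + b ^+ 2 ->
  (g / 2) ^+ 2 * s ^+ 2 <= (a + x) ^+ 2 + (b + y) ^+ 2.
Proof.
move=> tg xs ys ab.
have x2 : x ^+ 2 <= t ^+ 2 * s ^+ 2.
  by rewrite -exprMn -real_normK ?num_real // ler_pXn2r // nnegrE // (le_trans _ xs).
have y2 : y ^+ 2 <= t ^+ 2 * s ^+ 2.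
  by rewrite -exprMn -real_normK ?num_real // ler_pXn2r // nnegrE // (le_trans _ ys).
have gs : 8 * (t ^+ 2 * s ^+ 2) <= g ^+ 2 * s ^+ 2 by rewrite mulrA ler_wpM2r // sqr_ge0.
have := sqr_ge0 (a + 2 * x); have := sqr_ge0 (b + 2 * y).
rewrite exprMn; move: (t ^+ 2 * _) gs x2 y2 => T; lra.
Qed.

Section PerturbedPencil.
Variable R : realType.
Local Notation C := (R[i]).
Local Notation hermitian := Defs.hermitian.
Variables (n : nat) (mu M : R).
Hypotheses (mu0 : 0 <= mu).

Definition perturb (A : 'M[C]_n) (d : nat -> R) : 'M[C]_n := A + cR mu *: rdiag n d.

Lemma perturb_hermitian A d : hermitian A -> hermitian (perturb A d).
Proof. by move=> hA; apply: hermitianD => //; apply: hermitianZ; exact: hermitian_rdiag. Qed.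

Lemma qform_perturb A d u : qform (perturb A d) u = qform A u + qform (rdiag n (fun l => mu * d l)) u.
Proof.
rewrite /perturb qformDm qformZm; congr (_ + _).
by rewrite !qform_rdiag mulr_sumr; apply: eq_bigr => l _; rewrite mulrA.
Qed.

Lemma qform_rdiag_norm (d : nat -> R) (u : 'cV[C]_n) : (forall l : 'I_n, `|d l| <= M) ->
  `|qform (rdiag n (fun l => mu * d l)) u| <= mu * M * sqn u.
Proof.
move=> dM; rewrite -qform_rdiag_cst ler_norml -qformNm; apply/andP; split.
  have -> : qform (- rdiag n (fun=> mu * M)) u = qform (rdiag n (fun=> - (mu * M))) u.
    by rewrite qformNm !qform_rdiag_cst mulNr.
  apply: qform_rdiag_le => l; have := dM l; rewrite ler_norml => /andP[h1 h2].
  by rewrite -mulrN ler_wpM2l.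
apply: qform_rdiag_le => l; have := dM l; rewrite ler_norml => /andP[h1 h2].
by rewrite ler_wpM2l.
Qed.

Lemma qform_le1 (A : 'M[C]_n) u : specnorm A <= 1 -> `|qform A u| <= sqn u.
Proof.
move=> A1; apply: le_trans (qform_specnorm _ _) _.
by rewrite -[leRHS]mul1r ler_wpM2r // sqn_ge0.
Qed.

Lemma perturb_form_le A (d : nat -> R) : specnorm A <= 1 -> (forall l : 'I_n, `|d l| <= M) ->
  form_le (1 + mu * M) (perturb A d).
Proof.
move=> A1 dM u; rewrite qform_perturb mulrDl mul1r; apply: le_trans (ler_normD _ _) _.
by apply: lerD; [exact: qform_le1|exact: qform_rdiag_norm].
Qed.

Lemma crawford_perturb A B (d1 d2 : nat -> R) : hermitian A -> hermitian B -> 0 <= crawford A B ->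
  8 * (mu * M) ^+ 2 <= crawford A B ^+ 2 ->
  (forall l : 'I_n, `|d1 l| <= M) -> (forall l : 'I_n, `|d2 l| <= M) ->
  crawford_ge (crawford A B / 2) (perturb A d1) (perturb B d2).
Proof.
move=> hA hB c0 tg d1M d2M u; rewrite !qform_perturb.
apply: (perturbed_pair_bound tg); do ?exact: qform_rdiag_norm.
exact: crawford_qform.
Qed.

(** Sharper than the uniform bound [1 + mu M]: it retains the dependence on each entry of [D_1],
    over which [mean_bound] then averages. *)
Lemma perturb_le_diag A (d : nat -> R) (sg : R) u : specnorm A <= 1 -> (sg = 1 \/ sg = -1) ->
  sg * qform (perturb A d) u <= qform (rdiag n (fun l => `|1 + sg * (mu * d l)|)) u.
Proof.
move=> A1 sgE; rewrite qform_perturb mulrDr.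
have h : sg * qform A u <= sqn u.
  have := qform_le1 u A1; rewrite ler_norml => /andP[h1 h2].
  by case: sgE => ->; rewrite ?mul1r // mulN1r lerNl.
apply: le_trans (lerD h (lexx _)) _.
have -> : sg * qform (rdiag n (fun l => mu * d l)) u = qform (rdiag n (fun l => sg * (mu * d l))) u.
  by rewrite !qform_rdiag mulr_sumr; apply: eq_bigr => l _; rewrite mulrA.
rewrite -[sqn u]mul1r -qform_rdiag_cst qform_rdiagD; apply: qform_rdiag_le => l.
exact: ler_norm.
Qed.

End PerturbedPencil.

(** * Eigenvalues beyond the grid *)

Lemma dominant_sign (R : realFieldType) (sg a x y s t g : R) :
  (sg = 1 \/ sg = -1) -> 0 < s -> 0 <= t -> 8 * t ^+ 2 < g ^+ 2 ->
  g ^+ 2 * s ^+ 2 <= x ^+ 2 + y ^+ 2 -> `|y| <= 2 * t * s -> 0 < sg * x ->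
  `|a - x| <= t * s -> 0 < sg * a.
Proof.
move=> sgE s0 t0 tg xy ys sx ax.
have y2 : y ^+ 2 <= 4 * (t * s) ^+ 2.
  have -> : 4 * (t * s) ^+ 2 = (2 * t * s) ^+ 2 by ring.
  by rewrite -real_normK ?num_real // ler_pXn2r // nnegrE // (le_trans _ ys).
have ts : 4 * (t * s) ^+ 2 < x ^+ 2.
  have : 8 * t ^+ 2 * s ^+ 2 < g ^+ 2 * s ^+ 2 by rewrite ltr_pM2r // exprn_gt0.
  rewrite exprMn; move: y2; rewrite exprMn; lra.
have ts0 : 0 <= t * s by rewrite mulr_ge0 // ltW.
have xts : t * s < sg * x.
  rewrite -ltr_sqr ?nnegrE //; last exact: ltW.
  rewrite [(sg * x) ^+ 2]exprMn.
  have -> : sg ^+ 2 = 1 by case: sgE => ->; ring.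
  rewrite mul1r; apply: le_lt_trans ts; rewrite ler_peMl ?sqr_ge0 //.
  lra.
move: ax; rewrite ler_norml => /andP[h1 h2].
by case: sgE xts => ->; lra.
Qed.

Lemma sqr_dominates (R : realFieldType) (x y s t g : R) : 0 < s -> 0 <= t ->
  t ^+ 2 + 1 < g ^+ 2 -> g ^+ 2 * s ^+ 2 <= x ^+ 2 + y ^+ 2 -> `|x| <= s -> t * s < `|y|.
Proof.
move=> s0 t0 tg xy xs; have ts0 : 0 <= t * s by rewrite mulr_ge0 // ltW.
rewrite -ltr_sqr ?nnegrE // real_normK ?num_real // exprMn.
have x2 : x ^+ 2 <= s ^+ 2 by rewrite -real_normK ?num_real // ler_sqr ?nnegrE // ltW.
have : (t ^+ 2 + 1) * s ^+ 2 < g ^+ 2 * s ^+ 2 by rewrite ltr_pM2r // exprn_gt0.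
lra.
Qed.

Section Outside.
Variable R : realType.
Local Notation C := (R[i]).
Local Notation hermitian := Defs.hermitian.
Variables (n : nat) (A B : 'M[C]_n) (mu M : R).
Hypotheses (hA : hermitian A) (hB : hermitian B) (A1 : specnorm A <= 1) (B1 : specnorm B <= 1)
  (c0 : 0 < crawford A B) (mu0 : 0 <= mu) (M0 : 0 <= M).
Let t := mu * M.
Hypothesis (tc : 8 * t ^+ 2 < crawford A B ^+ 2).

Lemma no_small_zero (w : 'cV[C]_n) (eta : R) : w != 0 -> 0 <= eta -> eta < crawford A B ->
  qform A w = 0 -> `|qform B w| <= eta * sqn w -> False.
Proof.
move=> w0 e0 ec Aw Bw; have s0 : 0 < sqn w by rewrite sqn_gt0.
have := crawford_qform w hA hB (ltW c0); rewrite Aw expr0n add0r leNgt => /negP; apply.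
have cs : 0 <= crawford A B * sqn w by rewrite ltW // mulr_gt0.
rewrite -exprMn -real_normK ?num_real // ltr_sqr ?nnegrE //.
by apply: le_lt_trans Bw _; rewrite ltr_pM2r.
Qed.

(** If [A] took both signs on these vectors, interpolation would give a vector with the form of [A]
    zero and that of [B] at most [2 t], below the Crawford number. The width is [2 t] because
    vectors on which the perturbed [B] is at most [t] must be covered, and the perturbation
    contributes another [t]. *)
Lemma near_null_sign : exists sg : R, (sg = 1 \/ sg = -1) /\
  forall u : 'cV[C]_n, u != 0 -> `|qform B u| <= 2 * t * sqn u -> 0 < sg * qform A u.
Proof.
have t0 : 0 <= t by exact: mulr_ge0.
have e0 : 0 <= 2 * t by rewrite mulr_ge0.
have ec : 2 * t < crawford A B.
  rewrite -ltr_sqr ?nnegrE // ?ltW //; apply: le_lt_trans tc; rewrite exprMn.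
  by rewrite ler_wpM2r ?sqr_ge0 //; lra.
have [[v [v0 Bv Av]]|no] := pselect (exists v : 'cV[C]_n,
    [/\ v != 0, `|qform B v| <= 2 * t * sqn v & 0 < qform A v]).
  exists 1; split; [by left|move=> u u0 Bu; rewrite mul1r].
  have [//|Au|Au] := ltgtP 0 (qform A u).
    have [w [w0 Aw Bw]] := qform_interpolate hA hB Av Au Bv Bu.
    by have := no_small_zero w0 e0 ec Aw Bw.
  by have := no_small_zero u0 e0 ec (esym Au) Bu.
exists (-1); split; [by right|move=> u u0 Bu; rewrite mulN1r oppr_gt0].
have [Au|//|Au] := ltgtP 0 (qform A u); first by exfalso; apply: no; exists u.
by have := no_small_zero u0 e0 ec (esym Au) Bu.
Qed.

Lemma nneg_psd (K : 'M[C]_n) : (forall u : 'cV[C]_n, 0 <= qform K u) -> nneg K = 0%N.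
Proof.
move=> K0; case E : (nneg K) => [//|k].
have [V VP] : neg_ge 1 K by apply/nnegP; rewrite E.
have ne : (1%:M : 'cV[C]_1) != 0.
  by apply/eqP => /matrixP/(_ 0 0)/eqP; rewrite !mxE oner_eq0.
by have := VP _ ne; rewrite ltNge K0.
Qed.

Lemma nneg_nd (K : 'M[C]_n) : (forall u : 'cV[C]_n, u != 0 -> qform K u < 0) -> nneg K = n.
Proof.
move=> K0; apply/eqP; rewrite eqn_leq nneg_le /=; apply/nnegP.
by exists 1%:M => x x0; rewrite mul1mx; exact: K0.
Qed.

(** Since the form of [A] is at most 1, a Crawford number above [sqrt(1 + t^2)] keeps the form of
    [B] above [t] in absolute value. A change of sign would yield a zero of that form by
    interpolation, now with the roles of [A] and [B] exchanged. *)
Lemma definite_sign : t ^+ 2 + 1 < crawford A B ^+ 2 -> exists sg : R, (sg = 1 \/ sg = -1) /\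
  forall u : 'cV[C]_n, u != 0 -> t * sqn u < sg * qform B u.
Proof.
move=> tc1; have t0 : 0 <= t by exact: mulr_ge0.
have large (u : 'cV[C]_n) : u != 0 -> t * sqn u < `|qform B u|.
  move=> u0; have s0 : 0 < sqn u by rewrite sqn_gt0.
  exact: sqr_dominates s0 t0 tc1 (crawford_qform u hA hB (ltW c0)) (qform_le1 u A1).
have s0 (u : 'cV[C]_n) : 0 <= t * sqn u by rewrite mulr_ge0 // sqn_ge0.
have A1' (u : 'cV[C]_n) : `|qform A u| <= 1 * sqn u by rewrite mul1r; exact: qform_le1.
have [[v Bv]|no] := pselect (exists v : 'cV[C]_n, 0 < qform B v).
  exists 1; split; [by left|move=> u u0; rewrite mul1r].
  have := large u u0; have [Bu|Bu] := leP 0 (qform B u); first by rewrite ger0_norm.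
  have [w [w0 Bw _]] := qform_interpolate hB hA Bv Bu (A1' v) (A1' u).
  by have := large w w0; rewrite Bw normr0 ltNge s0.
exists (-1); split; [by right|move=> u u0; rewrite mulN1r].
have := large u u0; have [Bu|Bu] := ltP 0 (qform B u); first by exfalso; apply: no; exists u.
by rewrite ler0_norm.
Qed.

Section Config.
Variables (d1 d2 : nat -> R) (S : 'M[C]_n) (a b : nat -> R) (del : R) (k : 'I_n).
Hypotheses (d1M : forall l : 'I_n, `|d1 l| <= M) (d2M : forall l : 'I_n, `|d2 l| <= M)
  (uS : S \in unitmx)
  (dA : mxadj S *m perturb mu A d1 *m S = rdiag n a)
  (dB : mxadj S *m perturb mu B d2 *m S = rdiag n b)
  (del0 : 0 <= del) (delt : del * (1 + t) <= t) (out : `|b k| < del * `|a k|).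

Local Notation At := (perturb mu A d1).
Local Notation Bt := (perturb mu B d2).

(** All columns with [|b m| <= del |a m|] have [a m] of sign [sg]. As [x] runs from [- del sg] to
    [del sg], the entries [b m - x a m] can therefore only turn negative, and the one at [k] does.
    Domination by the diagonal of [|1 + sg mu d1|] replaces the shift along the pencil by a diagonal
    one. *)
Lemma outside_two_sided (sg : R) : (sg = 1 \/ sg = -1) ->
  (forall u : 'cV[C]_n, u != 0 -> `|qform B u| <= 2 * t * sqn u -> 0 < sg * qform A u) ->
  (nneg (Bt + rdiag n (fun l => del * `|1 + sg * (mu * d1 l)|)%R) <
   nneg (Bt - rdiag n (fun l => del * `|1 + sg * (mu * d1 l)|)%R))%N.
Proof.
move=> sgE sgP; have t0 : 0 <= t by exact: mulr_ge0.
have sgn (m : 'I_n) : `|b m| <= del * `|a m| -> 0 < sg * a m.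
  move=> bm; pose u : 'cV[C]_n := S *m delta_mx m 0; have u0 : u != 0 := column_neq0 uS m.
  have s0 : 0 < sqn u by rewrite sqn_gt0.
  have Au : qform At u = a m := column_form m dA.
  have Bu : qform Bt u = b m := column_form m dB.
  have Bu2 : `|qform B u| <= 2 * t * sqn u.
    have h1 := qform_rdiag_norm mu0 u d2M.
    have h2 : `|a m| <= (1 + t) * sqn u by rewrite -Au; exact: (perturb_form_le mu0 A1 d1M).
    have -> : qform B u = qform Bt u - qform (rdiag n (fun l => mu * d2 l)) u.
      by rewrite qform_perturb addrK.
    apply: le_trans (ler_normB _ _) _; rewrite Bu; apply: le_trans (lerD bm h1) _.
    have -> : 2 * t * sqn u = t * sqn u + t * sqn u by rewrite -mulrDl; congr (_ * _); ring.
    rewrite lerD2r; apply: (@le_trans _ _ (del * ((1 + t) * sqn u))); first by rewrite ler_wpM2l.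
    by rewrite mulrA ler_wpM2r // ltW.
  apply: (dominant_sign sgE s0 t0 tc (crawford_qform u hA hB (ltW c0)) Bu2 (sgP u u0 Bu2)).
  by rewrite -Au qform_perturb addrC addKr; exact: qform_rdiag_norm.
have sgn2 : sg * sg = 1 by case: sgE => ->; ring.
have nsg (x : R) : `|sg * x| = `|x|.
  by case: sgE => ->; rewrite ?mul1r // mulN1r normrN.
have E1 := nneg_shifted uS dB dA (del * sg).
have E2 := nneg_shifted uS dB dA (- (del * sg)).
apply: (@leq_ltn_trans (nneg (Bt - cR (- (del * sg)) *: At))).
  apply: nneg_mono => u; rewrite qformBm qformZm qformDm lerD2l mulNr opprK -mulrA.
  apply: le_trans (ler_wpM2l del0 (perturb_le_diag mu d1 u A1 sgE)) _.
  by rewrite !qform_rdiag mulr_sumr; apply: ler_sum => l _; rewrite [leLHS]mulrA.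
apply: (@leq_trans (nneg (Bt - cR (del * sg) *: At))); last first.
  apply: nneg_mono => u; rewrite !qformBm qformZm lerD2l lerN2 -mulrA.
  apply: le_trans (ler_wpM2l del0 (perturb_le_diag mu d1 u A1 sgE)) _.
  by rewrite !qform_rdiag mulr_sumr; apply: ler_sum => l _; rewrite [leLHS]mulrA.
apply: (@leq_trans #|negset n (fun i => b i - del * sg * a i)|); last by rewrite E1.
apply: (@leq_ltn_trans #|negset n (fun i => b i - - (del * sg) * a i)|); first by rewrite E2.
apply: proper_card; apply/properP; split.
  apply/fintype.subsetP => m; rewrite !inE => m2; rewrite ltNge; apply/negP => m1.
  have w0 : sg * a m < 0.
    rewrite ltNge; apply/negP => w0; have : 0 <= del * (sg * a m) by exact: mulr_ge0.
    by move: m1 m2; rewrite -!mulrA; lra.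
  have : 0 < sg * a m.
    apply: sgn; rewrite -(nsg (a m)) (ltr0_norm w0) ler_norml.
    by apply/andP; split; move: m1 m2; rewrite mulrN; lra.
  by rewrite ltNge ltW.
have w0 : 0 < sg * a k by apply: sgn; exact: ltW.
move: out; rewrite -(nsg (a k)) (gtr0_norm w0) ltr_norml => /andP[h1 h2].
exists k; rewrite !inE; first by move: h1 h2; lra.
by rewrite -leNgt; move: h1 h2; lra.
Qed.

(** The perturbed [B] is still definite. If positive, its index is 0 and becomes positive under a
    shift by [del (1 + t)] downwards. If negative, the same shift is started from above, at the base
    [beta], and ends at index [n]. In both cases the window is half of the two-sided one. *)
Lemma outside_one_sided (sg beta : R) : (sg = 1 \/ sg = -1) ->
  (forall u : 'cV[C]_n, u != 0 -> t * sqn u < sg * qform B u) ->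
  beta = (if sg == 1 then 0 else del * (1 + t)) ->
  (nneg (Bt + rdiag n (fun=> beta)) <
   nneg (Bt + rdiag n (fun=> beta) - rdiag n (fun=> del * (1 + t))%R))%N.
Proof.
move=> sgE sgP betaE; pose c := del * (1 + t).
have Bts (u : 'cV[C]_n) : u != 0 -> 0 < sg * qform Bt u.
  move=> u0; have := sgP u u0; rewrite qform_perturb mulrDr.
  have := qform_rdiag_norm mu0 u d2M; rewrite ler_norml -/t => /andP[h1 h2].
  by case: sgE => ->; lra.
have bound (x : R) (u : 'cV[C]_n) : `|x| = del -> x * qform At u <= c * sqn u.
  move=> xd; apply: le_trans (ler_norm _) _; rewrite normrM xd /c -mulrA.
  by rewrite ler_wpM2l // (perturb_form_le mu0 A1 d1M).
pose x := if 0 <= a k then del else - del.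
have xd : `|x| = del by rewrite /x; case: ifP => _; rewrite ?normrN ger0_norm.
have xa : x * a k = del * `|a k|.
  rewrite /x; have [h|h] := leP 0 (a k); first by rewrite ger0_norm.
  by rewrite ltr0_norm // mulrN mulNr.
case: sgE => sE; rewrite betaE sE ?eqxx.
  have -> : nneg (Bt + rdiag n (fun=> 0)) = 0%N.
    apply: nneg_psd => u; rewrite qformDm qform_rdiag_cst mul0r addr0.
    have [->|u0] := eqVneq u 0; first by rewrite qform0.
    by have := Bts u u0; rewrite sE mul1r => /ltW.
  apply: (@leq_trans (nneg (Bt - cR x *: At))); last first.
    apply: nneg_mono => u; rewrite qformBm qformDm qformBm qformZm !qform_rdiag_cst mul0r addr0.
    by rewrite lerD2l lerN2; exact: bound.
  rewrite (nneg_shifted uS dB dA x) card_gt0; apply/set0Pn; exists k.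
  rewrite inE xa subr_lt0; apply: le_lt_trans out; exact: ler_norm.
have -> : (-1 == 1 :> R) = false by apply/eqP => h; have : (0 : R) < 1 by []; lra.
have -> : nneg (Bt + rdiag n (fun=> del * (1 + t)) - rdiag n (fun=> del * (1 + t))) = n.
  apply: nneg_nd => u u0; rewrite qformBm qformDm addrK.
  by have := Bts u u0; rewrite sE mulN1r oppr_gt0.
apply: (@leq_ltn_trans (nneg (Bt - cR (- x) *: At))).
  apply: nneg_mono => u; rewrite qformBm qformZm qformDm qform_rdiag_cst mulNr opprK.
  by rewrite lerD2l; exact: bound.
rewrite (nneg_shifted uS dB dA (- x)) -[X in (_ < X)%N](card_ord n).
apply: (@leq_trans #|[set: 'I_n]%SET|); last by rewrite cardsT.
apply: proper_card; apply/properP; split; first exact: finset.subsetT.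
exists k; rewrite inE // -leNgt mulNr opprK xa.
by have := out; rewrite ltr_norml => /andP[h _]; rewrite -lerBlDr sub0r ltW.
Qed.

End Config.
End Outside.

(** * From conditions on the index to shattering *)

Section ShatteredCriterion.
Variable R : realType.
Local Notation C := (R[i]).
Local Notation hermitian := Defs.hermitian.

Lemma size_grid (z w : R) (K : nat) : size (grid z w K) = K.+2.
Proof. by rewrite size_map size_iota. Qed.

Lemma nth_grid (z w : R) (K j : nat) : (j < K.+2)%N -> (grid z w K)`_j = z + j%:R * w.
Proof. by move=> jK; rewrite (nth_map 0%N) ?size_iota // nth_iota. Qed.

Lemma grid_cell (z w x : R) (K : nat) : z < x -> x < z + K.+1%:R * w ->
  (forall j, (j < K.+2)%N -> x != z + j%:R * w) ->
  exists2 j, (j < K.+1)%N & z + j%:R * w < x < z + j.+1%:R * w.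
Proof.
move=> zx xK off.
have ex : exists j, x < z + j%:R * w by exists K.+1.
have := ex_minnP ex; case=> -[|j] xj min; first by move: xj; rewrite mul0r addr0 ltNge ltW.
have jK : (j < K.+1)%N by apply: min.
exists j => //; rewrite xj andbT lt_neqAle eq_sym off ?(ltnW jK) //=; last by rewrite ltnS ltnW.
by rewrite leNgt; apply/negP => /min; rewrite ltnn.
Qed.

Variables (n : nat) (A B S : 'M[C]_n) (a b : nat -> R) (N g eps z w : R) (K : nat).
Hypotheses (hA : hermitian A) (hB : hermitian B) (uS : S \in unitmx)
  (dA : mxadj S *m A *m S = rdiag n a) (dB : mxadj S *m B *m S = rdiag n b)
  (N0 : 0 < N) (g0 : 0 < g) (leB : form_le N B) (crawfordP : crawford_ge g A B)
  (eps0 : 0 < eps) (w0 : 0 < w) (wgap : w < 2 * g / N).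

Local Notation pt j := (z + j%:R * w).
Local Notation H j := (A - cR (z + j%:R * w) *: B).

Lemma shattered_criterion :
  (forall k : 'I_n, b k != 0 -> pt 0 < a k / b k < pt K.+1) ->
  (forall j, (j < K.+2)%N ->
     ~ (nneg (H j + rdiag n (fun=> 71 / 50 * eps * Num.max 1 `|pt j|)%R) <
        nneg (H j - rdiag n (fun=> 71 / 50 * eps * Num.max 1 `|pt j|)%R))%N) ->
  (forall j, (j < K.+1)%N -> ~ (nneg (H j) + 2 <= nneg (H j.+1))%N /\
     ~ (nneg (H j.+1) + 2 <= nneg (H j))%N) ->
  shattered eps A B (grid z w K).
Proof.
move=> inside noeps nojump.
have max1 (x : R) : 1 <= Num.max 1 `|x| by rewrite le_max lexx.
have maxx (x : R) : `|x| <= Num.max 1 `|x| by rewrite le_max lexx orbT.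
(* An eigenvalue at a grid point makes [H j] singular and so produces the forbidden jump as well.
   Hence eigenvalues lie in open cells. *)
have off (k : 'I_n) j : b k != 0 -> (j < K.+2)%N -> a k / b k != pt j.
  move=> bk jK; apply/eqP => e; apply: (noeps j jK).
  have eta0 : 0 < 71 / 50 * eps * Num.max 1 `|pt j|.
    by rewrite !mulr_gt0 ?divr_gt0 //; apply: lt_le_trans (max1 _).
  apply: (eigenvalue_jump hA hB eta0 (column_neq0 uS k)).
  have inj (y y' : 'cV[C]_n) : mxadj S *m y = mxadj S *m y' -> y = y'.
    have uT : mxadj S \in unitmx.
      by rewrite unitmxE /mxadj det_tr det_map_mx unitfE conjc_eq0 -unitfE -unitmxE.
    by move=> /(congr1 (mulmx (invmx (mxadj S)))); rewrite !mulKmx.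
  apply: inj; rewrite -scalemxAr !mulmxA dA dB.
  apply/matrixP => i l; rewrite ord1 !mul_diag_mx !mxE.
  have [->|_] := eqVneq i k; last by rewrite !mulr0.
  by rewrite !mulr1 -cRM -e divfK.
have step j : pt j < pt j.+1.
  by rewrite ltrD2l ltr_pM2r // ltr_nat.
have stepw j : pt j.+1 - pt j = w.
  by rewrite -natr1; ring.
split.
- move=> x /(root_pencil uS dA dB g0 crawfordP)[k bk ->].
  have /andP[h1 h2] := inside k bk.
  have [||j jK h] := @grid_cell z w (a k / b k) K _ h2.
  + by move: h1; rewrite mul0r addr0.
  + by move=> j jK; exact: off.
  exists j; first by rewrite size_grid.
  by exists (a k / b k); split=> //; rewrite !nth_grid //; apply: ltnW.
- move=> j x; rewrite size_grid ltnS => jK /(root_pencil uS dA dB g0 crawfordP)[k bk ->].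
  move=> [r [[<-]]]; rewrite !nth_grid //; last exact: ltnW.
  move=> hk; have only (l : 'I_n) : b l != 0 -> pt j < a l / b l < pt j.+1 -> l = k.
    move=> bl hl; apply/eqP; apply: contraT => lk; rewrite eq_sym in lk.
    have gap : pt j.+1 - pt j < 2 * g / N by rewrite stepw.
    have [n1 n2] := nojump j jK.
    have [h|h] := collision_jump uS dA dB N0 g0 leB crawfordP (step j) gap lk bk bl hk hl.
      by case: (n1 h).
    by case: (n2 h).
  split.
    apply: (mup_pencil uS dA dB g0 crawfordP bk) => l lk bl.
    by apply: contra_neq lk => e; apply: only => //; rewrite e.
  move=> x' /(root_pencil uS dA dB g0 crawfordP)[l bl ->] [r' [[<-]]].
  rewrite !nth_grid //; last exact: ltnW.
  by move=> hl; rewrite (only l bl hl).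
- move=> j; rewrite size_grid => jK; rewrite nth_grid // => ps.
  apply: (noeps j jK); exact: pseudospec_jump (maxx _) (max1 _) ps.
Qed.

End ShatteredCriterion.

(** * Borel matrices and comparison under a weight *)

Section BorelMatrices.
Variable R : realType.
Local Notation C := (R[i]).
Local Notation hermitian := Defs.hermitian.
Variables (n k : nat).

Definition mborel (X : seq R -> 'M[C]_n) : Prop := forall i j,
  rborel k (fun s => complex.Re (X s i j)) /\ rborel k (fun s => complex.Im (X s i j)).

Lemma eq_rborel (f g : seq R -> R) : f =1 g -> rborel k g -> rborel k f.
Proof. by move=> /funext ->. Qed.

Lemma mborel_cst (A : 'M[C]_n) : mborel (fun=> A).
Proof. by move=> i j; split; exact: rborel_cst. Qed.

Lemma mborelD X Y : mborel X -> mborel Y -> mborel (fun s => X s + Y s).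
Proof.
move=> bX bY i j; have [x1 x2] := bX i j; have [y1 y2] := bY i j; split.
  apply: (@eq_rborel _ (fun s => complex.Re (X s i j) + complex.Re (Y s i j))).
    by move=> s; rewrite mxE raddfD.
  exact: rborelD.
apply: (@eq_rborel _ (fun s => complex.Im (X s i j) + complex.Im (Y s i j))).
  by move=> s; rewrite mxE raddfD.
exact: rborelD.
Qed.

Lemma mborelZ (f : seq R -> R) X : rborel k f -> mborel X -> mborel (fun s => cR (f s) *: X s).
Proof.
move=> bf bX i j; have [x1 x2] := bX i j; split.
  apply: (@eq_rborel _ (fun s => f s * complex.Re (X s i j))).
    by move=> s; rewrite mxE; case: (X s i j) => x y /=; rewrite mul0r subr0.
  exact: rborelM.
apply: (@eq_rborel _ (fun s => f s * complex.Im (X s i j))).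
  by move=> s; rewrite mxE; case: (X s i j) => x y /=; rewrite mul0r addr0.
exact: rborelM.
Qed.

Lemma mborelB X Y : mborel X -> mborel Y -> mborel (fun s => X s - Y s).
Proof.
move=> bX bY.
have -> : (fun s => X s - Y s) = (fun s => X s + cR (-1) *: Y s).
  by apply/funext => s; rewrite cRN scaleN1r.
by apply: mborelD => //; apply: mborelZ => //; exact: rborel_cst.
Qed.

Lemma mborel_rdiag (d : seq R -> nat -> R) : (forall l, rborel k (fun s => d s l)) ->
  mborel (fun s => rdiag n (d s)).
Proof.
move=> bd i j; have [ij|ij] := eqVneq i j; split.
- apply: (@eq_rborel _ (fun s => d s i)) => // s.
  by rewrite !mxE ij eqxx mulr1n.
- apply: (@eq_rborel _ (fun=> 0)); last exact: rborel_cst.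
  by move=> s; rewrite !mxE ij eqxx mulr1n.
- apply: (@eq_rborel _ (fun=> 0)); last exact: rborel_cst.
  by move=> s; rewrite !mxE (negPf ij) mulr0n.
- apply: (@eq_rborel _ (fun=> 0)); last exact: rborel_cst.
  by move=> s; rewrite !mxE (negPf ij) mulr0n.
Qed.

Lemma rborel_nneg X : (forall s, hermitian (X s)) -> mborel X ->
  rborel k (fun s => (nneg (X s))%:R).
Proof.
move=> hX bX d T c sc mc; apply: measurable_nneg => [t|i j|i j]; first exact: hX.
  by have [h _] := bX i j; exact: h.
by have [_ h] := bX i j; exact: h.
Qed.

Lemma rborel_nneg_lt X Y (m : nat) : (forall s, hermitian (X s)) -> mborel X ->
  (forall s, hermitian (Y s)) -> mborel Y ->
  rborel k (fun s => (nneg (X s) + m < nneg (Y s))%N%:R).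
Proof.
move=> hX bX hY bY.
apply: (@eq_rborel _ (fun s => ((nneg (X s))%:R + m%:R < (nneg (Y s))%:R :> R)%R%:R)).
  by move=> s; rewrite -natrD ltr_nat.
by apply: rborel_lt; [apply: rborelD; [|exact: rborel_cst]|]; exact: rborel_nneg.
Qed.

Lemma rborel_site X (kap : seq R -> nat -> R) i : (forall s, hermitian (X s)) -> mborel X ->
  (forall l, rborel k (fun s => kap s l)) -> rborel k (fun s => site (X s) (kap s) i).
Proof.
move=> hX bX bk; have bp m : mborel (fun s => rdiag n (part (kap s) m)).
  apply: mborel_rdiag => l; case E : (l < m)%N.
    by apply: (@eq_rborel _ (fun s => kap s l)) => // s; rewrite /part E.
  apply: (@eq_rborel _ (fun=> 0)); last exact: rborel_cst.
  by move=> s; rewrite /part E.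
have hp m s : hermitian (X s - rdiag n (part (kap s) m)).
  by apply: hermitianB => //; exact: hermitian_rdiag.
by apply: rborelB; apply: rborel_nneg => //; exact: mborelB.
Qed.

End BorelMatrices.

Section SiteSlices.
Variable R : realType.
Local Notation C := (R[i]).
Variable n : nat.

Lemma site_ext (K K' : 'M[C]_n) (kap kap' : nat -> R) (i : 'I_n) :
  (forall u, qform K u = qform K' u) -> (forall l : 'I_n, kap l = kap' l) ->
  site K kap i = site K' kap' i.
Proof.
move=> eK ek; apply: (f_equal2 (fun p q : nat => (p%:R - q%:R : R))); apply: nneg_eq => u.
  rewrite !qformBm eK; congr (_ - _); apply: qform_rdiag_eq => l.
  by rewrite /part ek.
rewrite !qformBm eK; congr (_ - _); apply: qform_rdiag_eq => l.
by rewrite /part ek.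
Qed.

(** The coordinate moves the entry [i] with speed [cc]. For negative speed the order is reversed, so
    [site_window] is used with the two values exchanged. *)
Lemma site_slice_window (K : R -> 'M[C]_n) (K0 : 'M[C]_n) (kap : R -> nat -> R)
    (kap0 : nat -> R) (cc : R) (i : 'I_n) (v v' : R) :
  (forall v u, qform (K v) u = qform K0 u + qform (rdiag n (single i (cc * v))) u) ->
  (forall v (l : 'I_n), kap v l = kap0 l) -> cc != 0 -> 0 <= kap0 i ->
  site (K v) (kap v) i != 0 -> site (K v') (kap v') i != 0 ->
  v' <= v + kap0 i / `|cc|.
Proof.
move=> KE kE cc0 k0.
have E x : site (K x) (kap x) i = site (K0 + rdiag n (single i (cc * x))) kap0 i.
  by apply: site_ext => [u|//]; rewrite KE qformDm.
rewrite (E v) (E v') => s1 s2.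
have h1 := site_window k0 s1 s2; have h2 := site_window k0 s2 s1.
have [cp|cn|c00] := ltgtP 0 cc; last by rewrite -c00 eqxx in cc0.
  rewrite gtr0_norm // -(ler_pM2l cp) mulrDr [cc * (_ / _)]mulrC divfK //.
rewrite ltr0_norm // -(ler_pM2l (_ : 0 < - cc)) ?oppr_gt0 //.
rewrite mulrDr [- cc * (_ / _)]mulrC divfK ?oppr_eq0 // !mulNr.
by move: h2; move: (kap0 i) (cc * v) (cc * v') => x y z; clear; lra.
Qed.

End SiteSlices.

(** * Comparison of weighted expectations *)

Section Weighted.
Variable R : realType.
Local Notation leb := (@lebesgue_measure R).
Variables (k : nat) (W : seq R -> R).
Hypotheses (bW : rborel k W) (W0 : forall s, 0 <= W s).

Definition wle (f g : seq R -> R) : Prop :=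
  (iint k (fun s => (W s * f s)%:E) <= iint k (fun s => (W s * g s)%:E))%E.

Definition admissible (f : seq R -> R) : Prop := rborel k f /\ forall s, 0 <= f s.

Lemma admissibleD f g : admissible f -> admissible g -> admissible (fun s => f s + g s).
Proof. by move=> [bf f0] [bg g0]; split; [exact: rborelD|move=> s; exact: addr_ge0]. Qed.

Lemma admissibleM f g : admissible f -> admissible g -> admissible (fun s => f s * g s).
Proof. by move=> [bf f0] [bg g0]; split; [exact: rborelM|move=> s; exact: mulr_ge0]. Qed.

Lemma admissible_cst a : 0 <= a -> admissible (fun=> a).
Proof. by move=> a0; split; [exact: rborel_cst|]. Qed.

Lemma admissible_sum (I : Type) (l : seq I) (f : I -> seq R -> R) :
  (forall i, admissible (f i)) -> admissible (fun s => \sum_(i <- l) f i s).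
Proof.
move=> af; split; first by apply: rborel_sum => i; case: (af i).
by move=> s; apply: sumr_ge0 => i _; case: (af i).
Qed.

Lemma wle_trans g f h : wle f g -> wle g h -> wle f h.
Proof. exact: le_trans. Qed.

Lemma wle_support f g : (forall s, 0 <= f s) ->
  (forall s, size s = k -> W s != 0 -> f s <= g s) -> wle f g.
Proof.
move=> f0 fg; apply: le_iint => s; first by rewrite lee_fin mulr_ge0.
move=> sk; rewrite lee_fin; have [->|Ws] := eqVneq (W s) 0; first by rewrite !mul0r.
by rewrite ler_wpM2l // fg.
Qed.

Lemma wleD f g f' g' : admissible f -> admissible g -> admissible f' -> admissible g' ->
  wle f f' -> wle g g' -> wle (fun s => f s + g s) (fun s => f' s + g' s).
Proof.
move=> [bf f0] [bg g0] [bf' f0'] [bg' g0'] h1 h2; rewrite /wle.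
have split_sum (x y : seq R -> R) : rborel k x -> rborel k y -> (forall s, 0 <= x s) ->
    (forall s, 0 <= y s) -> iint k (fun s => (W s * (x s + y s))%:E) =
    (iint k (fun s => (W s * x s)%:E) + iint k (fun s => (W s * y s)%:E))%E.
  move=> bx by' x0 y0; rewrite -iintD.
  - by apply: eq_iint => s _; rewrite -EFinD mulrDr.
  - by apply: rborel_EFin; exact: rborelM.
  - by apply: rborel_EFin; exact: rborelM.
  - by move=> s; rewrite lee_fin mulr_ge0.
  - by move=> s; rewrite lee_fin mulr_ge0.
by rewrite !split_sum //; exact: leeD.
Qed.

Lemma wle_sum (I : Type) (l : seq I) (f g : I -> seq R -> R) :
  (forall i, admissible (f i)) -> (forall i, admissible (g i)) ->
  (forall i, wle (f i) (g i)) ->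
  wle (fun s => \sum_(i <- l) f i s) (fun s => \sum_(i <- l) g i s).
Proof.
move=> af ag fg; elim: l => [|i l IH].
  by apply: wle_support => [s|s _ _]; rewrite !big_nil.
have -> : (fun s => \sum_(j <- i :: l) f j s) = (fun s => f i s + \sum_(j <- l) f j s).
  by apply/funext => s; rewrite big_cons.
have -> : (fun s => \sum_(j <- i :: l) g j s) = (fun s => g i s + \sum_(j <- l) g j s).
  by apply/funext => s; rewrite big_cons.
by apply: wleD => //; exact: admissible_sum.
Qed.

Lemma wleZ a f g : 0 <= a -> admissible f -> admissible g -> wle f g ->
  wle (fun s => a * f s) (fun s => a * g s).
Proof.
move=> a0 [bf f0] [bg g0] fg; rewrite /wle.
have pull (x : seq R -> R) : rborel k x -> (forall s, 0 <= x s) ->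
    iint k (fun s => (W s * (a * x s))%:E) = (a%:E * iint k (fun s => (W s * x s)%:E))%E.
  move=> bx x0; rewrite -iintZl //.
  - by apply: eq_iint => s _; rewrite -EFinM mulrCA.
  - by apply: rborel_EFin; exact: rborelM.
  - by move=> s; rewrite lee_fin mulr_ge0.
by rewrite !pull //; apply: lee_wpmul2l; rewrite ?lee_fin.
Qed.

(* With G = W (1 - X) 1[X <= 1] one has W <= G + W X. *)
Lemma failure_bound (F : seq R -> \bar R) (X : seq R -> R) (I a : R) :
  admissible X -> iint k (fun s => (W s)%:E) = I%:E -> wle X (fun=> a) -> 0 <= a ->
  (forall s, 0 <= F s)%E ->
  (forall s, size s = k -> (X s < 1)%R -> (W s)%:E <= F s)%E ->
  ((I - a * I)%:E <= iint k F)%E.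
Proof.
move=> [bX X0] iW Xa a0 F0 WF.
pose G s := W s * (1 - X s) * (X s <= 1)%R%:R.
have G0 s : 0 <= G s.
  by rewrite /G; case: (leP (X s) 1) => h /=; rewrite ?mulr0n ?mulr0 // mulr1n mulr1 mulr_ge0 // subr_ge0.
have bG : rborel k G.
  apply: rborelM; last by apply: rborel_le => //; exact: rborel_cst.
  by apply: rborelM => //; apply: rborelB => //; exact: rborel_cst.
have GF : (iint k (fun s => (G s)%:E) <= iint k F)%E.
  apply: le_iint => [s|s sk]; first by rewrite lee_fin.
  have [h|h] := ltP (X s) 1.
    apply: le_trans (WF s sk h); rewrite lee_fin /G (ltW h) /= mulr1n mulr1.
    by rewrite -[leRHS]mulr1 ler_wpM2l // gerBl.
  suff -> : G s = 0 by [].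
  rewrite /G; case: (leP (X s) 1) => h' /=; last by rewrite mulr0n mulr0.
  have -> : X s = 1 by apply/le_anti/andP; split.
  by rewrite subrr mulr0 mul0r.
have WG : (iint k (fun s => (W s)%:E) <= iint k (fun s => (G s)%:E + (W s * X s)%:E))%E.
  apply: le_iint => [s|s sk]; first by rewrite lee_fin.
  rewrite -EFinD lee_fin /G; case: (leP (X s) 1) => h.
    by rewrite /= mulr1n mulr1 -mulrDr subrK mulr1.
  by rewrite /= mulr0n mulr0 add0r -[leLHS]mulr1 ler_wpM2l // ltW.
have XI : (iint k (fun s => (W s * X s)%:E) <= (a * I)%:E)%E.
  apply: le_trans Xa _.
  have -> : (a * I)%:E = (a%:E * iint k (fun s => (W s)%:E))%E by rewrite iW -EFinM.
  rewrite -(iintZl (rborel_EFin bW)) //.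
  by rewrite le_eqVlt; apply/orP; left; apply/eqP; apply: eq_iint => s _; rewrite -EFinM mulrC.
move: WG; rewrite (iintD (rborel_EFin bG) (rborel_EFin (rborelM bW bX))) //; last first.
  by move=> s; rewrite lee_fin mulr_ge0.
rewrite iW => WG; rewrite EFinB leeBlDr //.
apply: (le_trans WG); exact: leeD.
Qed.

End Weighted.

(** * Wegner and Minami estimates *)

Lemma affine_shift1 (R : comRingType) (hv h0 av bv a0 b0 t d : R) :
  hv = av - t * bv -> h0 = a0 - t * b0 -> av = a0 + d -> bv = b0 -> hv = h0 + d.
Proof. by move=> -> -> -> ->; ring. Qed.

Lemma affine_shift2 (R : comRingType) (hv h0 av bv a0 b0 t d e : R) :
  hv = av - t * bv -> h0 = a0 - t * b0 -> av = a0 -> bv = b0 + d -> e = - (t * d) -> hv = h0 + e.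
Proof. by move=> -> -> -> -> ->; ring. Qed.

Lemma qform_shift_add (R : realType) n (X X' Y Y' Z : 'M[R[i]]_n) x :
  qform X x = qform X' x + qform Z x -> qform Y x = qform Y' x ->
  qform (X + Y) x = qform (X' + Y') x + qform Z x.
Proof. by rewrite !qformDm => -> ->; rewrite addrAC. Qed.

Lemma eq_leq_trans (a b a' b' : nat) : a = a' -> b = b' -> (a' <= b')%N -> (a <= b)%N.
Proof. by move=> -> ->. Qed.

(* The factor (1 < n) matters for the numerical budget: with n = 1 there are no collisions. *)
Definition gap (n m x y : nat) : bool := (1 < n)%N && (x + m < y)%N.

Lemma gap_resample_up n x y x' y' : (x' <= x)%N -> (y <= y'.+1)%N -> gap n 1 x y -> gap n 0 x' y'.
Proof.
rewrite /gap addn1 addn0 => h1 h2 /andP[-> h3] /=; rewrite -ltnS.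
exact: leq_ltn_trans h1 (leq_trans h3 h2).
Qed.

Lemma gap_resample_down n x y x' y' : (x' <= x.+1)%N -> (y <= y')%N -> gap n 1 x y -> gap n 0 x' y'.
Proof.
rewrite /gap addn1 addn0 => h1 h2 /andP[-> h3] /=; exact: leq_ltn_trans h1 (leq_trans h3 h2).
Qed.

Section RandomPencil.
Variable R : realType.
Local Notation C := (R[i]).
Local Notation hermitian := Defs.hermitian.
Local Notation leb := (@lebesgue_measure R).
Variables (q u : R -> R) (r p : R) (n : nat).
Hypotheses (mq : measurable_fun setT q) (q0 : forall x, 0 <= q x) (qr : forall x, q x <= r)
  (intq : (\int[leb]_x (q x)%:E = p%:E)%E) (p0 : 0 < p)
  (mu_ : measurable_fun setT u) (u0 : forall x, 0 <= u x) (intu : (\int[leb]_x (u x)%:E = 1)%E).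
Let k := (n + n).+1.

Definition weight (s : seq R) : R := (\prod_(l < n + n) q s`_l) * u s`_(n + n).

Let punctured (m : nat) (s : seq R) : R :=
  (\prod_(l < n + n | (l : nat) != m) q s`_l) * u s`_(n + n).

Lemma nth_set (s : seq R) m v l : (set_nth 0 s m v)`_l = if l == m then v else s`_l.
Proof. by rewrite nth_set_nth. Qed.

Lemma weight_slice m s v : (m < n + n)%N -> weight (set_nth 0 s m v) = q v * punctured m s.
Proof.
move=> mn; rewrite /weight /punctured (bigD1 (Ordinal mn)) //= !nth_set eqxx.
rewrite (gtn_eqF mn) -mulrA; congr (_ * (_ * _)); apply: eq_bigr => l.
by rewrite -val_eqE /= nth_set => /negPf ->.
Qed.

Lemma weight_ge0 s : 0 <= weight s.
Proof. by rewrite mulr_ge0 // prodr_ge0. Qed.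

Lemma rborel_weight : rborel k weight.
Proof.
apply: rborelM; last by apply: rborel_comp => //; exact: rborel_nth.
by apply: rborel_prod => l; apply: rborel_comp => //; exact: rborel_nth.
Qed.

Lemma weight_support s (l : nat) : (l < n + n)%N -> weight s != 0 -> q s`_l != 0.
Proof.
move=> ln; apply: contra_neq => ql.
by rewrite /weight (bigD1 (Ordinal ln)) //= ql !mul0r.
Qed.

Local Notation "f <=w g" := (wle k weight f g) (at level 70).

(** Coordinate [m] is integrated out; [cc] is the speed at which it moves the diagonal entry [i],
    [D] bounds the width of the window, [e] is a factor under which the bound is claimed, and [h] is
    what remains of [e] after resampling. *)
Lemma site_wle (m : nat) (i : 'I_n) (X : seq R -> 'M[C]_n) (kap : seq R -> nat -> R)
    (cc D e h : seq R -> R) : (m < n + n)%N ->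
  (forall s, hermitian (X s)) -> mborel k X -> (forall l, rborel k (fun s => kap s l)) ->
  (forall s l, 0 <= kap s l) -> rborel k e -> (forall s, 0 <= e s <= 1) ->
  admissible k h -> admissible k D ->
  (forall s v, D (set_nth 0 s m v) = D s) ->
  (forall s v v', e (set_nth 0 s m v) != 0 -> 1 <= h (set_nth 0 s m v')) ->
  (forall s v x, qform (X (set_nth 0 s m v)) x =
     qform (X (set_nth 0 s m 0)) x + qform (rdiag n (single i (cc s * v))) x) ->
  (forall s v (l : 'I_n), kap (set_nth 0 s m v) l = kap (set_nth 0 s m 0) l) ->
  (forall s v, e (set_nth 0 s m v) != 0 -> cc s != 0 /\ kap (set_nth 0 s m 0) i / `|cc s| <= D s) ->
  (fun s => e s * site (X s) (kap s) i) <=w (fun s => r / p * (D s * h s)).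
Proof.
move=> mn hX bX bk k0 be e01 [bh h0] [bD D0] Dinv eh XE kE eD.
have s01 s : 0 <= site (X s) (kap s) i <= 1 by exact: site_01.
have e0 s : 0 <= e s by case/andP: (e01 s).
rewrite /wle; have := @slice_window R q r p mq q0 qr intq p0 k m weight (punctured m) _
  rborel_weight weight_ge0 _ _ (fun s => e s * site (X s) (kap s) i) D h _ bD bh _ D0 h0 Dinv.
have -> : iint k (fun s => (weight s * (r / p * (D s * h s)))%:E) =
    iint k (fun s => (r / p * (weight s * (D s * h s)))%:E).
  by apply: eq_iint => s _; rewrite mulrCA.
apply.
- by rewrite /k ltnS ltnW.
- by move=> s; rewrite mulr_ge0 // prodr_ge0.
- by move=> s v _; exact: weight_slice.
- by apply: rborelM => //; exact: rborel_site.
- move=> s; have /andP[? ?] := e01 s; have /andP[? ?] := s01 s.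
  by rewrite mulr_ge0 //= mulr_ile1.
- by move=> s v v' _; rewrite mulf_eq0 negb_or => /andP[h1 _]; exact: eh h1.
have nz (x y : R) : x * y != 0 -> x != 0 /\ y != 0 by rewrite mulf_eq0 negb_or => /andP.
move=> s v v' _ /nz[e1 s1] /nz[_ s2].
have [cc0 cD] := eD s v e1.
apply: (@le_trans _ _ (v + kap (set_nth 0 s m 0) i / `|cc s|)); last by rewrite lerD2l.
exact: (@site_slice_window _ _ (fun v => X (set_nth 0 s m v)) _ (fun v => kap (set_nth 0 s m v)) _
  _ _ v v' (XE s) (kE s) cc0 (k0 _ _) s1 s2).
Qed.

Lemma coordinate_wle (m : nat) (phi : R -> R) (a : R) : (m < n + n)%N ->
  measurable_fun setT phi -> (forall v, 0 <= phi v) -> 0 <= a ->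
  (\int[leb]_v (q v * phi v)%:E <= (a * p)%:E)%E ->
  (fun s => phi s`_m) <=w (fun=> a).
Proof.
move=> mn mphi phi0 a0 le; rewrite /wle.
have -> : iint k (fun s => (weight s * a)%:E) = iint k (fun s => (a * weight s)%:E).
  by apply: eq_iint => s _; rewrite mulrC.
apply: (@slice_mean R q p mq q0 intq k m weight (punctured m) _ rborel_weight
  weight_ge0 _ _ (fun s => phi s`_m) phi a _ _ a0 mphi phi0 _ le).
- by rewrite /k ltnS ltnW.
- by move=> s; rewrite mulr_ge0 // prodr_ge0.
- by move=> s v _; exact: weight_slice.
- by apply: rborel_comp => //; exact: rborel_nth.
- by move=> s; exact: phi0.
- by move=> s v _; rewrite nth_set eqxx.
Qed.

Variables (A B : 'M[C]_n) (mu : R).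
Hypotheses (hA : hermitian A) (hB : hermitian B) (mu0 : 0 < mu).

Definition randA (s : seq R) : 'M[C]_n := perturb mu A (fun i => s`_i).
Definition randB (s : seq R) : 'M[C]_n := perturb mu B (fun i => s`_(n + i)).
Definition node (om : R) (j : nat) (s : seq R) : R := s`_(n + n) + j%:R * om.
Definition randH (om : R) (j : nat) (s : seq R) : 'M[C]_n := randA s - cR (node om j s) *: randB s.

Lemma randA_hermitian s : hermitian (randA s). Proof. exact: perturb_hermitian. Qed.
Lemma randB_hermitian s : hermitian (randB s). Proof. exact: perturb_hermitian. Qed.
Lemma randH_hermitian om j s : hermitian (randH om j s).
Proof. by apply: hermitianB; [exact: randA_hermitian|apply: hermitianZ; exact: randB_hermitian]. Qed.

Lemma mborel_randA : mborel k randA.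
Proof.
apply: mborelD; first exact: mborel_cst.
apply: mborelZ; first exact: rborel_cst.
by apply: mborel_rdiag => l; exact: rborel_nth.
Qed.

Lemma mborel_randB : mborel k randB.
Proof.
apply: mborelD; first exact: mborel_cst.
apply: mborelZ; first exact: rborel_cst.
by apply: mborel_rdiag => l; exact: rborel_nth.
Qed.

Lemma rborel_node om j : rborel k (node om j).
Proof. by apply: rborelD; [exact: rborel_nth|exact: rborel_cst]. Qed.

Lemma mborel_randH om j : mborel k (randH om j).
Proof.
apply: mborelB; first exact: mborel_randA.
by apply: mborelZ; [exact: rborel_node|exact: mborel_randB].
Qed.

Lemma randA_slice (i : 'I_n) s v x : qform (randA (set_nth 0 s i v)) x =
  qform (randA (set_nth 0 s i 0)) x + qform (rdiag n (single i (mu * v))) x.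
Proof.
rewrite !qform_perturb -addrA qform_rdiagD; congr (_ + _); apply: qform_rdiag_eq => l.
rewrite !nth_set /single; case: eqP => _; last by rewrite addr0.
by rewrite mulr0 add0r.
Qed.

Lemma randA_slice2 (i : 'I_n) s v x : qform (randA (set_nth 0 s (n + i) v)) x =
  qform (randA (set_nth 0 s (n + i) 0)) x.
Proof.
rewrite !qform_perturb; congr (_ + _); apply: qform_rdiag_eq => l.
by rewrite !nth_set ltn_eqF // (leq_trans (ltn_ord l)) // leq_addr.
Qed.

Lemma randB_slice (i : 'I_n) s v x : qform (randB (set_nth 0 s (n + i) v)) x =
  qform (randB (set_nth 0 s (n + i) 0)) x + qform (rdiag n (single i (mu * v))) x.
Proof.
rewrite !qform_perturb -addrA qform_rdiagD; congr (_ + _); apply: qform_rdiag_eq => l.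
rewrite !nth_set /single eqn_add2l; case: eqP => _; last by rewrite addr0.
by rewrite mulr0 add0r.
Qed.

Lemma randB_slice2 (i : 'I_n) s v x : qform (randB (set_nth 0 s i v)) x =
  qform (randB (set_nth 0 s i 0)) x.
Proof.
rewrite !qform_perturb; congr (_ + _); apply: qform_rdiag_eq => l.
by rewrite !nth_set gtn_eqF // (leq_trans (ltn_ord i)) // leq_addr.
Qed.

Lemma node_slice om j m s v : (m < n + n)%N -> node om j (set_nth 0 s m v) = node om j s.
Proof. by move=> mn; rewrite /node nth_set gtn_eqF. Qed.

Lemma randH_form om j s x : qform (randH om j s) x = qform (randA s) x - node om j s * qform (randB s) x.
Proof. by rewrite /randH qformBm qformZm. Qed.

Lemma randH_slice om j (i : 'I_n) s v x : qform (randH om j (set_nth 0 s i v)) x =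
  qform (randH om j (set_nth 0 s i 0)) x + qform (rdiag n (single i (mu * v))) x.
Proof.
have inn : (i < n + n)%N by rewrite (leq_trans (ltn_ord i)) // leq_addr.
have e1 := randH_form om j (set_nth 0 s i v) x; have e2 := randH_form om j (set_nth 0 s i 0) x.
rewrite (node_slice om j s v inn) in e1; rewrite (node_slice om j s 0 inn) in e2.
exact: affine_shift1 e1 e2 (randA_slice i s v x) (randB_slice2 i s v x).
Qed.

Lemma randH_slice2 om j (i : 'I_n) s v x : qform (randH om j (set_nth 0 s (n + i) v)) x =
  qform (randH om j (set_nth 0 s (n + i) 0)) x +
  qform (rdiag n (single i ((- node om j s * mu) * v))) x.
Proof.
have inn : (n + i < n + n)%N by rewrite ltn_add2l.
have e1 := randH_form om j (set_nth 0 s (n + i) v) x.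
have e2 := randH_form om j (set_nth 0 s (n + i) 0) x.
rewrite (node_slice om j s v inn) in e1; rewrite (node_slice om j s 0 inn) in e2.
apply: affine_shift2 e1 e2 (randA_slice2 i s v x) (randB_slice i s v x) _.
rewrite !qform_rdiag mulr_sumr -sumrN.
apply: eq_bigr => l _; rewrite /single; case: eqP => _; last by rewrite !mul0r mulr0 oppr0.
by rewrite !mulNr !mulrA.
Qed.

Lemma admissible_site (X : seq R -> 'M[C]_n) (kap : seq R -> nat -> R) (i : 'I_n) :
  (forall s, hermitian (X s)) -> mborel k X -> (forall l, rborel k (fun s => kap s l)) ->
  (forall s l, 0 <= kap s l) -> admissible k (fun s => site (X s) (kap s) i).
Proof.
move=> hX bX bk k0; split; first exact: rborel_site.
by move=> s; have /andP[] := site_01 (X s) (k0 s i).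
Qed.

Lemma rp_ge0 : 0 <= r / p.
Proof. by rewrite divr_ge0 // ?ltW // (density_bound_gt0 q0 qr intq p0). Qed.

Lemma sum_cst (c : R) : \sum_(i < n) c = n%:R * c.
Proof. by rewrite sumr_const card_ord mulr_natl. Qed.

Lemma out_wle (phib phik : R -> R) (a : R) : measurable_fun setT phib ->
  measurable_fun setT phik -> (forall v, 0 <= phik v) -> 0 <= a ->
  (\int[leb]_v (q v * phik v)%:E <= (a * p)%:E)%E ->
  (fun s => \sum_(i < n) site (randB s + rdiag n (fun l => phib s`_l)) (fun l => phik s`_l) i)
    <=w (fun=> n%:R * (r / p * (a / mu))).
Proof.
move=> mb mk k0 a0 le.
have bphi (phi : R -> R) l : measurable_fun setT phi -> rborel k (fun s => phi s`_l).
  by move=> mphi; apply: rborel_comp => //; exact: rborel_nth.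
have hX s : hermitian (randB s + rdiag n (fun l => phib s`_l)).
  by apply: hermitianD; [exact: randB_hermitian|exact: hermitian_rdiag].
have bX : mborel k (fun s => randB s + rdiag n (fun l => phib s`_l)).
  by apply: mborelD; [exact: mborel_randB|apply: mborel_rdiag => l; exact: bphi].
have -> : (fun _ : seq R => n%:R * (r / p * (a / mu))) =
    (fun s => \sum_(i < n) (fun _ : seq R => r / p * (a / mu)) s).
  by apply/funext => s; rewrite sum_cst.
have iN (i : 'I_n) : (i < n + n)%N by rewrite (leq_trans (ltn_ord i)) // leq_addr.
have nz : mu != 0 by rewrite gt_eqF.
have muV : 0 <= mu^-1 by rewrite invr_ge0 ltW.
have amu : 0 <= a / mu by rewrite mulr_ge0.
apply: (wle_sum rborel_weight weight_ge0) => [i|i|i].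
- by apply: (admissible_site i hX bX) => [l|s l]; [exact: bphi|exact: k0].
- by apply: admissible_cst; rewrite mulr_ge0 // rp_ge0.
have aD : admissible k (fun s => phik s`_i / mu).
  split; last by move=> s; rewrite mulr_ge0.
  by apply: rborelM; [exact: bphi|exact: rborel_cst].
apply: (@wle_trans _ _ _ (fun s => r / p * (phik s`_i / mu * 1))).
  (* Site [i] is integrated over the entry of [D_2]. The shift sizes depend on [D_1] only, stay
     frozen meanwhile, and are averaged afterwards by [coordinate_wle]. *)
  have := @site_wle (n + i) i (fun s => randB s + rdiag n (fun l => phib s`_l))
    (fun s l => phik s`_l) (fun=> mu) (fun s => phik s`_i / mu) (fun=> 1) (fun=> 1).
  have -> : (fun s => 1 * site (randB s + rdiag n (fun l => phib s`_l)) (fun l => phik s`_l) i) =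
    (fun s => site (randB s + rdiag n (fun l => phib s`_l)) (fun l => phik s`_l) i).
    by apply/funext => s; rewrite mul1r.
  have off (l : 'I_n) : (l == n + i :> nat)%N = false.
    by apply/negbTE; rewrite neq_ltn (leq_trans (ltn_ord l)) // leq_addr.
  apply=> //.
  - by rewrite ltn_add2l.
  - by move=> l; exact: bphi.
  - by move=> s; rewrite ler01 lexx.
  - by apply: admissible_cst.
  - by move=> s v; rewrite nth_set off.
  - move=> s v x; apply: qform_shift_add; first exact: randB_slice.
    by apply: qform_rdiag_eq => l; rewrite !nth_set off.
  - by move=> s v l; rewrite !nth_set off.
  - by move=> s v _; split=> //; rewrite nth_set off gtr0_norm.
apply: (wleZ rborel_weight weight_ge0 rp_ge0).
- by apply: admissibleM => //; exact: admissible_cst.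
- exact: admissible_cst.
have -> : (fun s : seq R => phik s`_i / mu * 1) = (fun s => mu^-1 * phik s`_i).
  by apply/funext => s; rewrite mulr1 mulrC.
have -> : (fun _ : seq R => a / mu) = (fun s => mu^-1 * a).
  by apply/funext => s; rewrite mulrC.
apply: (wleZ rborel_weight weight_ge0 muV).
- by split; [exact: bphi|].
- exact: admissible_cst.
exact: coordinate_wle.
Qed.

(** In [H(x)] the entry of [D_1] acts with speed [mu] and that of [D_2] with speed [- x mu]. Using
    the first for [|x| <= 1] and the second otherwise, the speed is [mu max(1,|x|)] in absolute
    value; the maximum cancels against the shift, and every grid point has the same window
    [2 c / mu]. *)
Lemma pseudo_wle (om : R) (j : nat) (c : R) : 0 < c ->
  (fun s => \sum_(i < n) site (randH om j s + rdiag n (fun=> c * Num.max 1 `|node om j s|)%R)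
     (fun=> 2 * (c * Num.max 1 `|node om j s|)) i) <=w (fun=> n%:R * (r / p * (2 * c / mu))).
Proof.
move=> c0; pose mx s := Num.max 1 `|node om j s|.
have mx1 s : 1 <= mx s by rewrite /mx le_max lexx.
have mx0 s : 0 <= mx s by apply: le_trans (mx1 s).
have bpt : rborel k (fun s => `|node om j s|).
  by apply: (@rborel_comp _ _ (fun x => `|x|)) => //; exact: rborel_node.
have bmx : rborel k mx.
  move=> d T cc sc mc; apply: measurable_maxr; first exact: measurable_cst.
  exact: bpt.
have bc (b : R) : rborel k (fun s => b * mx s) by apply: rborelM => //; exact: rborel_cst.
have hX s : hermitian (randH om j s + rdiag n (fun=> c * mx s)).
  by apply: hermitianD; [exact: randH_hermitian|exact: hermitian_rdiag].
have bX : mborel k (fun s => randH om j s + rdiag n (fun=> c * mx s)).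
  by apply: mborelD; [exact: mborel_randH|apply: mborel_rdiag => l; exact: bc].
have bkap (l : nat) : rborel k (fun s => 2 * (c * mx s)).
  by apply: rborelM; [exact: rborel_cst|exact: bc].
have k0 s (l : nat) : 0 <= 2 * (c * mx s) by rewrite !mulr_ge0 // ltW.
pose e1 (s : seq R) : R := (`|node om j s| <= 1)%R%:R.
pose e2 (s : seq R) : R := (1 < `|node om j s|)%R%:R.
have ae1 : admissible k e1.
  by split=> [|s]; [apply: rborel_le => //; exact: rborel_cst|rewrite /e1 ler0n].
have ae2 : admissible k e2.
  by split=> [|s]; [apply: rborel_lt => //; exact: rborel_cst|rewrite /e2 ler0n].
have D0 : 0 <= 2 * c / mu by rewrite divr_ge0 ?mulr_ge0 // ltW.
have aD : admissible k (fun=> 2 * c / mu) by exact: admissible_cst.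
have iN (i : 'I_n) : (i < n + n)%N by rewrite (leq_trans (ltn_ord i)) // leq_addr.
have iN2 (i : 'I_n) : (n + i < n + n)%N by rewrite ltn_add2l.
have nz : mu != 0 by rewrite gt_eqF.
have mxs m s v : (m < n + n)%N -> mx (set_nth 0 s m v) = mx s.
  by move=> mn; rewrite /mx node_slice.
have e1s m s v : (m < n + n)%N -> e1 (set_nth 0 s m v) = e1 s.
  by move=> mn; rewrite /e1 node_slice.
have e2s m s v : (m < n + n)%N -> e2 (set_nth 0 s m v) = e2 s.
  by move=> mn; rewrite /e2 node_slice.
pose st i s := site (randH om j s + rdiag n (fun=> c * mx s)) (fun=> 2 * (c * mx s)) i.
have ast (i : 'I_n) : admissible k (st i) := admissible_site i hX bX bkap k0.
have h1 (i : 'I_n) : (fun s => e1 s * st i s) <=w (fun s => r / p * (2 * c / mu * e1 s)).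
  have := @site_wle i i (fun s => randH om j s + rdiag n (fun=> c * mx s))
    (fun s _ => 2 * (c * mx s)) (fun=> mu) (fun=> 2 * c / mu) e1 e1; apply=> //.
  - by case: ae1.
  - by move=> s; rewrite /e1 ler0n lern1 leq_b1.
  - move=> s v v'; rewrite !e1s // /e1; case: (`|node om j s| <= 1) => //=; by rewrite eqxx.
  - move=> s v x; apply: qform_shift_add; first exact: randH_slice.
    by rewrite !mxs.
  - by move=> s v l; rewrite !mxs.
  - move=> s v; rewrite e1s // /e1; case: leP => [h _|_]; last by rewrite eqxx.
    split=> //; rewrite mxs // /mx max_l // mulr1 gtr0_norm //.
have h2 (i : 'I_n) : (fun s => e2 s * st i s) <=w (fun s => r / p * (2 * c / mu * e2 s)).
  have := @site_wle (n + i) i (fun s => randH om j s + rdiag n (fun=> c * mx s))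
    (fun s _ => 2 * (c * mx s)) (fun s => - node om j s * mu) (fun=> 2 * c / mu) e2 e2; apply=> //.
  - by case: ae2.
  - by move=> s; rewrite /e2 ler0n lern1 leq_b1.
  - move=> s v v'; rewrite !e2s // /e2; case: (1 < `|node om j s|) => //=; by rewrite eqxx.
  - move=> s v x; apply: qform_shift_add; last by rewrite !mxs.
    exact: randH_slice2.
  - by move=> s v l; rewrite !mxs.
  - move=> s v; rewrite e2s // /e2; case: ltP => [h _|_]; last by rewrite eqxx.
    have pt0 : node om j s != 0 by rewrite -normr_gt0 (lt_trans _ h).
    split; first by rewrite mulf_neq0 // oppr_eq0.
    rewrite mxs // /mx (max_r (ltW h)) normrM normrN (gtr0_norm mu0).
    have np : `|node om j s| != 0 by rewrite normr_eq0.
    have -> : 2 * (c * `|node om j s|) / (`|node om j s| * mu) = 2 * c / mu by field; rewrite nz np.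
    exact: lexx.
have -> : (fun _ : seq R => n%:R * (r / p * (2 * c / mu))) = (fun s => \sum_(i < n)
    (fun s => r / p * (2 * c / mu * e1 s) + r / p * (2 * c / mu * e2 s)) s).
  apply/funext => s; rewrite sum_cst; congr (_ * _).
  rewrite -mulrDr -mulrDr; suff -> : e1 s + e2 s = 1 by rewrite mulr1.
  by rewrite /e1 /e2; case: leP; rewrite ?addr0 ?add0r.
have -> : (fun s => \sum_(i < n) site (randH om j s + rdiag n (fun=> c * Num.max 1 `|node om j s|))
    (fun=> 2 * (c * Num.max 1 `|node om j s|)) i) = (fun s => \sum_(i < n)
    (fun s => e1 s * st i s + e2 s * st i s) s).
  apply/funext => s; apply: eq_bigr => i _; rewrite -mulrDl.
  suff -> : e1 s + e2 s = 1 by rewrite mul1r.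
  by rewrite /e1 /e2; case: leP; rewrite ?addr0 ?add0r.
have arp (e : seq R -> R) : admissible k e -> admissible k (fun s => r / p * (2 * c / mu * e s)).
  move=> ae; apply: admissibleM; first by apply: admissible_cst; exact: rp_ge0.
  exact: admissibleM.
apply: (wle_sum rborel_weight weight_ge0) => [i|i|i].
- by apply: admissibleD; exact: admissibleM.
- by apply: admissibleD; exact: arp.
by apply: (wleD rborel_weight weight_ge0); do ?[exact: admissibleM|exact: arp].
Qed.

Lemma nneg_randH_slice om j (i : 'I_n) (s : seq R) (v : R) : nneg (randH om j (set_nth 0 s i v)) =
  nneg (randH om j (set_nth 0 s i 0) + rdiag n (single i (mu * v))).
Proof. by apply: nneg_eq => x; rewrite qformDm; exact: randH_slice. Qed.

Lemma nneg_randH_mono om j (i : 'I_n) (s : seq R) (v v' : R) : v <= v' ->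
  (nneg (randH om j (set_nth 0%R s i v')) <= nneg (randH om j (set_nth 0%R s i v)))%N.
Proof.
move=> vv; have e := nneg_randH_slice om j i s v; have e' := nneg_randH_slice om j i s v'.
have le : mu * v <= mu * v' by rewrite ler_pM2l.
exact: eq_leq_trans e' e (nneg_single_le _ _ le).
Qed.

Lemma nneg_randH_S om j (i : 'I_n) (s : seq R) (v v' : R) :
  (nneg (randH om j (set_nth 0%R s i v)) <= (nneg (randH om j (set_nth 0%R s i v'))).+1)%N.
Proof.
have e := nneg_randH_slice om j i s v; have e' := nneg_randH_slice om j i s v'.
exact: eq_leq_trans e (congr1 S e') (nneg_single_S _ _ _ _).
Qed.

Definition jump (m : nat) om j j' (s : seq R) : bool := gap n m (nneg (randH om j s)) (nneg (randH om j' s)).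

(** An entry of [D_1] shifts both forms in the same direction. When it moves, one index can shrink
    the gap by at most one while the other moves favourably, so a gap of two leaves a gap of one. *)
Lemma jump_resample om j j' (i : 'I_n) (s : seq R) (v v' : R) :
  jump 1 om j j' (set_nth 0 s i v) -> jump 0 om j j' (set_nth 0 s i v').
Proof.
have [vv|/ltW vv] := leP v v'.
  exact: gap_resample_up (nneg_randH_mono om j i s vv) (nneg_randH_S om j' i s v v').
exact: gap_resample_down (nneg_randH_S om j i s v' v) (nneg_randH_mono om j' i s vv).
Qed.

Lemma rborel_jump m om j j' : rborel k (fun s => (jump m om j j' s)%:R).
Proof.
rewrite /jump /gap; case: (1 < n)%N; last exact: rborel_cst.
apply: rborel_nneg_lt => [s||s|]; do ?[exact: randH_hermitian|exact: mborel_randH].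
Qed.

(* Minami's estimate: after resampling the entry that produces the first of the two crossings,
   the second one is still there. *)
Lemma collision_wle (om : R) (j j' : nat) (kc : R) : 0 <= kc ->
  (fun s => \sum_(i < n) (jump 1 om j j' s)%:R * site (randH om j s) (fun=> kc) i) <=w
  (fun s => n%:R * (r / p * (kc / mu * (jump 0 om j j' s)%:R))).
Proof.
move=> kc0; have aj m : admissible k (fun s => (jump m om j j' s)%:R).
  by split; [exact: rborel_jump|move=> s; exact: ler0n].
have -> : (fun s => n%:R * (r / p * (kc / mu * (jump 0 om j j' s)%:R))) =
    (fun s => \sum_(i < n) (fun s => r / p * (kc / mu * (jump 0 om j j' s)%:R)) s).
  by apply/funext => s; rewrite sum_cst.
have iN (i : 'I_n) : (i < n + n)%N by rewrite (leq_trans (ltn_ord i)) // leq_addr.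
have kmu : 0 <= kc / mu by rewrite divr_ge0 // ltW.
have aD : admissible k (fun=> kc / mu) by exact: admissible_cst.
have bk (l : nat) : rborel k (fun=> kc) by exact: rborel_cst.
have k0 (s : seq R) (l : nat) : 0 <= kc by [].
have ast (i : 'I_n) : admissible k (fun s => site (randH om j s) (fun=> kc) i) :=
  admissible_site i (randH_hermitian om j) (mborel_randH om j) bk k0.
have nz : mu != 0 by rewrite gt_eqF.
apply: (wle_sum rborel_weight weight_ge0) => [i|i|i].
- by apply: admissibleM; [exact: aj|exact: ast].
- by apply: admissibleM; [apply: admissible_cst; exact: rp_ge0|exact: admissibleM].
apply: (@site_wle i i (randH om j) (fun _ _ => kc) (fun=> mu) (fun=> kc / mu)
  (fun s => (jump 1 om j j' s)%:R) (fun s => (jump 0 om j j' s)%:R)).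
- exact: iN.
- exact: randH_hermitian.
- exact: mborel_randH.
- exact: bk.
- exact: k0.
- exact: rborel_jump.
- by move=> s; rewrite ler0n lern1 leq_b1.
- exact: aj.
- exact: aD.
- by [].
- move=> s v v'; case E : (jump 1 om j j' _) => /=; last by rewrite mulr0n eqxx.
  by rewrite (jump_resample v' E).
- move=> s v x; exact: randH_slice.
- by [].
- by move=> s v _; rewrite gtr0_norm.
Qed.

End RandomPencil.

(** * Numerical budget *)

Section Numerics.
Variable R : realFieldType.

(** Here [t = mu M], [m = mu/N], [sg = p mu/r], [e = mu w/N^2], [g2] is the squared Crawford number,
    and [big] means [n > 1]. At [t = 43/100] less than 1/10 is left besides the saving
    [2/3 sg >= 4/3 m]. For [n > 1] the pseudospectral term is halved by [N >= 2], which makes room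
    for the collision term; for [n = 1] that term is absent. *)
Lemma budget_two_sided (t sg m e g2 N : R) (big : bool) :
  0 <= t <= 43 / 100 -> 0 <= m -> 2 * m <= sg -> sg <= 2 * t -> 1 <= N ->
  (big -> 2 <= N) -> 0 <= g2 <= 2 -> e * N <= 2 * t ^+ 4 -> (big -> e * 8 <= 2 * t ^+ 4) -> 0 <= e ->
  (~~ big -> N = 1) ->
  4 / 3 * (1 + t - sg / 2) + 71 / 50 * (m / N) * (1 + e) + big%:R * ((1 + t) / 2 * g2 * m ^+ 2) <= 2.
Proof.
move=> /andP[t0 t1] m0 msg sgt N1 bigN /andP[g0 g22] eN ebig e0 smallN.
have t4 : t ^+ 4 <= 342 / 10000.
  have -> : t ^+ 4 = (t ^+ 2) ^+ 2 by ring.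
  have t2 : t ^+ 2 <= 1849 / 10000 by nra.
  have := sqr_ge0 t; clear -t2; nra.
case: big bigN ebig smallN => bigN ebig smallN.
  have N2 := bigN isT; have e8 := ebig isT.
  have mN : m / N <= m / 2 by rewrite ler_wpM2l // lef_pV2 // posrE; clear -N2; lra.
  have mN0 : 0 <= m / N by rewrite divr_ge0 //; clear -N2; lra.
  have h1 : 71 / 50 * (m / N) * (1 + e) <= 72 / 100 * m by clear -mN mN0 e0 e8 t4 m0; nra.
  have m1 : m <= 43 / 100 by clear -msg sgt t1; lra.
  have h2 : g2 * m ^+ 2 <= 2 * (43 / 100) * m.
    have a1 : g2 * m ^+ 2 <= 2 * m ^+ 2 by rewrite ler_wpM2r // sqr_ge0.
    have a2 : m ^+ 2 <= 43 / 100 * m by rewrite expr2 ler_wpM2r.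
    clear -a1 a2; lra.
  have h3 : (1 + t) / 2 * g2 * m ^+ 2 <= 143 / 200 * (2 * (43 / 100) * m).
    rewrite -mulrA; have : 0 <= g2 * m ^+ 2 by rewrite mulr_ge0 // sqr_ge0.
    move: (g2 * _) h2 => y h2 y0; clear -t0 t1 h2 y0 m0; nra.
  rewrite mul1r; clear -h1 h2 h3 msg sgt t0 t1 m0; lra.
rewrite mul0r addr0 smallN // divr1.
have e1 : e <= 684 / 10000 by rewrite smallN // in eN; clear -eN t4; lra.
clear -t0 t1 m0 msg sgt e0 e1; nra.
Qed.

Lemma budget_one_sided (t m e g2 N : R) (big : bool) :
  0 <= t < 1 / 2 -> 0 <= m <= t -> 1 <= N -> (big -> 2 <= N) -> 0 <= g2 <= 2 -> 0 <= e <= 1 / 8 ->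
  2 / 3 * (1 + t) + 71 / 50 * (m / N) * (1 + e) + big%:R * ((1 + t) / 2 * g2 * m ^+ 2) <= 2.
Proof.
move=> /andP[t0 t1] /andP[m0 mt] N1 bigN /andP[g0 g22] /andP[e0 e1].
have mN0 : 0 <= m / N by rewrite divr_ge0 //; lra.
case: big bigN => bigN.
  have N2 := bigN isT.
  have mN : m / N <= m / 2 by rewrite ler_wpM2l // lef_pV2 // posrE; lra.
  have m2 : m ^+ 2 <= 1 / 4 by nra.
  have h2 : g2 * m ^+ 2 <= 1 / 2 by have := sqr_ge0 m; nra.
  have h3 : (1 + t) / 2 * g2 * m ^+ 2 <= 3 / 4 * (1 / 2).
    rewrite -mulrA; have : 0 <= g2 * m ^+ 2 by rewrite mulr_ge0 // sqr_ge0.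
    move: (g2 * _) h2 => y h2 y0; nra.
  have h1 : 71 / 50 * (m / N) * (1 + e) <= 71 / 50 * (m / 2) * (9 / 8) by nra.
  rewrite mul1r; lra.
have mN : m / N <= m by rewrite ler_pdivrMr; nra.
have h1 : 71 / 50 * (m / N) * (1 + e) <= 71 / 50 * m * (9 / 8) by nra.
rewrite mul0r addr0; lra.
Qed.

Lemma bernoulli_ineq (x : R) (m : nat) : 0 <= x <= 1 -> 1 - m%:R * x <= (1 - x) ^+ m.
Proof.
move=> /andP[x0 x1]; elim: m => [|m IH]; first by rewrite mul0r subr0 expr0.
rewrite exprS -natr1; have : 0 <= m%:R * x ^+ 2 by rewrite mulr_ge0 ?sqr_ge0.
have : (1 - x) * (1 - m%:R * x) <= (1 - x) * (1 - x) ^+ m by rewrite ler_wpM2l // subr_ge0.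
by rewrite expr2; move: (m%:R) ((1 - x) ^+ m) => a b *; nra.
Qed.

End Numerics.

Section Budget.
Variable R : realFieldType.
Variables (mu M g r p N : R).
Let t := mu * M.
Let w := mu ^+ 3 * g ^+ 2 / N ^+ 5.
Let eps := mu ^+ 6 * g ^+ 2 / (6 * N ^+ 11).
Let del := 2 * mu / (3 * N ^+ 2).
Hypotheses (mu0 : 0 < mu) (M0 : 0 < M) (g0 : 0 < g) (g2 : g ^+ 2 <= 2)
  (tg : 8 * t ^+ 2 < g ^+ 2) (N1 : 1 <= N) (r0 : 0 < r) (p0 : 0 < p)
  (pM : p <= 2 * M * r) (pr : 2 * r <= p * N).

Let N0 : 0 < N. Proof. exact: lt_le_trans N1. Qed.
Let t0 : 0 < t. Proof. exact: mulr_gt0. Qed.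
Let mu_n : mu != 0. Proof. by rewrite gt_eqF. Qed.
Let N_n : N != 0. Proof. by rewrite gt_eqF. Qed.
Let p_n : p != 0. Proof. by rewrite gt_eqF. Qed.
Let g_n : g != 0. Proof. by rewrite gt_eqF. Qed.

Lemma t_lt_half : t < 1 / 2.
Proof.
rewrite -ltr_sqr ?nnegrE ?divr_ge0 //; last exact: ltW.
by rewrite expr_div_n expr1n; move: tg g2; rewrite !expr2; lra.
Qed.

Let m := mu / N.
Let sg := p * mu / r.

Lemma m_ge0 : 0 <= m. Proof. by rewrite divr_ge0 // ltW. Qed.

Lemma m_le_sg : 2 * m <= sg.
Proof.
rewrite /m /sg mulrA ler_pdivrMr // [p * mu / r * N]mulrAC ler_pdivlMr //.
by rewrite [leLHS]mulrAC [leRHS]mulrAC ler_wpM2r // ltW.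
Qed.

Lemma sg_le_t : sg <= 2 * t.
Proof.
rewrite /sg ler_pdivrMr // /t [p * mu]mulrC.
have -> : 2 * (mu * M) * r = mu * (2 * M * r) by ring.
by rewrite ler_wpM2l // ltW.
Qed.

Lemma m_le_t : m <= t.
Proof. have := m_le_sg; have := sg_le_t; lra. Qed.

Lemma w_gt0 : 0 < w.
Proof. by rewrite /w divr_gt0 ?mulr_gt0 ?exprn_gt0. Qed.

Lemma eps_gt0 : 0 < eps.
Proof. by rewrite /eps divr_gt0 ?mulr_gt0 ?exprn_gt0. Qed.

Lemma del_gt0 : 0 < del.
Proof. by rewrite /del divr_gt0 ?mulr_gt0 ?exprn_gt0. Qed.

Lemma del_small : del * (1 + t) <= t.
Proof.
have -> : del = 2 / 3 * (m / N) by rewrite /del /m; field.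
have mN : m / N <= m by rewrite ler_pdivrMr // ler_peMr // m_ge0.
have mN0 : 0 <= m / N by rewrite divr_ge0 ?m_ge0 // ltW.
have := m_le_t; have := t_lt_half; nra.
Qed.

Lemma g_le : g <= 3 / 2.
Proof.
rewrite -ler_sqr ?nnegrE ?divr_ge0 //; last exact: ltW.
by rewrite expr_div_n; move: g2; rewrite !expr2; lra.
Qed.

(** [g / 2] and [1 + t] are the Crawford number and the form bound of the perturbed pencil, so a
    cell is too short to hold eigenvalues of opposite sign type. From [m <= t < 1/2] the left side
    is at most [3/16 g], while the right side exceeds [2/3 g]. *)
Lemma gap_small : w < 2 * (g / 2) / (1 + t).
Proof.
have t1 : 0 < 1 + t by rewrite addr_gt0.
rewrite ltr_pdivlMr // [2 * (g / 2)]mulrC divfK ?pnatr_eq0 //.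
have -> : w = m ^+ 3 * (g ^+ 2) * (N ^+ 2)^-1 by rewrite /w /m; field.
have N2 : (N ^+ 2)^-1 <= 1 by rewrite invf_le1 ?exprn_gt0 // exprn_ege1.
have th := t_lt_half; have m3 : m ^+ 3 <= 1 / 8.
  have -> : 1 / 8 = (1 / 2) ^+ 3 :> R by field.
  by rewrite lerXn2r ?nnegrE ?m_ge0 ?divr_ge0 //; apply: le_trans m_le_t (ltW th).
have m30 : 0 <= m ^+ 3 by rewrite exprn_ge0 // m_ge0.
have gg : g ^+ 2 <= 3 / 2 * g by rewrite expr2 ler_wpM2r ?g_le // ltW.
have : m ^+ 3 * g ^+ 2 * (N ^+ 2)^-1 <= 1 / 8 * (3 / 2 * g).
  rewrite -[leRHS]mulr1; apply: ler_pM => //.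
  - by rewrite mulr_ge0 // sqr_ge0.
  - by rewrite invr_ge0 sqr_ge0.
  by apply: ler_pM => //; rewrite sqr_ge0.
move: (_ * _ * _) => y ys; have := g0; nra.
Qed.

Let e := mu * w / N ^+ 2.

Lemma e_ge0 : 0 <= e.
Proof. have h : 0 < mu * w by exact: mulr_gt0 mu0 w_gt0.
by rewrite /e divr_ge0 ?sqr_ge0 // ltW. Qed.

Lemma e_le : e * N ^+ 3 <= 2 * t ^+ 4.
Proof.
have -> : e * N ^+ 3 = g ^+ 2 * m ^+ 4 by rewrite /e /w /m; field.
apply: ler_pM => //; rewrite ?sqr_ge0 ?exprn_ge0 ?m_ge0 //.
by rewrite lerXn2r ?nnegrE ?m_ge0 ?m_le_t // ltW.
Qed.

Lemma eN_le : e * N <= 2 * t ^+ 4.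
Proof.
apply: le_trans e_le; rewrite ler_wpM2l ?e_ge0 // -[leLHS]expr1.
by rewrite ler_weXn2l.
Qed.

Lemma e8_le : 2 <= N -> e * 8 <= 2 * t ^+ 4.
Proof.
move=> N2; apply: le_trans e_le; rewrite ler_wpM2l ?e_ge0 //.
have -> : 8 = 2 ^+ 3 :> R by ring.
by rewrite lerXn2r ?nnegrE // ltW.
Qed.

Lemma e_le8 : e <= 1 / 8.
Proof.
have h : e <= e * N ^+ 3 by rewrite ler_peMr ?e_ge0 // exprn_ege1.
apply: le_trans h (le_trans e_le _).
have -> : 1 / 8 = 2 * (1 / 2) ^+ 4 :> R by field.
by rewrite ler_wpM2l // lerXn2r ?nnegrE ?divr_ge0 // ltW // t_lt_half.
Qed.

(** Everything is measured in the unit [r/(N p)], of which 2 are available. [K2] bounds the number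
    of grid points; its surplus 3 over [3 N^2/(mu w)] becomes the factor [1 + e]. The exponents in
    [w] and [eps] reduce the costs of cells and grid points to [(1 + t)/2 (g m)^2] and
    [71/50 (m/N) (1 + e)]. *)
Lemma total_budget (a K2 : R) (big : bool) : (big -> 2 <= N) -> (~~ big -> N = 1) ->
  K2 <= 3 * N ^+ 2 / (mu * w) + 3 ->
  (t <= 43 / 100 /\ a = 2 * del * (1 + t - sg / 2)) \/ a = del * (1 + t) ->
  N * (r / p * (a / mu)) + (K2 * (N * (r / p * (2 * (71 / 50 * eps) / mu))) +
    1 / 2 * (N * (r / p * (w * (1 + t) / mu)) * (N * big%:R))) <= 2 * r / N / p.
Proof.
move=> bN nbN K2le aE.
have cp0 : 0 <= r / N / p by rewrite !divr_ge0 // ltW.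
have th := t_lt_half; have t0' := ltW t0; have w0 := w_gt0; have w_n : w != 0 by rewrite gt_eqF.
have E1 : N * (r / p * (a / mu)) = r / N / p * (a * N ^+ 2 / mu).
  by field; rewrite mu_n p_n N_n.
have E2 : K2 * (N * (r / p * (2 * (71 / 50 * eps) / mu))) <= r / N / p * (71 / 50 * (m / N) * (1 + e)).
  have pos : 0 <= N * (r / p * (2 * (71 / 50 * eps) / mu)).
    have eps0 := ltW eps_gt0; have r0' := ltW r0; have p0' := ltW p0; have mu0' := ltW mu0; have N0' := ltW N0.
    have rp0 := divr_ge0 r0' p0'; have ee : 0 <= 2 * (71 / 50 * eps) by lra.
    exact: mulr_ge0 N0' (mulr_ge0 rp0 (divr_ge0 ee mu0')).
  apply: le_trans (ler_wpM2r pos K2le) _.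
  rewrite le_eqVlt; apply/orP; left; apply/eqP; rewrite /e /m /eps /w.
  by field; rewrite mu_n g_n p_n N_n.
have E3 : 1 / 2 * (N * (r / p * (w * (1 + t) / mu)) * (N * big%:R)) =
    r / N / p * (big%:R * ((1 + t) / 2 * g ^+ 2 * m ^+ 2)).
  by rewrite /w /m; field; rewrite mu_n p_n N_n.
have -> : 2 * r / N / p = r / N / p * 2 by field; rewrite p_n N_n.
have g22 : 0 <= g ^+ 2 <= 2 by rewrite sqr_ge0 g2.
rewrite E1 E3 addrA; apply: le_trans (lerD (lerD (lexx _) E2) (lexx _)) _.
rewrite -!mulrDr ler_wpM2l //.
case: aE => [[t43 ->]|->].
  have -> : 2 * del * (1 + t - sg / 2) * N ^+ 2 / mu = 4 / 3 * (1 + t - sg / 2).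
    by rewrite /del; field; rewrite mu_n N_n.
  apply: budget_two_sided => //; do ?[exact: m_ge0|exact: m_le_sg|exact: sg_le_t|exact: eN_le|exact: e_ge0].
  - by rewrite t0' t43.
  - by move=> /bN; exact: e8_le.
have -> : del * (1 + t) * N ^+ 2 / mu = 2 / 3 * (1 + t).
  by rewrite /del; field; rewrite mu_n N_n.
apply: budget_one_sided => //.
- by rewrite t0' th.
- by rewrite m_ge0 m_le_t.
- by rewrite e_ge0 e_le8.
Qed.

End Budget.

(** * The shattering probability *)

Section Densities.
Variable R : realType.
Local Notation leb := (@lebesgue_measure R).

(** Conditioning on [|x| <= M] without renormalization: the product weight stays below the original
    density, and the conditioning reappears as the factor [p ^ (2 n)]. *)
Definition truncated (rho : R -> R) (M x : R) : R := if `|x| <= M then rho x else 0.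

Lemma measurable_truncated rho M : measurable_fun setT rho -> measurable_fun setT (truncated rho M).
Proof.
move=> mrho; apply: measurable_fun_ifT; [|exact: mrho|exact: measurable_cst].
by apply: measurable_fun_ler; [exact: normr_measurable|exact: measurable_cst].
Qed.

Lemma fine_complement (x y : \bar R) (th : R) : x \is a fin_num -> y \is a fin_num ->
  (0 <= x)%E -> (x <= th%:E)%E -> (y + x = 1)%E -> 1 - th <= fine y <= 1.
Proof.
case: x => [x||] //; case: y => [y||] // _ _; rewrite !lee_fin -EFinD => x0 xt [] yx /=.
apply/andP; split; lra.
Qed.

Lemma truncated_mass (rho : R -> R) (M theta : R) : is_density rho ->
  (\int[leb]_(x in [set x : R | (M < `|x|)%R]) (rho x)%:E <= theta%:E)%E ->
  exists p, (\int[leb]_x (truncated rho M x)%:E = p%:E)%E /\ 1 - theta <= p <= 1.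
Proof.
move=> [mrho rho0 int1] tail.
pose T := [set x : R | (M < `|x|)%R].
have mT : measurable T.
  rewrite -[T]setTI; have := @measurable_fun_ltr _ _ _ setT (fun=> M) (fun x : R => `|x|)
    (measurable_cst _) (@normr_measurable R _).
  exact: (fun h => h measurableT [set true] I).
have E0 D : measurable D -> (0 <= \int[leb]_(x in D) (rho x)%:E)%E.
  by move=> mD; apply: integral_ge0 => x _; rewrite lee_fin.
have T0 := E0 _ mT; have C0 := E0 _ (measurableC mT).
have mE D : measurable_fun D (fun x => (rho x)%:E).
  by apply/measurable_EFinP; exact: measurable_funTS.
have split1 : (\int[leb]_(x in ~` T) (rho x)%:E + \int[leb]_(x in T) (rho x)%:E = 1)%E.
  have e : [set: R] = ~` T `|` T by rewrite setvU.
  rewrite -int1 e ge0_integral_setU //.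
  - exact: measurableC.
  - exact: mE.
  - by move=> x _; rewrite lee_fin.
  - by rewrite /disj_set setICl eqxx.
have truncE : (\int[leb]_x (truncated rho M x)%:E = \int[leb]_(x in ~` T) (rho x)%:E)%E.
  rewrite [RHS]integral_mkcond; apply: eq_integral => x _; rewrite patchE /truncated /=.
  case: ifPn => h; case: ifPn => h' //.
    by move: h'; rewrite notin_setE /T /=; case: leP h.
  by move: h'; rewrite inE /T /=; case: leP h.
have fT : (\int[leb]_(x in T) (rho x)%:E)%E \is a fin_num.
  by rewrite (ge0_fin_numE T0); apply: le_lt_trans tail (ltry _).
have fC : (\int[leb]_(x in ~` T) (rho x)%:E)%E \is a fin_num.
  rewrite (ge0_fin_numE C0).
  have le1 : (\int[leb]_(x in ~` T) (rho x)%:E <= 1)%E by rewrite -split1 leeDl.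
  by apply: le_lt_trans le1 (ltry _).
rewrite truncE -(fineK fC); eexists; split; first by [].
exact: fine_complement fT fC T0 tail split1.
Qed.

Definition uniform_density (a w x : R) : R := if `[< a - w < x < a >] then w^-1 else 0.

Lemma uniform_densityE a w x : uniform_density a w x = w^-1 * \1_`]a - w, a[ x.
Proof.
rewrite /uniform_density indicE mem_setE in_itv /=; case: asboolP => [->|h]; first by rewrite mulr1.
by case: (boolP (a - w < x < a)) h => [h h'|_ _]; [case: (h' isT)|rewrite mulr0].
Qed.

Lemma uniform_density_ge0 a w x : 0 < w -> 0 <= uniform_density a w x.
Proof. by move=> w0; rewrite uniform_densityE mulr_ge0 // invr_ge0 ltW. Qed.

Lemma measurable_uniform_density a w : measurable_fun setT (uniform_density a w).
Proof.
have -> : uniform_density a w = (fun x => w^-1 * \1_`]a - w, a[ x).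
  by apply/funext => x; exact: uniform_densityE.
by apply: measurable_funM; [exact: measurable_cst|exact: measurable_indic].
Qed.

Lemma integral_uniform_density a w : 0 < w -> (\int[leb]_x (uniform_density a w x)%:E = 1)%E.
Proof.
move=> w0; under eq_integral do rewrite uniform_densityE EFinM.
have i0 (x : R) : (0 <= (\1_(`]a - w, a[%classic) x)%:E :> \bar R)%E by rewrite lee_fin.
rewrite ge0_integralZl_EFin //; last first.
- by rewrite invr_ge0 ltW.
- by apply/measurable_EFinP; exact: measurable_indic.
rewrite integral_indic // setIT [X in (_ * X)%E]lebesgue_measure_itv /= lte_fin ltrBlDr ltrDl w0.
by rewrite -EFinB -EFinM opprB addrCA subrr addr0 mulVf // gt_eqF.
Qed.

Lemma le_supnorm (rho : R -> R) x : ubounded_density rho -> rho x <= supnorm rho.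
Proof.
move=> [b hb]; apply: ub_le_sup; last by exists x.
by exists b => _ [y _ <-].
Qed.

End Densities.

Lemma le_sum_nat (R : numDomainType) (f : nat -> R) (J j : nat) : (forall i, 0 <= f i) ->
  (j < J)%N -> f j <= \sum_(i < J) f i.
Proof. by move=> f0 jJ; rewrite (bigD1 (Ordinal jJ)) //= lerDl sumr_ge0. Qed.

Lemma sums_lt1 (R : realFieldType) (X0 : R) (X1 : nat -> R) (X2 : nat -> nat -> R) (K : nat) :
  0 <= X0 -> (forall j, 0 <= X1 j) -> (forall j j', 0 <= X2 j j') ->
  X0 + (\sum_(j < K.+2) X1 j + \sum_(j < K.+1) 1 / 2 * (X2 j j.+1 + X2 j.+1 j)) < 1 ->
  [/\ X0 < 1, forall j, (j < K.+2)%N -> X1 j < 1 &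
     forall j, (j < K.+1)%N -> 1 / 2 * X2 j j.+1 < 1 /\ 1 / 2 * X2 j.+1 j < 1].
Proof.
move=> X00 X10 X20; pose Y j := 1 / 2 * (X2 j j.+1 + X2 j.+1 j).
have Y0 j : 0 <= Y j by rewrite mulr_ge0 ?divr_ge0 ?addr_ge0.
rewrite -[X in X0 + (_ + X)]/(\sum_(j < K.+1) Y j) => lt1.
have S1 : 0 <= \sum_(j < K.+2) X1 j by exact: sumr_ge0.
have S2 : 0 <= \sum_(j < K.+1) Y j by exact: sumr_ge0.
split=> [|j jK|j jK]; first lra.
  by have := le_sum_nat X10 jK; lra.
have := le_sum_nat Y0 jK; rewrite {1}/Y => h; have := X20 j j.+1; have := X20 j.+1 j.
by move=> *; split; lra.
Qed.

Lemma ratio_le (R : realFieldType) (a b L del : R) : del * L = 1 -> 0 < L -> b != 0 ->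
  del * `|a| <= `|b| -> `|a / b| <= L.
Proof.
move=> dL L0 b0 le; rewrite normrM normfV ler_pdivrMr ?normr_gt0 //.
have -> : `|a| = L * (del * `|a|) by rewrite mulrA [L * del]mulrC dL mul1r.
by rewrite ler_wpM2l // ltW.
Qed.

Lemma shift_arith (R : realFieldType) (p q s x y w N p1 p2 : R) :
  p1 = p - x * q -> p2 = p - y * q ->
  (y - x) * q <= w * (N * s) -> p1 - w * N * s <= p2.
Proof. by move=> -> ->; lra. Qed.

(** * Counts of unit steps that detect every failure *)

Section GoodEvent.
Variable R : realType.
Local Notation C := (R[i]).
Local Notation hermitian := Defs.hermitian.

Lemma far_shift_sites n (K K' : 'M[C]_n) (c : R) (m : nat) :
  (forall u, qform K u - c * sqn u <= qform K' u) -> (nneg K + m <= nneg K')%N ->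
  (m%:R : R) <= \sum_(i < n) site K (fun=> c) i.
Proof.
move=> le h; apply: site_sum_ge; apply: leq_trans h _; apply: nneg_mono => u.
by rewrite qformBm qform_rdiag_cst.
Qed.

Lemma two_sided_sites n (K : 'M[C]_n) (d : nat -> R) :
  (nneg (K + rdiag n d) < nneg (K - rdiag n d))%N ->
  1 <= \sum_(i < n) site (K + rdiag n d) (fun l => 2 * d l) i.
Proof.
move=> h; rewrite -[1]/(1%:R); apply: site_sum_ge; rewrite addn1; apply: leq_trans h _; apply: nneg_mono => u.
rewrite !qformBm qformDm -addrA lerD2l qform_rdiagB -sub0r.
rewrite lerBrDr qform_rdiagD (@qform_rdiag_eq _ _ _ (fun=> 0)) ?qform_rdiag_cst ?mul0r //.
by move=> l; ring.
Qed.

Lemma shift_form n (A B : 'M[C]_n) (N w x y : R) : form_le N B -> `|y - x| = w ->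
  forall u, qform (A - cR x *: B) u - w * N * sqn u <= qform (A - cR y *: B) u.
Proof.
move=> leB yx u; have E v : qform (A - cR v *: B) u = qform A u - v * qform B u.
  by rewrite qformBm qformZm.
have h : (y - x) * qform B u <= w * (N * sqn u).
  apply: le_trans (ler_norm _) _; rewrite normrM yx; apply: ler_wpM2l (leB u).
  by rewrite -yx; exact: normr_ge0.
exact: shift_arith (E x) (E y) h.
Qed.

Variables (n : nat) (A B S : 'M[C]_n) (a b : nat -> R) (N g eps z w L del : R) (K : nat).
Hypotheses (hA : hermitian A) (hB : hermitian B) (uS : S \in unitmx)
  (dA : mxadj S *m A *m S = rdiag n a) (dB : mxadj S *m B *m S = rdiag n b)
  (N0 : 0 < N) (g0 : 0 < g) (leB : form_le N B) (crawfordP : crawford_ge g A B)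
  (eps0 : 0 < eps) (w0 : 0 < w) (wgap : w < 2 * g / N)
  (L0 : 0 < L) (dL : del * L = 1) (zL : z < - L) (Lz : L < z + K.+1%:R * w).

Let H (j : nat) := A - cR (z + j%:R * w) *: B.
Let c := 71 / 50 * eps.

Definition pseudo_count (j : nat) : R := \sum_(i < n)
  site (H j + rdiag n (fun=> c * Num.max 1 `|z + j%:R * w|)%R)
    (fun=> 2 * (c * Num.max 1 `|z + j%:R * w|)) i.

Definition collision_count (j j' : nat) : R :=
  \sum_(i < n) (gap n 1 (nneg (H j)) (nneg (H j')))%:R * site (H j) (fun=> w * N) i.

Let m0 (x : R) : 0 <= Num.max 1 `|x|.
Proof. by rewrite le_max ler01. Qed.

Lemma out_count_ge0 (Ko : 'M[C]_n) (kap : nat -> R) : (forall l, 0 <= kap l) ->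
  0 <= \sum_(i < n) site Ko kap i.
Proof. by move=> kap0; apply: sumr_ge0 => i _; have /andP[] := site_01 Ko (kap0 i). Qed.

Lemma pseudo_count_ge0 j : 0 <= pseudo_count j.
Proof.
have c0 : 0 <= c by have := eps0; rewrite /c; move: eps => x; lra.
have k0 : 0 <= 2 * (c * Num.max 1 `|z + j%:R * w|) := mulr_ge0 (ler0n _ 2) (mulr_ge0 c0 (m0 _)).
exact: (@out_count_ge0 _ (fun=> _) (fun=> k0)).
Qed.

Lemma collision_count_ge0 j j' : 0 <= collision_count j j'.
Proof.
have k0 : 0 <= w * N by rewrite ltW // mulr_gt0.
apply: sumr_ge0 => i _; apply: mulr_ge0; first exact: ler0n.
by have /andP[] := @site_01 _ _ (H j) (fun=> w * N) i k0.
Qed.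

(** Moving to a neighbouring grid point lowers the form by at most [w N], so a jump by two
    contributes at least two unit steps; hence the factor 1/2. *)
Lemma collision_count_ge (j j' : nat) : `|(z + j'%:R * w) - (z + j%:R * w)| = w ->
  (nneg (H j) + 2 <= nneg (H j'))%N -> 1 <= 1 / 2 * collision_count j j'.
Proof.
move=> yx h; have := far_shift_sites (shift_form A leB yx) h.
have gp : gap n 1 (nneg (H j)) (nneg (H j')).
  have h2 : (2 <= nneg (H j'))%N by apply: leq_trans h; exact: leq_addl.
  have n2 : (1 < n)%N := leq_trans h2 (nneg_le _).
  by rewrite /gap n2 addn1 /= -addn2.
rewrite /collision_count gp; move: (site _ _) => f.
have -> : \sum_(i < n) true%:R * f i = \sum_(i < n) f i by apply: eq_bigr => i _; exact: mul1r.
move: (\sum_(i < n) _) => x; lra.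
Qed.

(** Each failure contributes at least 1 to its count and no count is negative, so a total below 1
    excludes all failures at once. The union bound thereby becomes one expectation. *)
Lemma good_event (Ko : 'M[C]_n) (kap : nat -> R) : (forall l, 0 <= kap l) ->
  (forall k : 'I_n, `|b k| < del * `|a k| -> (nneg Ko < nneg (Ko - rdiag n kap))%N) ->
  \sum_(i < n) site Ko kap i + (\sum_(j < K.+2) pseudo_count j +
     \sum_(j < K.+1) 1 / 2 * (collision_count j j.+1 + collision_count j.+1 j)) < 1 ->
  shattered eps A B (grid z w K).
Proof.
move=> kap0 outP.
move=> /(sums_lt1 (out_count_ge0 Ko kap0) pseudo_count_ge0 collision_count_ge0)[l0 l1 l2].
apply: (shattered_criterion hA hB uS dA dB N0 g0 leB crawfordP eps0 w0 wgap).
- move=> k bk; have ab : `|a k / b k| <= L.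
    apply: (ratio_le dL L0 bk); rewrite leNgt; apply/negP => /outP h.
    have := @site_sum_ge _ _ Ko kap 1; rewrite addn1 => /(_ h).
    by rewrite leNgt => /negP; apply.
  move: ab; rewrite ler_norml mul0r addr0 => /andP[h1 h2]; apply/andP; split.
    exact: lt_le_trans zL h1.
  exact: le_lt_trans h2 Lz.
- move=> j jK h; have := two_sided_sites h; rewrite leNgt => /negP; apply; exact: l1.
move=> j jK; have [lt1 lt2] := l2 j jK.
have stepw : z + j.+1%:R * w - (z + j%:R * w) = w by rewrite -natr1; ring.
have w1 : `|z + j.+1%:R * w - (z + j%:R * w)| = w by rewrite stepw gtr0_norm.
have w2 : `|z + j%:R * w - (z + j.+1%:R * w)| = w by rewrite distrC.
split=> h; [have := collision_count_ge w1 h|have := collision_count_ge w2 h].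
  by rewrite leNgt lt1.
by rewrite leNgt lt2.
Qed.

End GoodEvent.

Lemma sum_gaps_le (R : numDomainType) (f : nat -> nat) (J n : nat) :
  (\sum_(j < J) ((f j < f j.+1) + (f j.+1 < f j)) <= n)%N ->
  \sum_(j < J) ((gap n 0 (f j) (f j.+1))%:R + (gap n 0 (f j.+1) (f j))%:R) <=
    n%:R * (1 < n)%N%:R :> R.
Proof.
move=> le; rewrite /gap; case: (1 < n)%N => /=; last first.
  by rewrite big1 ?mulr0 // => j _; rewrite addr0.
rewrite mulr1 (eq_bigr (fun j : 'I_J => ((f j < f j.+1) + (f j.+1 < f j))%N%:R)).
  by rewrite -natr_sum ler_nat.
by move=> j _; rewrite !addn0 natrD.
Qed.

Section Outside.
Variable R : realType.
Local Notation C := (R[i]).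
Local Notation hermitian := Defs.hermitian.
Local Notation leb := (@lebesgue_measure R).
Variables (n : nat) (A B : 'M[C]_n) (mu M : R).
Hypotheses (hA : hermitian A) (hB : hermitian B) (A1 : specnorm A <= 1) (B1 : specnorm B <= 1)
  (c0 : 0 < crawford A B) (mu0 : 0 < mu) (M0 : 0 < M).
Let t := mu * M.
Hypothesis (tc : 8 * t ^+ 2 < crawford A B ^+ 2).

Lemma crawford_sqr_le2 : (0 < n)%N -> crawford A B ^+ 2 <= 2.
Proof.
move=> n0; pose u : 'cV[C]_n := delta_mx (Ordinal n0) 0.
have u0 : u != 0.
  by apply/eqP => /matrixP/(_ (Ordinal n0) 0)/eqP; rewrite !mxE !eqxx oner_eq0.
have s0 : 0 < sqn u ^+ 2 by rewrite exprn_gt0 // sqn_gt0.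
have sq (x : R) : `|x| <= sqn u -> x ^+ 2 <= sqn u ^+ 2.
  by move=> h; rewrite -real_normK ?num_real // ler_sqr ?nnegrE ?sqn_ge0.
rewrite -(ler_pM2r s0); apply: le_trans (crawford_qform u hA hB (ltW c0)) _.
by apply: le_trans (lerD (sq _ (qform_le1 u A1)) (sq _ (qform_le1 u B1))) _; lra.
Qed.

Lemma perturbed_diag (d1 d2 : nat -> R) :
  (forall l : 'I_n, `|d1 l| <= M) -> (forall l : 'I_n, `|d2 l| <= M) ->
  exists (S : 'M[C]_n) (a b : nat -> R), [/\ S \in unitmx,
    mxadj S *m perturb mu A d1 *m S = rdiag n a & mxadj S *m perturb mu B d2 *m S = rdiag n b].
Proof.
move=> d1M d2M; apply: definite_pencil_diag; do ?exact: perturb_hermitian.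
move=> u Au Bu; apply/eqP; apply: contraT => u0.
have := crawford_perturb (ltW mu0) hA hB (ltW c0) (ltW tc) d1M d2M u.
rewrite Au Bu expr0n addr0 leNgt => /negP; case.
by rewrite mulr_gt0 ?exprn_gt0 ?divr_gt0 ?sqn_gt0.
Qed.

Variables (q : R -> R) (r p del : R).
Hypotheses (mq : measurable_fun setT q) (q0 : forall x, 0 <= q x) (qr : forall x, q x <= r)
  (intq : (\int[leb]_x (q x)%:E = p%:E)%E) (p0 : 0 < p)
  (qM : forall x, M < `|x| -> q x = 0) (t_half : t < 1 / 2)
  (del0 : 0 < del) (delt : del * (1 + t) <= t) (sgt : p * mu / r <= 2 * t).

(* For small t the relevant sign of A is constant on near-null vectors of B, and the average of
   |1 + sg mu x| over the density saves the term p mu / (2 r). For t > 43/100 the Crawford number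
   forces B to be definite, and shifting on one side only halves the window. *)
Lemma outside_choice : exists (phib phik : R -> R) (a : R),
  [/\ measurable_fun setT phib, measurable_fun setT phik, (forall v, 0 <= phik v) &
    (\int[leb]_v (q v * phik v)%:E <= (a * p)%:E)%E] /\
  [/\ 0 <= a,
    (t <= 43 / 100 /\ a = 2 * del * (1 + t - p * mu / r / 2)) \/ a = del * (1 + t) &
    forall (d1 d2 : nat -> R) (S : 'M[C]_n) (a b : nat -> R) (k : 'I_n),
      (forall l : 'I_n, `|d1 l| <= M) -> (forall l : 'I_n, `|d2 l| <= M) -> S \in unitmx ->
      mxadj S *m perturb mu A d1 *m S = rdiag n a ->
      mxadj S *m perturb mu B d2 *m S = rdiag n b -> `|b k| < del * `|a k| ->
      (nneg (perturb mu B d2 + rdiag n (fun l => phib (d1 l))) <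
       nneg (perturb mu B d2 + rdiag n (fun l => phib (d1 l))
             - rdiag n (fun l => phik (d1 l))))%N].
Proof.
have t0 : 0 < t by exact: mulr_gt0.
have r0 := density_bound_gt0 q0 qr intq p0.
have [t43|t43] := leP t (43 / 100).
  have [sg [sgE sgP]] := near_null_sign hA hB c0 (ltW mu0) (ltW M0) tc.
  pose f (x : R) := `|1 + sg * (mu * x)|.
  have f0 x : 0 <= f x by exact: normr_ge0.
  have mf : measurable_fun setT f.
    apply: measurableT_comp; first exact: normr_measurable.
    apply: measurable_funD; first exact: measurable_cst.
    apply: measurable_funM; first exact: measurable_cst.
    by apply: measurable_funM; [exact: measurable_cst|exact: measurable_id].
  exists (fun x => del * f x), (fun x => 2 * (del * f x)),
    (2 * del * (1 + t - p * mu / r / 2)).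
  have a1 : 0 <= 1 + t - p * mu / r / 2 by move: (p * mu / r) sgt => y; lra.
  have mb : measurable_fun setT (fun x => del * f x).
    by apply: measurable_funM => //; exact: measurable_cst.
  split; split.
  - exact: mb.
  - by apply: measurable_funM => //; exact: measurable_cst.
  - by move=> v; exact: mulr_ge0 (ler0n _ 2) (mulr_ge0 (ltW del0) (f0 v)).
  - have -> : (\int[leb]_v (q v * (2 * (del * f v)))%:E =
        (2 * del)%:E * \int[leb]_v (q v * f v)%:E)%E.
      rewrite -ge0_integralZl_EFin.
      + by apply: eq_integral => v _; rewrite -EFinM; congr (_%:E); ring.
      + exact: measurableT.
      + by move=> v _; rewrite lee_fin mulr_ge0.
      + by apply/measurable_EFinP; exact: measurable_funM.
      + by rewrite mulr_ge0 // ltW.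
    have tM : mu * M <= 1 by move: t_half; rewrite /t; lra.
    have := mean_bound mq q0 qr intq p0 M0 qM mu0 tM sgE => mb'.
    apply: le_trans (lee_wpmul2l _ mb') _; first by rewrite lee_fin mulr_ge0 // ltW.
    rewrite -EFinM lee_fin le_eqVlt; apply/orP; left; apply/eqP.
    by rewrite /t; field; rewrite gt_eqF.
  - exact: mulr_ge0 (mulr_ge0 (ler0n _ 2) (ltW del0)) a1.
  - by left.
  move=> d1 d2 S a b k d1M d2M uS dA dB out.
  have h := outside_two_sided hA hB A1 c0 (ltW mu0) (ltW M0) tc d1M d2M uS dA dB (ltW del0) delt
    out sgE sgP.
  apply: leq_trans h _; apply: nneg_mono => u; rewrite !qformBm qformDm -addrA lerD2l.
  rewrite qform_rdiagB -sub0r lerBrDr qform_rdiagD (@qform_rdiag_eq _ _ _ (fun=> 0)).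
    by rewrite qform_rdiag_cst mul0r.
  by move=> l; rewrite /f; ring.
(* Here [8 t^2 - t^2 = 7 t^2 > 1], because [7 (43/100)^2] is about 1.29. The threshold must lie
   above [1/sqrt(7)], about 0.378, and below 1/2 with enough room for the two-sided budget. *)
have tc1 : t ^+ 2 + 1 < crawford A B ^+ 2.
  apply: le_lt_trans tc; have : (43 / 100) ^+ 2 <= t ^+ 2.
    by rewrite ler_sqr ?nnegrE ?divr_ge0 // ltW.
  by rewrite expr_div_n; move: (t ^+ 2) => y; rewrite !expr2; lra.
have [sg [sgE sgP]] := definite_sign hA hB A1 c0 (ltW mu0) (ltW M0) tc1.
pose beta := if sg == 1 then 0 else del * (1 + t).
have d0 : 0 <= del * (1 + t) by rewrite mulr_ge0 // ?addr_ge0 // ltW.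
exists (fun=> beta), (fun=> del * (1 + t)), (del * (1 + t)); split; split.
- exact: measurable_cst.
- exact: measurable_cst.
- by [].
- have -> : (\int[leb]_v (q v * (del * (1 + t)))%:E =
      \int[leb]_v (del * (1 + t) * q v)%:E)%E.
    by apply: eq_integral => v _; rewrite mulrC.
  by rewrite (integral_scale_density mq q0 intq d0).
- by [].
- by right.
move=> d1 d2 S a b k d1M d2M uS dA dB out.
have h := outside_one_sided A1 (ltW mu0) d1M d2M uS dA dB (ltW del0) out sgE sgP.
exact: h erefl.
Qed.

End Outside.

Lemma double_ratio (R : fieldType) (x mu w : R) : (2 : R) != 0 -> mu != 0 -> w != 0 ->
  2 * (x / (2 * mu)) = x / (mu * w) * w.
Proof. by move=> h2 hm hw; field; rewrite h2 hm hw. Qed.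

Section ShatteringProbability.
Variable R : realType.
Local Notation C := (R[i]).
Local Notation hermitian := Defs.hermitian.
Local Notation leb := (@lebesgue_measure R).
Variables (n : nat) (A B : 'M[C]_n) (mu M : R) (q u : R -> R) (r p : R) (K : nat).
Let g := crawford A B.
Let N : R := n%:R.
Let t := mu * M.
Let w := mu ^+ 3 * g ^+ 2 / N ^+ 5.
Let eps := mu ^+ 6 * g ^+ 2 / (6 * N ^+ 11).
Let del := 2 * mu / (3 * N ^+ 2).
Let L := 3 * N ^+ 2 / (2 * mu).
Hypotheses (n0 : (0 < n)%N) (hA : hermitian A) (hB : hermitian B)
  (A1 : specnorm A <= 1) (B1 : specnorm B <= 1)
  (c0 : 0 < g) (mu0 : 0 < mu) (M0 : 0 < M) (tc : 8 * t ^+ 2 < g ^+ 2)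
  (mq : measurable_fun setT q) (q0 : forall x, 0 <= q x) (qr : forall x, q x <= r)
  (intq : (\int[leb]_x (q x)%:E = p%:E)%E) (p0 : 0 < p)
  (qM : forall x, M < `|x| -> q x = 0) (pr : 2 * r <= p * N)
  (mu_ : measurable_fun setT u) (u0 : forall x, 0 <= u x) (intu : (\int[leb]_x (u x)%:E = 1)%E)
  (u_supp : forall x, u x != 0 -> - L - w < x < - L)
  (Kge : 3 * N ^+ 2 / (mu * w) <= K%:R) (Kle : K%:R <= 3 * N ^+ 2 / (mu * w) + 1).
Let k := (n + n).+1.
Let W := weight q u n.

Let N1 : 1 <= N. Proof. by rewrite ler1n. Qed.
Let N0 : 0 < N. Proof. exact: lt_le_trans N1. Qed.
Let t0 : 0 < t. Proof. exact: mulr_gt0. Qed.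
Let t10 : 0 < 1 + t. Proof. by rewrite addr_gt0. Qed.
Let g2 : g ^+ 2 <= 2. Proof. exact: crawford_sqr_le2 n0. Qed.
Let r0 : 0 < r. Proof. exact: density_bound_gt0 q0 qr intq p0. Qed.
Let pM : p <= 2 * M * r. Proof. have h := mass_le q0 qr intq p0 qM; exact: h. Qed.
Let w0 : 0 < w. Proof. exact: w_gt0. Qed.
Let eps0 : 0 < eps. Proof. exact: eps_gt0. Qed.
Let del0 : 0 < del. Proof. exact: del_gt0. Qed.
Let wN : 0 <= w * (1 + t). Proof. by rewrite ltW // mulr_gt0. Qed.

Local Notation "f <=w g" := (wle k W f g) (at level 70).
Local Notation At s := (randA A mu s).
Local Notation Bt s := (randB B mu s).

Let bW : rborel k W. Proof. exact: rborel_weight. Qed.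
Let W0 s : 0 <= W s. Proof. exact: weight_ge0. Qed.

Lemma entries_bounded s (l : nat) : W s != 0 -> (l < n + n)%N -> `|s`_l| <= M.
Proof.
move=> Ws ln; have := weight_support ln Ws; rewrite leNgt; apply: contra => h.
by rewrite qM.
Qed.

Lemma gridstart_range s : W s != 0 -> - L - w < s`_(n + n) < - L.
Proof. by rewrite /W /weight mulf_eq0 negb_or => /andP[_]; exact: u_supp. Qed.

Let d1M s : W s != 0 -> forall l : 'I_n, `|s`_l| <= M.
Proof. by move=> Ws l; apply: entries_bounded => //; rewrite (leq_trans (ltn_ord l)) // leq_addr. Qed.

Let d2M s : W s != 0 -> forall l : 'I_n, `|s`_(n + l)| <= M.
Proof. by move=> Ws l; apply: entries_bounded => //; rewrite ltn_add2l. Qed.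

Lemma weight_diag s : W s != 0 -> exists (S : 'M[C]_n) (a b : nat -> R),
  [/\ S \in unitmx, mxadj S *m At s *m S = rdiag n a & mxadj S *m Bt s *m S = rdiag n b].
Proof.
move=> Ws; exact: (@perturbed_diag _ _ A B mu M hA hB c0 mu0 tc (fun l => s`_l)
  (fun l => s`_(n + l)) (d1M Ws) (d2M Ws)).
Qed.

Lemma admissible_out (phib phik : R -> R) : measurable_fun setT phib ->
  measurable_fun setT phik -> (forall v, 0 <= phik v) ->
  admissible k (fun s => \sum_(i < n)
    site (Bt s + rdiag n (fun l => phib s`_l)) (fun l => phik s`_l) i).
Proof.
move=> mb mk k0; have bphi (phi : R -> R) l : measurable_fun setT phi -> rborel k (fun s => phi s`_l).
  by move=> mphi; apply: rborel_comp => //; exact: rborel_nth.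
apply: admissible_sum => i; apply: admissible_site => [s||l|s l].
- by apply: hermitianD; [exact: randB_hermitian|exact: hermitian_rdiag].
- by apply: mborelD; [exact: mborel_randB|apply: mborel_rdiag => l; exact: bphi].
- exact: bphi.
- exact: k0.
Qed.

Lemma admissible_pseudo j : admissible k (fun s => pseudo_count (At s) (Bt s) eps s`_(n + n) w j).
Proof.
have bmx : rborel k (fun s => Num.max 1 `|node n w j s|).
  move=> d T cc sc mc; apply: measurable_maxr; first exact: measurable_cst.
  by apply: measurableT_comp; [exact: normr_measurable|exact: rborel_node].
have c0' : 0 <= 71 / 50 * eps by have := eps0; move: eps => x; lra.
have bc : rborel k (fun s => 71 / 50 * eps * Num.max 1 `|node n w j s|).
  by apply: rborelM => //; exact: rborel_cst.
apply: admissible_sum => i; apply: admissible_site => [s||l|s l].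
- by apply: hermitianD; [exact: randH_hermitian|exact: hermitian_rdiag].
- by apply: mborelD; [exact: mborel_randH|apply: mborel_rdiag => l].
- by apply: rborelM; [exact: rborel_cst|exact: bc].
- by apply: mulr_ge0 => //; apply: mulr_ge0 => //; rewrite le_max ler01.
Qed.

Lemma admissible_collision j j' :
  admissible k (fun s => collision_count (At s) (Bt s) (1 + t) s`_(n + n) w j j').
Proof.
apply: admissible_sum => i; apply: admissibleM.
  split; last by move=> s; exact: ler0n.
  exact: (@rborel_jump _ _ A B mu hA hB 1 w j j').
by apply: admissible_site => [s||l|s l]; [exact: randH_hermitian|exact: mborel_randH|exact: rborel_cst|].
Qed.

Lemma pseudo_total : (fun s => \sum_(j < K.+2) pseudo_count (At s) (Bt s) eps s`_(n + n) w j) <=w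
  (fun=> K.+2%:R * (N * (r / p * (2 * (71 / 50 * eps) / mu)))).
Proof.
have c0' : 0 < 71 / 50 * eps by have := eps0; move: eps => x; lra.
pose x := N * (r / p * (2 * (71 / 50 * eps) / mu)).
have -> : (fun=> K.+2%:R * x) = (fun s : seq R => \sum_(j < K.+2) (fun=> x) s).
  by apply/funext => s; rewrite sumr_const card_ord mulr_natl.
have x0 : 0 <= x.
  apply: mulr_ge0; first exact: ltW.
  apply: mulr_ge0; first by rewrite divr_ge0 // ltW.
  by apply: divr_ge0; [apply: mulr_ge0 => //; exact: ltW|exact: ltW].
apply: (wle_sum bW W0) => [j|j|j].
- exact: admissible_pseudo.
- exact: admissible_cst.
exact: (pseudo_wle mq q0 qr intq p0 mu_ u0 hA hB mu0 w j c0').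
Qed.

Lemma collision_total :
  (fun s => \sum_(j < K.+1) 1 / 2 * (collision_count (At s) (Bt s) (1 + t) s`_(n + n) w j j.+1 +
     collision_count (At s) (Bt s) (1 + t) s`_(n + n) w j.+1 j)) <=w
  (fun=> 1 / 2 * (N * (r / p * (w * (1 + t) / mu)) * (N * (1 < n)%N%:R))).
Proof.
pose x := N * (r / p * (w * (1 + t) / mu)).
have x0 : 0 <= x.
  apply: mulr_ge0; first exact: ltW.
  apply: mulr_ge0; first by rewrite divr_ge0 // ltW.
  by apply: divr_ge0; [exact: wN|exact: ltW].
pose J j j' s : R := (jump A B mu 0 w j j' s)%:R.
have aJ j j' : admissible k (J j j').
  by split; [exact: (@rborel_jump _ _ A B mu hA hB 0 w j j')|move=> s; exact: ler0n].
pose Y j j' s := N * (r / p * (w * (1 + t) / mu * J j j' s)).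
have YE j j' s : Y j j' s = x * J j j' s by rewrite /Y /x !mulrA.
have aY j j' : admissible k (Y j j').
  have -> : Y j j' = (fun s => x * J j j' s) by apply/funext => s; exact: YE.
  by apply: admissibleM => //; exact: admissible_cst.
have cw j j' : (fun s => collision_count (At s) (Bt s) (1 + t) s`_(n + n) w j j') <=w Y j j' :=
  collision_wle mq q0 qr intq p0 mu_ u0 hA hB mu0 w j j' wN.
have half : 0 <= 1 / 2 :> R by rewrite divr_ge0.
have aD j := admissibleD (admissible_collision j j.+1) (admissible_collision j.+1 j).
have aYD j := admissibleD (aY j j.+1) (aY j.+1 j).
apply: (@wle_trans _ _ _ (fun s => \sum_(j < K.+1) 1 / 2 * (Y j j.+1 s + Y j.+1 j s))).
  apply: (wle_sum bW W0) => [j|j|j].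
  - apply: admissibleM; [exact: admissible_cst|exact: aD].
  - apply: admissibleM; [exact: admissible_cst|exact: aYD].
  apply: (wleZ bW W0 half (aD j) (aYD j)).
  exact: (wleD bW W0 (admissible_collision _ _) (admissible_collision _ _) (aY _ _) (aY _ _)).
apply: wle_support => // [s|s sk Ws].
  apply: sumr_ge0 => j _; have [_ h1] := aY j j.+1; have [_ h2] := aY j.+1 j.
  by rewrite mulr_ge0 // addr_ge0.
have -> : \sum_(j < K.+1) 1 / 2 * (Y j j.+1 s + Y j.+1 j s) =
    1 / 2 * (x * \sum_(j < K.+1) (J j j.+1 s + J j.+1 j s)).
  rewrite !mulr_sumr; apply: eq_bigr => j _.
  by rewrite !YE -mulrDr.
apply: ler_wpM2l => //; apply: ler_wpM2l => //.
(* Where the weight is nonzero the entries are bounded by [M], so the pencil can be diagonalized and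
   all cells together contribute at most [n] of the surviving unit jumps. *)
have [S [a [b [uS dA dB]]]] := weight_diag Ws.
exact: (sum_gaps_le _ (f := fun j => nneg (randH A B mu w j s))
  (sum_jumps_le uS dA dB s`_(n + n) K.+1 w0)).
Qed.

Let L0 : 0 < L. Proof. by rewrite /L divr_gt0 ?mulr_gt0 ?exprn_gt0. Qed.

Let dL : del * L = 1.
Proof. by rewrite /del /L; field; rewrite !gt_eqF. Qed.

Lemma weight_shattered (Ko : 'M[C]_n) (kap : nat -> R) s : W s != 0 -> (forall l, 0 <= kap l) ->
  (forall (S : 'M[C]_n) (a b : nat -> R) (l : 'I_n), S \in unitmx ->
     mxadj S *m At s *m S = rdiag n a -> mxadj S *m Bt s *m S = rdiag n b ->
     `|b l| < del * `|a l| -> (nneg Ko < nneg (Ko - rdiag n kap))%N) ->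
  \sum_(i < n) site Ko kap i + (\sum_(j < K.+2) pseudo_count (At s) (Bt s) eps s`_(n + n) w j +
    \sum_(j < K.+1) 1 / 2 * (collision_count (At s) (Bt s) (1 + t) s`_(n + n) w j j.+1 +
     collision_count (At s) (Bt s) (1 + t) s`_(n + n) w j.+1 j)) < 1 ->
  shattered eps (At s) (Bt s) (grid s`_(n + n) w K).
Proof.
move=> Ws kap0 out lt1; have [S [a [b [uS dA dB]]]] := weight_diag Ws.
have g20 : 0 < g / 2 by rewrite divr_gt0.
have leB : form_le (1 + t) (Bt s) := @perturb_form_le _ n mu M (ltW mu0) B _ B1 (d2M Ws).
have cr : crawford_ge (g / 2) (At s) (Bt s).
  exact: (@crawford_perturb _ n mu M (ltW mu0) A B _ _ hA hB (ltW c0) (ltW tc) (d1M Ws) (d2M Ws)).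
have wgap : w < 2 * (g / 2) / (1 + t) := gap_small mu0 M0 c0 g2 tc N1 r0 pM pr.
have /andP[z1 z2] := gridstart_range Ws.
(* The start is less than [w] below [- L]; one step makes up for this, and the other [K] steps cover
   [2 L]. *)
have Lz : L < s`_(n + n) + K.+1%:R * w.
  have wK : 2 * L <= K%:R * w.
    have -> : 2 * L = 3 * N ^+ 2 / (mu * w) * w by rewrite /L; by apply: double_ratio; rewrite gt_eqF.
    by rewrite ler_wpM2r // ltW.
  by rewrite -natr1 mulrDl mul1r; move: z1 wK; move: (s`_(n + n)) (K%:R * w) => x y; lra.
have h := good_event (randA_hermitian mu hA s) (randB_hermitian mu hB s) uS dA dB t10 g20 leB cr eps0 w0 wgap
  L0 dL z2 Lz kap0 (fun l => out S a b l uS dA dB).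
exact: h lt1.
Qed.

(* The union bound over the resonances: an eigenvalue beyond the grid, a grid point in the
   pseudospectrum, and two eigenvalues in one cell. *)
Lemma shattering_bound (F : seq R -> \bar R) : (forall s, 0 <= F s)%E ->
  (forall s, size s = k -> W s != 0 -> shattered eps (At s) (Bt s) (grid s`_(n + n) w K) ->
     ((W s)%:E <= F s)%E) ->
  ((p ^+ (n + n) - 2 * r / N / p * p ^+ (n + n))%:E <= iint k F)%E.
Proof.
move=> F0 WF.
have sgt : p * mu / r <= 2 * t := sg_le_t mu0 r0 pM.
have th : t < 1 / 2 := t_lt_half mu0 M0 g2 tc.
have delt : del * (1 + t) <= t := del_small mu0 M0 g2 tc N1 r0 pM pr.
have [phib [phik [a [[mb mk k0 ik] [a0 aE out]]]]] :=
  outside_choice hA hB A1 c0 mu0 M0 tc mq q0 qr intq p0 qM th del0 delt sgt.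
pose X1 s := \sum_(i < n) site (Bt s + rdiag n (fun l => phib s`_l)) (fun l => phik s`_l) i.
pose X2 s := \sum_(j < K.+2) pseudo_count (At s) (Bt s) eps s`_(n + n) w j.
pose X3 s := \sum_(j < K.+1) 1 / 2 * (collision_count (At s) (Bt s) (1 + t) s`_(n + n) w j j.+1 +
     collision_count (At s) (Bt s) (1 + t) s`_(n + n) w j.+1 j).
pose T1 := N * (r / p * (a / mu)).
pose T2 := K.+2%:R * (N * (r / p * (2 * (71 / 50 * eps) / mu))).
pose T3 := 1 / 2 * (N * (r / p * (w * (1 + t) / mu)) * (N * (1 < n)%N%:R)).
have aX1 : admissible k X1 by exact: admissible_out.
have aX2 : admissible k X2 by apply: admissible_sum => j; exact: admissible_pseudo.
have aX3 : admissible k X3.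
  apply: admissible_sum => j; apply: admissibleM.
    by apply: admissible_cst; rewrite divr_ge0.
  exact: admissibleD (admissible_collision _ _) (admissible_collision _ _).
have rp0 : 0 <= r / p by rewrite divr_ge0 // ltW.
have T10 : 0 <= T1.
  by apply: mulr_ge0; [exact: ltW|apply: mulr_ge0 => //; rewrite divr_ge0 // ltW].
have e0' : 0 <= 2 * (71 / 50 * eps) by have := eps0; move: eps => x; lra.
have T20 : 0 <= T2.
  apply: mulr_ge0; first exact: ler0n.
  by apply: mulr_ge0; [exact: ltW|apply: mulr_ge0 => //; rewrite divr_ge0 // ltW].
have T30 : 0 <= T3.
  apply: mulr_ge0; first by rewrite divr_ge0.
  apply: mulr_ge0; last by apply: mulr_ge0; [exact: ltW|exact: ler0n].
  by apply: mulr_ge0; [exact: ltW|apply: mulr_ge0 => //; rewrite divr_ge0 // ltW].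
have le : T1 + (T2 + T3) <= 2 * r / N / p.
  apply: (total_budget mu0 M0 c0 g2 tc N1 r0 p0 pM pr (a := a) (K2 := K.+2%:R) (big := (1 < n)%N)).
  - by move=> n1; rewrite /N (ler_nat _ 2).
  - by rewrite -leqNgt => n1; rewrite /N (_ : n = 1%N) //; apply/eqP; rewrite eqn_leq n1.
  - have := Kle; have -> : K.+2%:R = K%:R + 2 :> R by rewrite -addn2 natrD.
    move: (K%:R : R) (_ / (mu * w)) => x y; lra.
  - exact: aE.
have wX : (fun s => X1 s + (X2 s + X3 s)) <=w (fun=> T1 + (T2 + T3)).
  apply: (wleD bW W0) => //; do ?exact: admissible_cst.
  - exact: admissibleD.
  - exact: admissible_cst (addr_ge0 _ _).
  - exact: (out_wle mq q0 qr intq p0 mu_ u0 hB mu0 mb mk k0 a0 ik).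
  apply: (wleD bW W0) => //; do ?exact: admissible_cst.
  - exact: pseudo_total.
  exact: collision_total.
have aX : admissible k (fun s => X1 s + (X2 s + X3 s)) by apply: admissibleD => //; exact: admissibleD.
have iW : iint k (fun s => (W s)%:E) = (p ^+ (n + n))%:E by exact: iint_product.
have T0 : 0 <= T1 + (T2 + T3) by rewrite !addr_ge0.
apply: le_trans (failure_bound bW W0 aX iW wX T0 F0 _).
  rewrite lee_fin lerD2l lerN2; apply: ler_wpM2r le; exact: exprn_ge0 (ltW p0).
move=> s sk lt1; have [->|Ws] := eqVneq (W s) 0; first exact: F0.
apply: WF => //; apply: (weight_shattered Ws _ _ lt1) => [l|S a' b' l uS dA dB bl].
  exact: k0.
exact: (out (fun l => s`_l) (fun l => s`_(n + l)) S a' b' l (d1M Ws) (d2M Ws) uS dA dB bl).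
Qed.

End ShatteringProbability.

Lemma perturbation_small (R : realType) (mu M g : R) : 0 < mu -> 0 < M ->
  mu < g / (2 * Num.sqrt 2 * M) -> 8 * (mu * M) ^+ 2 < g ^+ 2.
Proof.
move=> mu0 M0; have s0 : 0 < Num.sqrt 2 :> R by rewrite sqrtr_gt0.
rewrite ltr_pdivlMr ?mulr_gt0 // => h.
have s2 : Num.sqrt 2 ^+ 2 = 2 :> R by rewrite sqr_sqrtr.
have -> : 8 * (mu * M) ^+ 2 = (mu * (2 * Num.sqrt 2 * M)) ^+ 2.
  by rewrite !exprMn s2; ring.
have h0 : 0 < mu * (2 * Num.sqrt 2 * M) by rewrite !mulr_gt0.
by rewrite ltr_sqr ?nnegrE // ltW // (lt_trans h0).
Qed.

Lemma mass_margin (R : realFieldType) (theta N c : R) : 0 < theta -> 1 <= N ->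
  0 < 1 - 2 * N * theta - c -> c <= 1 - theta.
Proof. by move=> *; nra. Qed.

(** The failure probability carries [1/p] but also [p ^ (2 n)], and [p ^ (2 n - 1) <= 1] absorbs the
    quotient. Bernoulli's inequality turns the remaining [p ^ (2 n)] into [1 - 2 n theta]. *)
Lemma final_bound (R : realFieldType) (p theta c : R) (n : nat) : (0 < n)%N -> 0 <= theta <= 1 ->
  1 - theta <= p -> 0 < p <= 1 -> 0 <= c ->
  1 - 2 * n%:R * theta - 2 * c <= p ^+ (n + n) - 2 * c / p * p ^+ (n + n).
Proof.
move=> n0 th pth /andP[p0 p1] c0; have /andP[th0 th1] := th.
have b := bernoulli_ineq (n + n) th.
have q0 : 0 <= 1 - theta by rewrite subr_ge0.
have b2 : (1 - theta) ^+ (n + n) <= p ^+ (n + n) by rewrite lerXn2r ?nnegrE // ltW.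
have n2 : (0 < n + n)%N by rewrite addn_gt0 n0.
have le1 : 2 * c / p * p ^+ (n + n) <= 2 * c.
  rewrite -(prednK n2) exprS mulrA divfK ?gt_eqF // ler_piMr ?mulr_ge0 //.
  by rewrite exprn_ile1 // ltW.
move: b b2 le1; rewrite natrD; move: (_ ^+ _) (_ ^+ _) (_ * _ ^+ _) => x y z; lra.
Qed.

Lemma ceil_absz_bounds (R : realType) (y : R) : 0 <= y ->
  y <= (`|Num.ceil y|%N)%:R /\ (`|Num.ceil y|%N)%:R <= y + 1.
Proof.
move=> y0; have c0 : 0 <= Num.ceil y by rewrite ceil_ge0 (lt_le_trans _ y0) // ltrN10.
rewrite natr_absz ger0_norm //; have := ceilB1_lt y.
by rewrite ceil_ge intrD ltrBlDr => /ltW.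
Qed.

Theorem theorem3p9 (R : realType) :
  exists Cst : R,
  forall (rho : R -> R) (M theta : R) (n : nat) (A B : 'M[R[i]]_n) (mu : R),
    is_density rho -> ubounded_density rho ->
    0 < M -> 0 < theta < 1 ->
    (\int[lebesgue_measure]_(x in [set x : R | (M < `|x|)%R]) (rho x)%:E
       <= theta%:E)%E ->
    (0 < n)%N ->
    definite_pencil A B -> specnorm A <= 1 -> specnorm B <= 1 ->
    0 < mu -> mu < crawford A B / (2 * Num.sqrt 2 * M) ->
    (((1 - Cst * supnorm rho ^+ 2 / n%:R)
      * (1 - 2 * n%:R * theta - 2 * supnorm rho / n%:R))%:E
     <= shatter_prob rho mu A B)%E.
Proof.
exists 0 => rho M theta n A B mu density bounded M0 /andP[th0 th1] tail n0 [hA [hB c0]] A1 B1 mu0 muM.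
rewrite mul0r mul0r subr0 mul1r /shatter_prob.
have [mrho rho0 _] := density.
pose g := crawford A B; pose r := supnorm rho.
pose w := mu ^+ 3 * g ^+ 2 / n%:R ^+ 5; pose a := - (3 * n%:R ^+ 2 / (2 * mu)).
have tc := perturbation_small mu0 M0 muM.
have n1 : 1 <= n%:R :> R by rewrite ler1n.
have N0 : 0 < n%:R :> R by rewrite ltr0n.
have w0 : 0 < w by rewrite divr_gt0 ?mulr_gt0 ?exprn_gt0.
have rhor x : rho x <= r by exact: le_supnorm.
have r0 : 0 <= r by exact: le_trans (rho0 0) (rhor 0).
set F := (X in iint _ X).
have prod0 s : 0 <= \prod_(i < n + n) rho s`_i by exact: prodr_ge0.
have u0 x : 0 <= uniform_density a w x by exact: uniform_density_ge0.
have F0 s : (0 <= F s)%E.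
  rewrite lee_fin; apply: mulr_ge0 (u0 s`_(n + n)).
  by apply: mulr_ge0 => //; case: ifP.
have [small|big] := leP (1 - 2 * n%:R * theta - 2 * r / n%:R) 0.
  apply: (@le_trans _ _ 0%E); first by rewrite lee_fin.
  exact: iint_ge0.
have [p [intq /andP[p1 p2]]] := truncated_mass density tail.
have q0 x : 0 <= truncated rho M x by rewrite /truncated; case: ifP.
have qr x : truncated rho M x <= r by rewrite /truncated; case: ifP.
have qM x : M < `|x| -> truncated rho M x = 0 by rewrite /truncated leNgt => ->.
have p0 : 0 < p by apply: lt_le_trans p1; rewrite subr_gt0.
(* When the claimed bound is positive, [2 r / n <= 1 - theta <= p]. This is the relation [2 m <= sg]
   by which the averaging over [D_1] pays for the grid points. *)
have pr : 2 * r <= p * n%:R.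
  rewrite -ler_pdivrMr //; apply: le_trans p1.
  exact: mass_margin th0 n1 big.
have u_supp x : uniform_density a w x != 0 -> a - w < x < a.
  by rewrite /uniform_density; case: asboolP => //; rewrite eqxx.
have y0 : 0 <= 3 * n%:R ^+ 2 / (mu * w).
  exact: divr_ge0 (mulr_ge0 (ler0n _ 3) (sqr_ge0 _)) (ltW (mulr_gt0 mu0 w0)).
have [Kge Kle] := ceil_absz_bounds y0.
have bound := shattering_bound n0 hA hB A1 B1 c0 mu0 M0 tc (measurable_truncated M mrho) q0 qr intq p0
  qM pr (measurable_uniform_density a w) u0 (integral_uniform_density a w0) u_supp Kge Kle F0.
apply: le_trans (bound _); last first.
  (* On the support of the weight the truncated density agrees with [rho], so the integrand of the
     theorem equals the weight wherever shattering holds. *)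
  move=> s sk Ws sh; rewrite lee_fin le_eqVlt; apply/orP; left; apply/eqP.
  rewrite asboolT // mul1r /weight; congr (_ * _); apply: eq_bigr => l _.
  rewrite /truncated (_ : `|s`_l| <= M) //.
  exact: (entries_bounded qM Ws).
rewrite lee_fin.
have -> : 2 * r / n%:R = 2 * (r / n%:R) by rewrite mulrA.
have th : 0 <= theta <= 1 by rewrite !ltW.
have p01 : 0 < p <= 1 by rewrite p0.
exact: final_bound n0 th p1 p01 (divr_ge0 r0 (ltW N0)).
Qed.
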